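(* Let $\pi:M\to B$ be a fiber bundle with $M$ a 5-dimensional manifold with volume form $\Omega$ and $B$ an oriented 2-manifold with area form $\omega$. Let $\Pi$ be an almost coupling Poisson tensor on $M$ associated with a Poisson triple $(\gamma,\kappa,\beta)$, and let $(\mu,c)$ be an arbitrary pair consisting of a horizontal 1-form $\mu\in\Gamma\mathbb V^\circ$ and a Casimir function $c\in C^\infty(M)$ of $P_\beta$ ($d_{0,1}c\wedge\beta=0$). Then the symmetry transformation $\rho_{1/\varepsilon}\circ\mathcal T_{\mu,c}\circ\rho_\varepsilon$ induces the following smooth $\varepsilon$-dependent family $\{\Pi_\varepsilon\}_{\varepsilon\in\mathbb R}$ of Poisson structures: $$\Pi_\varepsilon=\frac{\kappa}{1-\varepsilon\kappa(\varkappa_{\mu,\varepsilon}-c)}\,\mathrm{hor}^{\gamma_\varepsilon}\psi-\mathbf i_\beta Q_{\mathrm V},$$ where $\gamma_\varepsilon(X)=\gamma(X)+\varepsilon\,\mathbf i_{d_{0,1}\mu\wedge\beta}(Q_{\mathrm V}\wedge X)$ for any vector field $X$ on $M$, and $\varkappa_{\mu,\varepsilon}\in C^\infty(M)$ is defined by $$\varkappa_{\mu,\varepsilon}=\frac{d_{1,0}^\gamma\mu+\frac{\varepsilon}{2}\{\mu\wedge\mu\}_\beta}{\pi^*\omega};$$ here $\Pi_\varepsilon$ is considered on the open set $\mathrm{Dom}(\Pi_\varepsilon)=\{p\in M:1-\varepsilon\kappa(p)(\varkappa_{\mu,\varepsilon}(p)-c(p))\ne0\}$.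
   Context: All objects are smooth. A fiber bundle $\pi:M\to B$ is a surjective submersion; $\mathbb V=\ker d\pi\subset TM$ is the vertical subbundle (rank 3 here). An Ehresmann connection is a bundle morphism $\gamma:TM\to\mathbb V$ with $\gamma|_{\mathbb V}=\mathrm{id}$; $\mathbb H=\ker\gamma$ is the horizontal subbundle, so $TM=\mathbb H\oplus\mathbb V$ and $T^*M=\mathbb V^\circ\oplus\mathbb H^\circ$ (annihilators). These splittings bigrade multivector fields and forms: a multivector field has bidegree $(p,q)$ if it is a section of $\wedge^p\mathbb H\otimes\wedge^q\mathbb V$, and a form has bidegree $(p,q)$ if it is a section of $\wedge^p\mathbb V^\circ\otimes\wedge^q\mathbb H^\circ$. The exterior differential splits as $d=d_{1,0}+d_{0,1}+d_{2,-1}$, where for a $(p,q)$-form $\alpha$, $d_{i,j}\alpha$ is the bidegree $(p+i,q+j)$ component of $d\alpha$ (depending on $\gamma$; write $d_{1,0}^\gamma$ for emphasis). For a multivector field $\psi$ on $B$, $\mathrm{hor}^\gamma\psi$ is its $\gamma$-horizontal lift. Interior products: $\mathbf i_{X\wedge Y}=\mathbf i_X\circ\mathbf i_Y$ for vector fields acting on forms; similarly $\mathbf i_{\alpha\wedge\alpha'}=\mathbf i_\alpha\circ\mathbf i_{\alpha'}$ for 1-forms acting on multivector fields, with $\mathbf i_\alpha$ inserting $\alpha$ in the first slot. Let $\Omega^{\mathrm H}=\pi^*\omega$ and let $\Omega^{\mathrm V}\in\Gamma\wedge^3\mathbb H^\circ$ be the unique form with $\Omega=\Omega^{\mathrm H}\wedge\Omega^{\mathrm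 V}$. Let $Q_{\mathrm H}\in\Gamma\wedge^2\mathbb H$, $Q_{\mathrm V}\in\Gamma\wedge^3\mathbb V$ be determined by $\mathbf i_{Q_{\mathrm H}}\Omega^{\mathrm H}=1$, $\mathbf i_{Q_{\mathrm V}}\Omega^{\mathrm V}=1$ ($Q_{\mathrm V}$ does not depend on $\gamma$), and let $\psi\in\Gamma\wedge^2TB$ satisfy $\mathbf i_\psi\omega=-1$. Put $P_\beta=-\mathbf i_\beta Q_{\mathrm V}$, $\theta=-\mathbf i_{Q_{\mathrm V}}d_{1,0}\Omega^{\mathrm V}$, $\varrho=\mathbf i_{Q_{\mathrm H}}d_{2,-1}\Omega^{\mathrm V}$. A triple $(\gamma,\kappa,\beta)$, consisting of an Ehresmann connection $\gamma$, a smooth function $\kappa$ and $\beta\in\Gamma\mathbb H^\circ$, is a Poisson triple (relative to $(\Omega,\omega)$) if $$d_{0,1}\beta\wedge\beta=0,\quad \kappa\,(d_{1,0}\beta-\theta\wedge\beta)=0,\quad d_{0,1}\kappa\wedge\beta-\kappa^2\varrho=0,$$ all $\gamma$-dependent objects being taken with respect to the connection of the triple. The almost coupling Poisson tensor associated with (induced by) a Poisson triple is $\Pi=\kappa\,\mathrm{hor}^\gamma\psi+P_\beta$. The bracket of $P_\beta$ is $\{f_1,f_2\}_\beta=-Q_{\mathrm V}(\beta,df_1,df_2)=P_\beta(df_1,df_2)$. For a horizontal 1-form $\mu$, $\{\mu\wedge\mu\}_\beta$ is the 2-form of bidegree $(2,0)$ with $\{\mu\wedge\mu\}_\beta(Y_1,Y_2)=\{\mu(Y_1),\mu(Y_2)\}_\beta-\{\mu(Y_2),\mu(Y_1)\}_\beta$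 for $Y_i=\mathrm{hor}^\gamma u_i$, $u_i$ vector fields on $B$. A quotient of a $(2,0)$-form by $\pi^*\omega$ denotes the unique function $f$ with form $=f\,\pi^*\omega$. Transformations of triples: $\rho_\varepsilon(\gamma,\kappa,\beta)=(\gamma,\varepsilon\kappa,\varepsilon\beta)$, and $\mathcal T_{\mu,c}(\gamma,\kappa,\beta)=(\widetilde\gamma,\widetilde\kappa,\beta)$ with $\widetilde\gamma(X)=\gamma(X)+\mathbf i_{d_{0,1}\mu\wedge\beta}(Q_{\mathrm V}\wedge X)$, $\widetilde\kappa=\dfrac{\kappa}{1-\kappa(\varkappa_\mu-c)}$, $\varkappa_\mu=\varkappa_\mu(\gamma,\beta)=\big(d_{1,0}^\gamma\mu+\frac12\{\mu\wedge\mu\}_\beta\big)/\pi^*\omega$ (defined where the denominator of $\widetilde\kappa$ is nonzero). The composition $\rho_{1/\varepsilon}\circ\mathcal T_{\mu,c}\circ\rho_\varepsilon$ is taken for $\varepsilon\neq0$; for $\varepsilon=0$ the displayed formula gives $\Pi_0=\Pi$. *)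

(* Defs.v *)
From HB Require Import structures.
From mathcomp Require Import all_boot all_order all_fingroup all_algebra.
From mathcomp Require Import all_classical all_reals all_analysis.
Set Implicit Arguments.
Unset Strict Implicit.
Unset Printing Implicit Defensive.
Import Order.TTheory GRing.Theory Num.Theory.
Import numFieldNormedType.Exports.
Local Open Scope classical_set_scope.
Local Open Scope ring_scope.

Fixpoint class_C (R : realType) (n : nat) (W : normedModType R) (k : nat)
    (U : set 'rV[R]_n) (f : 'rV[R]_n -> W) : Prop :=
  if k is k'.+1 then
    (forall x, U x -> differentiable f x) /\
    (forall v, class_C k' U (fun x => 'D_v f x))
  else forall x, U x -> {for x, continuous f}.

(* Only used for open U. *)
Definition smooth_on (R : realType) (n : nat) (W : normedModType R)
    (U : set 'rV[R]_n) (f : 'rV[R]_n -> W) : Prop :=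
  forall k, class_C k U f.

(* A homeomorphism of the open set chart_dom onto the open set chart_im; the
   values of chart_fun and chart_inv outside these sets are irrelevant. *)
Record chart (R : realType) (T : topologicalType) (n : nat) := Chart {
  chart_dom : set T;
  chart_im : set 'rV[R]_n;
  chart_fun :> T -> 'rV[R]_n;
  chart_inv : 'rV[R]_n -> T;
  chart_dom_open : open chart_dom;
  chart_im_open : open chart_im;
  chart_funP : forall p, chart_dom p -> chart_im (chart_fun p);
  chart_invP : forall x, chart_im x -> chart_dom (chart_inv x);
  chart_funK : forall p, chart_dom p -> chart_inv (chart_fun p) = p;
  chart_invK : forall x, chart_im x -> chart_fun (chart_inv x) = x;
  chart_fun_cont : forall p, chart_dom p -> {for p, continuous chart_fun};
  chart_inv_cont : forall x, chart_im x -> {for x, continuous chart_inv} }.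

(* Each point has a preferred chart chart_at, through which its tangent space
   is identified with R^n. *)
Record manifold (R : realType) (n : nat) := Manifold {
  manifold_sort :> topologicalType;
  manifold_hausdorff : hausdorff_space manifold_sort;
  manifold_second_countable : @second_countable manifold_sort;
  atlas : set (chart R manifold_sort n);
  chart_at : manifold_sort -> chart R manifold_sort n;
  chart_at_atlas : forall p, atlas (chart_at p);
  chart_at_dom : forall p, chart_dom (chart_at p) p;
  atlas_compat : forall c c', atlas c -> atlas c' ->
    smooth_on [set x | chart_im c x /\ chart_dom c' (chart_inv c x)]
      (c' \o chart_inv c) }.

(* Vectors and covectors of R^n are row vectors, paired by v *m xi^T.
   Both k-forms and k-vectors on R^n are alternating k-linear functions of the
   k rows of a k x n matrix: a k-form takes vectors, a k-vector covectors. *)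
Section ExteriorAlgebra.
Context {R : realType} {n : nat}.

Definition alternating (k : nat) (a : 'M[R]_(k, n) -> R) : Prop :=
  (forall (W : 'M[R]_(k, n)) (i : 'I_k) (r : R) (u v : 'rV[R]_n),
     let subst w := \matrix_l (if l == i then w else row l W) in
     a (subst (r *: u + v)) = r * a (subst u) + a (subst v)) /\
  (forall (W : 'M[R]_(k, n)) (i j : 'I_k),
     i != j -> row i W = row j W -> a W = 0).

(* Normalised so that (a /\ b)(u, v) = a(u) b(v) - a(v) b(u) in degree 1. *)
Definition wedge (k l : nat) (a : 'M[R]_(k, n) -> R) (b : 'M[R]_(l, n) -> R)
    : 'M[R]_(k + l, n) -> R := fun W =>
  (k`! * l`!)%:R^-1 * \sum_(s : 'S_(k + l)) (-1) ^+ s *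
    (a (usubmx (row_perm s W)) * b (dsubmx (row_perm s W))).

(* The interior product i_A b, bilinear with i_(X1 /\ ... /\ Xk) =
   i_X1 o ... o i_Xk and (i_X b)(W) = b(X, W); hence
   (i_(X1 /\ ... /\ Xk) b)(W) = b(Xk, ..., X1, W).  It serves both for
   k-vectors acting on forms and for k-forms acting on multivectors. *)
Definition iprod (k l : nat) (A : 'M[R]_(k, n) -> R) (b : 'M[R]_(k + l, n) -> R)
    : 'M[R]_(l, n) -> R := fun W =>
  k`!%:R^-1 * \sum_(J : {ffun 'I_k -> 'I_n})
    A (\matrix_i delta_mx 0 (J i)) *
    b (col_mx (\matrix_i delta_mx 0 (J (rev_ord i))) W).

Definition vec1 (v : 'rV[R]_n) : 'M[R]_(1, n) -> R := fun xi => (v *m xi^T) 0 0.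
Definition unvec1 (a : 'M[R]_(1, n) -> R) : 'rV[R]_n := \row_j a (delta_mx 0 j).

(* For complementary projections P1, P2 of R^n: the component of a of degree
   p along P1 and k - p along P2. *)
Definition bicomp (P1 P2 : 'M[R]_n) (p k : nat) (a : 'M[R]_(k, n) -> R)
    : 'M[R]_(k, n) -> R := fun W =>
  \sum_(S : {set 'I_k} | #|S| == p)
    a (\matrix_i (row i W *m (if i \in S then P1 else P2))).

End ExteriorAlgebra.

(* Tensor fields are total functions; smoothness, and any other property, is
   required only on a given open set. *)
Definition dform (R : realType) (n : nat) (M : manifold R n) (k : nat) :=
  M -> 'M[R]_(k, n) -> R.
Definition mvec (R : realType) (n : nat) (M : manifold R n) (k : nat) :=
  M -> 'M[R]_(k, n) -> R.

Section Tensors.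
Context {R : realType} {n : nat} {M : manifold R n}.

(* The tangent map of the chart c, from T_pM to R^n. *)
Definition to_chart (c : chart R M n) (p : M) : 'M[R]_n :=
  jacobian (c \o chart_inv (chart_at p)) (chart_at p p).

(* Its inverse, from R^n to the tangent space at the point of coordinates x. *)
Definition of_chart (c : chart R M n) (x : 'rV[R]_n) : 'M[R]_n :=
  jacobian (chart_at (chart_inv c x) \o chart_inv c) x.

Definition form_in (k : nat) (c : chart R M n) (a : dform M k)
    (x : 'rV[R]_n) : 'M[R]_(k, n) -> R :=
  fun W => a (chart_inv c x) (W *m of_chart c x).

Definition mvec_in (k : nat) (c : chart R M n) (A : mvec M k)
    (x : 'rV[R]_n) : 'M[R]_(k, n) -> R :=
  fun Xi => A (chart_inv c x) (Xi *m (to_chart c (chart_inv c x))^T).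

Definition endo_in (c : chart R M n) (g : M -> 'M[R]_n) (x : 'rV[R]_n)
    : 'M[R]_n :=
  of_chart c x *m g (chart_inv c x) *m to_chart c (chart_inv c x).

Definition coord_set (c : chart R M n) (U : set M) : set 'rV[R]_n :=
  [set x | chart_im c x /\ U (chart_inv c x)].

Definition smooth_fun (U : set M) (f : M -> R) : Prop :=
  forall c, atlas c -> smooth_on (coord_set c U) (f \o chart_inv c).

Definition smooth_endo (U : set M) (g : M -> 'M[R]_n) : Prop :=
  forall c, atlas c -> smooth_on (coord_set c U) (endo_in c g).

Definition is_form (U : set M) (k : nat) (a : dform M k) : Prop :=
  (forall p, U p -> alternating (a p)) /\
  (forall c W, atlas c ->
     smooth_on (coord_set c U) (fun x => form_in c a x W)).

Definition is_mvec (U : set M) (k : nat) (A : mvec M k) : Prop :=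
  (forall p, U p -> alternating (A p)) /\
  (forall c Xi, atlas c ->
     smooth_on (coord_set c U) (fun x => mvec_in c A x Xi)).

Definition volume_form (a : dform M n) : Prop :=
  is_form setT a /\ forall p, exists W, a p W != 0.

Definition fun_form (f : M -> R) : dform M 0 := fun p _ => f p.

(* The usual coordinate formula, in the preferred chart of the point. *)
Definition extd (k : nat) (a : dform M k) : dform M k.+1 := fun p W =>
  \sum_(i < k.+1) (-1) ^+ i *
    'D_(row i W) (fun x => form_in (chart_at p) a x (row' i W)) (chart_at p p).

Definition dfun (f : M -> R) (p : M) : 'rV[R]_n :=
  unvec1 (extd (fun_form f) p).

Definition bracket (A : mvec M 2) (f g : M -> R) : M -> R :=
  fun p => A p (col_mx (dfun f p) (dfun g p)).

Definition Poisson (U : set M) (A : mvec M 2) : Prop :=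
  is_mvec U A /\
  forall f g h, smooth_fun U f -> smooth_fun U g -> smooth_fun U h ->
  forall p, U p ->
    bracket A f (bracket A g h) p + bracket A g (bracket A h f) p +
    bracket A h (bracket A f g) p = 0.

(* Joint smoothness of (e, p) |-> A e p on the open set of the (e, p) with
   p in D e; a point of the product of the real line and R^n is a row vector
   of size 1 + n. *)
Definition smooth_family (k : nat) (D : R -> set M) (A : R -> mvec M k)
    : Prop :=
  open [set q : R * M | D q.1 q.2] /\
  forall c Xi, atlas c ->
    smooth_on
      [set y : 'rV[R]_(1 + n) | coord_set c (D (lsubmx y 0 0)) (rsubmx y)]
      (fun y => mvec_in c (A (lsubmx y 0 0)) (rsubmx y) Xi).

End Tensors.

Section Maps.
Context {R : realType} {m n : nat} {M : manifold R m} {B : manifold R n}.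
Variable pi : M -> B.

Definition smooth_map : Prop :=
  continuous pi /\
  forall c c', atlas c -> atlas c' ->
    smooth_on [set x | chart_im c x /\ chart_dom c' (pi (chart_inv c x))]
      (c' \o pi \o chart_inv c).

Definition tangent (p : M) : 'M[R]_(m, n) :=
  jacobian (chart_at (pi p) \o pi \o chart_inv (chart_at p)) (chart_at p p).

Definition fiber_bundle : Prop :=
  [/\ smooth_map, forall b, exists p, pi p = b & forall p, row_full (tangent p)].

Definition vertical (p : M) (v : 'rV[R]_m) : Prop := v *m tangent p = 0.

Definition pullback (k : nat) (a : dform B k) : dform M k :=
  fun p W => a (pi p) (W *m tangent p).

(* A connection acts on tangent vectors by v |-> v *m gamma p. *)
Definition connection (U : set M) (gamma : M -> 'M[R]_m) : Prop :=
  smooth_endo U gamma /\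
  forall p, U p -> forall v,
    vertical p (v *m gamma p) /\ (vertical p v -> v *m gamma p = v).

(* The matrix of the horizontal lift T_(pi p)B -> T_pM: the horizontal part of
   a right inverse of the tangent map of pi. *)
Definition hlift (gamma : M -> 'M[R]_m) (p : M) : 'M[R]_(n, m) :=
  pinvmx (tangent p) *m (1%:M - gamma p).

Definition hor (gamma : M -> 'M[R]_m) (k : nat) (A : mvec B k) : mvec M k :=
  fun p Xi => A (pi p) (Xi *m (hlift gamma p)^T).

Definition hor_vf (gamma : M -> 'M[R]_m) (u : B -> 'rV[R]_n) (p : M)
    : 'rV[R]_m := u (pi p) *m hlift gamma p.

End Maps.

Section Bigrading.
Context {R : realType} {n : nat} {M : manifold R n}.
Variable gamma : M -> 'M[R]_n.

Definition horizontal (p : M) (v : 'rV[R]_n) : Prop := v *m gamma p = 0.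

(* The component of bidegree (i, k - i) of a k-form. *)
Definition form_comp (i k : nat) (a : dform M k) : dform M k :=
  fun p => bicomp (1%:M - gamma p) (gamma p) i (a p).

(* Bidegree (i, k - i), at the point p. *)
Definition form_bideg (p : M) (i k : nat) (a : 'M[R]_(k, n) -> R) : Prop :=
  alternating a /\ bicomp (1%:M - gamma p) (gamma p) i a = a.
Definition mvec_bideg (p : M) (i k : nat) (A : 'M[R]_(k, n) -> R) : Prop :=
  alternating A /\ bicomp (1%:M - gamma p)^T (gamma p)^T i A = A.

(* Below, a is a form of bidegree (i, k - i). *)
Definition d10 (i k : nat) (a : dform M k) : dform M k.+1 :=
  form_comp i.+1 (extd a).
Definition d01 (i k : nat) (a : dform M k) : dform M k.+1 :=
  form_comp i (extd a).
Definition d2m1 (i k : nat) (a : dform M k) : dform M k.+1 :=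
  form_comp i.+2 (extd a).

End Bigrading.

Record triple (R : realType) (M : manifold R 5) := Triple {
  conn : M -> 'M[R]_5;
  fac : M -> R;
  cov : dform M 1 }.

Section PoissonTriples.
Context {R : realType} {M : manifold R 5} {B : manifold R 2}.
Variables (pi : M -> B) (Omega : dform M 5) (omega : dform B 2).
Implicit Types (gamma : M -> 'M[R]_5) (beta mu : dform M 1) (kappa c : M -> R).

(* Below, get names the element that the mathematics asserts to exist uniquely
   (for volume forms Omega, omega, a fiber bundle pi and a connection gamma);
   its value is arbitrary otherwise. *)

Definition OmegaV gamma : dform M 3 := fun p =>
  get [set a : 'M[R]_(3, 5) -> R |
    form_bideg gamma p 0 a /\ Omega p = wedge (pullback pi omega p) a].

Definition QH gamma : mvec M 2 := fun p =>
  get [set A : 'M[R]_(2, 5) -> R | mvec_bideg gamma p 2 A /\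
    forall W, @iprod _ _ 2 0 A (pullback pi omega p) W = 1].

Definition QV gamma : mvec M 3 := fun p =>
  get [set A : 'M[R]_(3, 5) -> R | mvec_bideg gamma p 0 A /\
    forall W, @iprod _ _ 3 0 A (OmegaV gamma p) W = 1].

Definition Pbeta gamma beta : mvec M 2 := fun p Xi =>
  - @iprod _ _ 1 2 (beta p) (QV gamma p) Xi.

Definition theta gamma : dform M 1 := fun p W =>
  - @iprod _ _ 3 1 (QV gamma p) (d10 gamma 0 (OmegaV gamma) p) W.

Definition varrho gamma : dform M 2 := fun p =>
  @iprod _ _ 2 2 (QH gamma p) (d2m1 gamma 0 (OmegaV gamma) p).

Definition Poisson_triple (U : set M) (t : triple M) : Prop :=
  let: Triple gamma kappa beta := t in
  [/\ connection pi U gamma, smooth_fun U kappa,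
      is_form U beta /\
      (forall p v, U p -> horizontal gamma p v -> beta p v = 0) &
      forall p, U p ->
      [/\ forall W, wedge (d01 gamma 0 beta p) (beta p) W = 0,
          forall W, kappa p *
            (d10 gamma 0 beta p W - wedge (theta gamma p) (beta p) W) = 0 &
          forall W, wedge (d01 gamma 0 (fun_form kappa) p) (beta p) W -
            kappa p ^+ 2 * varrho gamma p W = 0]].

Definition almost_coupling (psi : mvec B 2) (t : triple M) : mvec M 2 :=
  fun p Xi =>
    fac t p * hor pi (conn t) psi p Xi + Pbeta (conn t) (cov t) p Xi.

(* {mu /\ mu}_beta; it is tensorial in u1, u2, so that these may be taken to be
   defined on an open subset of B only. *)
Definition mubracket gamma beta mu : dform M 2 := fun p =>
  get [set a : 'M[R]_(2, 5) -> R | form_bideg gamma p 2 a /\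
    forall (U : set B) (u1 u2 : B -> 'rV[R]_2), open U -> U (pi p) ->
      is_mvec U (fun b => vec1 (u1 b)) -> is_mvec U (fun b => vec1 (u2 b)) ->
      let Y1 := hor_vf pi gamma u1 in
      let Y2 := hor_vf pi gamma u2 in
      a (col_mx (Y1 p) (Y2 p)) =
        bracket (Pbeta gamma beta)
          (fun q => mu q (Y1 q)) (fun q => mu q (Y2 q)) p -
        bracket (Pbeta gamma beta)
          (fun q => mu q (Y2 q)) (fun q => mu q (Y1 q)) p].

Definition quot_area (a : dform M 2) (p : M) : R :=
  get [set r | forall W, a p W = r * pullback pi omega p W].

(* The matrix of X |-> i_(d01 mu /\ beta) (QV /\ X). *)
Definition conn_shift gamma beta mu (p : M) : 'M[R]_5 :=
  lin1_mx (fun X : 'rV[R]_5 => unvec1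
    (@iprod _ _ 3 1 (wedge (d01 gamma 1 mu p) (beta p))
                    (wedge (QV gamma p) (vec1 X)))).

Definition varkappa gamma beta mu : M -> R :=
  quot_area (fun p W =>
    d10 gamma 1 mu p W + 2^-1 * mubracket gamma beta mu p W).

Definition rho (e : R) (t : triple M) : triple M :=
  Triple (conn t) (fun p => e * fac t p) (fun p W => e * cov t p W).

(* Meaningful where the denominator does not vanish. *)
Definition Tmuc mu c (t : triple M) : triple M :=
  let: Triple gamma kappa beta := t in
  Triple (fun p => gamma p + conn_shift gamma beta mu p)
    (fun p => kappa p / (1 - kappa p * (varkappa gamma beta mu p - c p)))
    beta.

End PoissonTriples.

(* Main.v *)
(* Let Y_0, Y_1 be the horizontal lifts of coordinate fields d_0, d_1 of B, let
   {.,.} be the bracket of P_beta, and put K = kappa / omega(d_0, d_1).  The three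
   equations of a Poisson triple say respectively that {.,.} satisfies the Jacobi
   identity, that K (Y_i{f,h} - {Y_i f,h} - {f,Y_i h}) = 0, and that
   {K,f} = K^2 [Y_0,Y_1] f for all f; conversely, evaluating these identities on
   three fibre coordinates gives the equations back.  They imply the Jacobi
   identity for Pi = K Y_0 /\ Y_1 + P_beta by a formal computation.
   Replacing gamma by gamma_eps amounts to replacing Y_i by Y_i + {m_i, .} with
   m_i = eps mu(Y_i).  Then K ([Y_0', Y_1'] - [Y_0, Y_1] - {w, .}) = 0 for
   w = Y_0 m_1 - Y_1 m_0 + {m_0, m_1}, and w differs by a Casimir function from
   the function u for which 1 - K u is the denominator of Pi_eps.  So K / (1 - K u)
   and the fields Y_i' satisfy the three identities again. *)
Require Import Defs.
From HB Require Import structures.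
From mathcomp Require Import all_boot all_order all_fingroup all_algebra.
From mathcomp Require Import all_classical all_reals all_analysis.
From mathcomp Require Import ring lra.
Set Implicit Arguments.
Unset Strict Implicit.
Unset Printing Implicit Defensive.
Import Order.TTheory GRing.Theory Num.Theory.
Import numFieldNormedType.Exports.
Local Open Scope classical_set_scope.
Local Open Scope ring_scope.

(** Two obstacles shape the proof. The objects attached to a triple are named by [get], and a
    tangent vector at q is a row of coordinates in the preferred chart of q, which may jump from
    point to point. Both difficulties vanish in a frame dual to fibred coordinates: the chosen
    objects become determinants with explicit factors, exterior derivatives carry no Lie bracket
    terms because the frame commutes, and smoothness is read chart by chart. The second obstacle is
    that kappa may vanish, and there the Y_i need not be derivations of {.,.}. So their defects and
    the commutator of the Y_i' are only used after multiplication by K; the square of K in the third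
    identity absorbs this factor. No division by eps enters the formal computation. The shifted
    triple is written with beta itself and is polynomial in eps up to the denominator; for eps
    nonzero it agrees with the conjugated transformation because the shift of the connection and {mu
    /\ mu}_beta are linear in beta. This covers eps = 0 and gives smoothness jointly in eps and the
    point. *)

Local Notation alternating := Defs.alternating.

(** * Alternating multilinear maps *)

Section Multilinear.
Context {R : realType}.

(** Convertible to the local [subst] in the definition of [alternating]. *)
Definition rset n k (W : 'M[R]_(k, n)) (i : 'I_k) (w : 'rV[R]_n) : 'M[R]_(k, n) :=
  \matrix_l (if l == i then w else row l W).

Definition multilinear n k (a : 'M[R]_(k, n) -> R) : Prop :=
  forall W i r u v, a (rset W i (r *: u + v)) = r * a (rset W i u) + a (rset W i v).

Lemma alternating_multilinear n k (a : 'M[R]_(k, n) -> R) :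
  alternating a -> multilinear a.
Proof. by case=> H _ W i r u v; apply: H. Qed.

Lemma alternating_eq n k (a : 'M[R]_(k, n) -> R) W i j :
  alternating a -> i != j -> row i W = row j W -> a W = 0.
Proof. by case=> _; apply. Qed.

Lemma rset_id n k (W : 'M[R]_(k, n)) i : rset W i (row i W) = W.
Proof.
by apply/matrixP=> l j; rewrite mxE; case: eqP => [->|_]; rewrite mxE.
Qed.

Lemma rset_col0 n k (u v : 'rV[R]_n) (W : 'M[R]_(k, n)) :
  rset (col_mx u W : 'M[R]_(k.+1, n)) ord0 v = col_mx v W.
Proof.
apply/matrixP=> l j; rewrite mxE.
case: (split_ordP (l : 'I_(1 + k))) => i ->; last first.
  by rewrite (_ : (_ == _) = false) // [LHS]mxE !(@col_mxEd _ 1 k).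
by rewrite (ord1 i) (_ : (_ == _) = true) // (@col_mxEu _ 1 k).
Qed.

Lemma rset_colS n k (u v : 'rV[R]_n) (W : 'M[R]_(k, n)) i :
  rset (col_mx u W : 'M[R]_(k.+1, n)) (rshift 1 i : 'I_(1 + k)) v = col_mx u (rset W i v).
Proof.
apply/matrixP=> l j; rewrite mxE.
case: (split_ordP (l : 'I_(1 + k))) => m ->; last first.
  rewrite [X in (if X then _ else _)](_ : _ = (m == i)) // (@col_mxEd _ 1 k) [RHS]mxE; case: eqP => // _.
  by rewrite [LHS]mxE (@col_mxEd _ 1 k) [RHS]mxE.
by rewrite (ord1 m) (_ : (_ == _) = false) // [LHS]mxE !(@col_mxEu _ 1 k).
Qed.

Lemma multilinear_rset0 n k (a : 'M[R]_(k, n) -> R) W i :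
  multilinear a -> a (rset W i 0) = 0.
Proof.
by move=> /(_ W i (-1) 0 0); rewrite scaler0 addr0 mulN1r addNr.
Qed.

Lemma multilinear_row0 n k (a : 'M[R]_(k, n) -> R) W i :
  multilinear a -> row i W = 0 -> a W = 0.
Proof.
by move=> Ha Hi; rewrite -(rset_id W i) Hi multilinear_rset0.
Qed.

Lemma multilinear_rset_sum n k (a : 'M[R]_(k, n) -> R) W i m
    (c : 'I_m -> R) (u : 'I_m -> 'rV[R]_n) :
  multilinear a ->
  a (rset W i (\sum_j c j *: u j)) = \sum_j c j * a (rset W i (u j)).
Proof.
move=> Ha; elim: m c u => [|m IH] c u; first by rewrite !big_ord0 multilinear_rset0.
by rewrite !big_ord_recl Ha IH.
Qed.

Lemma multilinear_col n k (a : 'M[R]_(k.+1, n) -> R) (u : 'rV[R]_n) :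
  multilinear a -> multilinear (fun W : 'M[R]_(k, n) => a (col_mx u W)).
Proof. by move=> Ha W i r x y; rewrite -!rset_colS Ha. Qed.

Lemma big_ffunS k (T : finType) (G : {ffun 'I_k.+1 -> T} -> R) :
  \sum_f G f = \sum_j \sum_(f : {ffun 'I_k -> T})
     G [ffun i => oapp f j (unlift ord0 i)].
Proof.
rewrite pair_big /=.
rewrite (reindex (fun jf : T * {ffun 'I_k -> T} =>
   [ffun i => oapp jf.2 jf.1 (unlift ord0 i)])) //=.
exists (fun f => (f ord0, [ffun i => f (lift ord0 i)])).
  move=> [j f] _ /=; congr pair; first by rewrite ffunE unlift_none.
  by apply/ffunP=> i; rewrite !ffunE liftK.
move=> f _; apply/ffunP=> i; rewrite !ffunE /=.
by case: unliftP => [i' ->|->] //=; rewrite ffunE.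
Qed.

(** Induction on the number of rows: expand the first row, then apply the induction hypothesis to
    the map with that row frozen. *)
Lemma multilinear_mulmx n k m (a : 'M[R]_(k, n) -> R) (C : 'M[R]_(k, m)) (F : 'M[R]_(m, n)) :
  multilinear a ->
  a (C *m F) = \sum_(f : {ffun 'I_k -> 'I_m}) (\prod_i C i (f i)) * a (rowsub f F).
Proof.
elim: k a C => [|k IH] a C Ha.
  (* With no rows there is a single function and a single matrix, so the sum is one term. *)
  have e (f : {ffun 'I_0 -> 'I_m}) : (\prod_i C i (f i)) * a (rowsub f F) = a (C *m F).
    by rewrite big_ord0 mul1r; congr a; apply/matrixP => -[].
  under eq_bigr do rewrite e.
  by rewrite sumr_const card_ffun card_ord [in RHS]card_ord expn0.
rewrite big_ffunS.
rewrite -[C](@vsubmxK _ 1 k); set c := usubmx _; set C' := dsubmx _.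
rewrite (@mul_col_mx _ 1 k).
have -> : c *m F = \sum_j c 0 j *: row j F by rewrite mulmx_sum_row.
rewrite -(rset_col0 0 (\sum_j c 0 j *: row j F)) (multilinear_rset_sum _ _ _ _ Ha).
apply: eq_bigr => j _; rewrite rset_col0 (IH _ _ (multilinear_col _ Ha)) mulr_sumr.
apply: eq_bigr => f _; rewrite big_ord_recl mulrA; congr (_ * _ * _).
- rewrite ffunE unlift_none /= (_ : ord0 = lshift k (ord0 : 'I_1)); last exact: val_inj.
  by rewrite (@col_mxEu _ 1 k).
- apply: eq_bigr => i _; rewrite ffunE liftK /= (_ : lift ord0 i = rshift 1 i); last exact: val_inj.
  by rewrite (@col_mxEd _ 1 k).
- congr a; apply/matrixP=> l i.
  case: (split_ordP (l : 'I_(1 + k))) => l' ->.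
    rewrite (@col_mxEu _ 1 k) !mxE ffunE (_ : (lshift k l' : 'I_k.+1) = ord0) ?unlift_none ?(ord1 l') //.
    by apply: val_inj; case: (l') => -[].
  rewrite (@col_mxEd _ 1 k) !mxE ffunE (_ : (rshift 1 l' : 'I_k.+1) = lift ord0 l') ?liftK//.
  exact: val_inj.
Qed.

Lemma multilinear_expand n k (a : 'M[R]_(k, n) -> R) W : multilinear a ->
  a W = \sum_(f : {ffun 'I_k -> 'I_n}) (\prod_i W i (f i)) * a (rowsub f 1%:M).
Proof. by move=> Ha; rewrite -{1}[W]mulmx1 multilinear_mulmx. Qed.

Lemma alternating_mulr n m k (a : 'M[R]_(k, m) -> R) (A : 'M[R]_(n, m)) :
  alternating a -> alternating (fun W : 'M[R]_(k, n) => a (W *m A)).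
Proof.
move=> [Ha Hb]; split=> [W i r u v /=|W i j ij eW].
  have e w : (\matrix_l (if l == i then w else row l W)) *m A =
     \matrix_l (if l == i then w *m A else row l (W *m A)).
    apply/row_matrixP=> l; rewrite row_mul !rowK.
    by case: ifP => // _; rewrite row_mul.
  by rewrite !e mulmxDl -scalemxAl Ha.
by apply: (Hb _ i j) => //; rewrite !row_mul eW.
Qed.

Lemma row_row_perm n k (W : 'M[R]_(k, n)) (s : 'S_k) i : row i (row_perm s W) = row (s i) W.
Proof. by apply/rowP=> j; rewrite !mxE. Qed.

(** Polarisation: the map vanishes when rows i and j both hold the sum of the two rows; expanding
    leaves the two mixed terms. *)
Lemma alternating_swap n k (a : 'M[R]_(k, n) -> R) i j W :
  alternating a -> i != j -> a (row_perm (tperm i j) W) = - a W.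
Proof.
move=> Ha ij; have Hm := alternating_multilinear Ha.
pose X x y := rset (rset W i x) j y.
have Xl r x x' y : a (X (r *: x + x') y) = r * a (X x y) + a (X x' y).
  have e z : X z y = rset (rset W j y) i z.
    apply/row_matrixP=> l; rewrite !rowK.
    by case: (eqVneq l i) => [->|//]; rewrite (negPf ij).
  by rewrite !e Hm.
have Xr r x y y' : a (X x (r *: y + y')) = r * a (X x y) + a (X x y') by rewrite Hm.
have Xd x : a (X x x) = 0.
  by apply: (alternating_eq Ha ij); rewrite !rowK !eqxx (negPf ij).
have := Xd (1 *: row i W + row j W).
rewrite Xl !Xr !Xd !mul1r addr0 add0r => /eqP; rewrite addr_eq0 => /eqP e.
rewrite (_ : row_perm _ _ = X (row j W) (row i W)).
  rewrite -[a (X _ _)]opprK -e; congr (- a _).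
  apply/row_matrixP=> l; rewrite !rowK.
  case: (l =P j) => [->//|_]; by case: (l =P i) => [->|].
apply/row_matrixP=> l; rewrite row_row_perm !rowK.
by case: tpermP => [->|->|/eqP/negPf -> /eqP/negPf ->]; rewrite ?eqxx ?(negPf ij).
Qed.

Lemma alternating_row_perm n k (a : 'M[R]_(k, n) -> R) (s : 'S_k) W :
  alternating a -> a (row_perm s W) = (-1) ^+ s * a W.
Proof.
move=> Ha; case: (prod_tpermP s) => ts -> Hts.
elim: ts Hts W => [|t ts IH] /=.
  by rewrite big_nil odd_perm1 => _ W; rewrite row_perm1 mul1r.
case/andP=> dt Hts W; rewrite big_cons row_permM odd_permM odd_tperm dt.
by rewrite alternating_swap // IH // signr_addb expr1 mulN1r mulNr.
Qed.

(** In the expansion over functions a non-injective one repeats a row and contributes nothing; the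
    injective ones are permutations and assemble into the Leibniz formula. This is what makes a
    top-degree form a multiple of the determinant. *)
Lemma alternating_mulmx n k (a : 'M[R]_(k, n) -> R) (C : 'M[R]_k) W :
  alternating a -> a (C *m W) = \det C * a W.
Proof.
move=> Ha; rewrite multilinear_mulmx; last exact: alternating_multilinear.
rewrite (bigID (fun f : {ffun _} => injectiveb f)) /= addrC big1 ?add0r => [|f Uf].
  rewrite (reindex (@pval _)) /=; last first.
    pose in_Sn := insubd (1%g : 'S_k).
    by exists in_Sn => /= f Uf; first apply: val_inj; apply: insubdK.
  rewrite big_distrl; apply: eq_big => /= [s | s _]; rewrite ?(valP s) //.
  rewrite (_ : rowsub _ _ = row_perm s W); last by apply/matrixP=> i j; rewrite !mxE pvalE.
  rewrite alternating_row_perm // mulrCA mulrA; congr (_ * _ * _).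
  by apply: eq_bigr => i _; rewrite pvalE.
case/injectivePn: Uf => i [j ij e].
rewrite (alternating_eq Ha ij) ?mulr0 //.
by apply/rowP=> l; rewrite !mxE e.
Qed.

Lemma row'_row_perm n k (W : 'M[R]_(k.+1, n)) i j s :
  row' i (row_perm (lift_perm i j s) W) = row_perm s (row' j W).
Proof. by apply/matrixP=> l m; rewrite !mxE lift_perm_lift. Qed.

(* Swapping the two equal rows turns [row' i W] into a permutation of [row' j W]. *)
Lemma alternating_row' n k (a : 'M[R]_(k, n) -> R) (W : 'M[R]_(k.+1, n)) i j :
  alternating a -> i != j -> row i W = row j W ->
  (-1) ^+ i * a (row' i W) + (-1) ^+ j * a (row' j W) = 0.
Proof.
move=> Ha ij eW.
(* The transposition of i and j induces a bijection from the indices other than i to those other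
   than j; the default value is never taken. *)
pose f k' := odflt k' (unlift j (tperm i j (lift i k'))).
have fK k' : lift j (f k') = tperm i j (lift i k').
  rewrite /f; case: unliftP => [u -> //|e]; move: (neq_lift i k').
  by rewrite -(inj_eq (@perm_inj _ (tperm i j))) tpermL e eqxx.
have f_inj : injective f.
  by move=> x y /(congr1 (lift j)); rewrite !fK => /perm_inj /lift_inj.
have e : tperm i j = lift_perm i j (perm f_inj).
  apply/permP=> l; case: (unliftP i l) => [l'|] ->; last by rewrite lift_perm_id tpermL.
  by rewrite lift_perm_lift [in RHS]permE fK.
have -> : row' i W = row_perm (perm f_inj) (row' j W).
  rewrite -(row'_row_perm W i) -e; congr row'.
  apply/row_matrixP=> l; rewrite row_row_perm.
  by case: tpermP => [->|->|//].
rewrite alternating_row_perm //.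
have := congr1 (@odd_perm _) e; rewrite odd_tperm ij odd_lift_perm => eo.
rewrite mulrA -[(-1) ^+ i]signr_odd -[(-1) ^+ j]signr_odd -signr_addb.
have -> : odd i (+) perm f_inj = ~~ odd j.
  by move: eo; case: odd; case: odd; case: (odd_perm _).
by rewrite signrN mulNr addNr.
Qed.

End Multilinear.

(** * Smooth functions on open subsets of R^n *)

Section Calculus.
Context {R : realType}.

(** The first-order expansion at x only sees values near x, so the differential of f serves for
    g. *)
Lemma near_eq_differentiable (V W : normedModType R) (f g : V -> W) x :
  (\near x, f x = g x) -> differentiable f x -> differentiable g x.
Proof.
move=> fg df; have := diff_locally df; move/eqaddoP => dfo.
have dgo : g \o shift x = cst (g x) + 'd f x +o_ 0 id.
  apply/eqaddoP => e e0.
  have H : \forall y \near 0, f (y + x) = g (y + x).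
    by move: fg; rewrite (near_shift 0); apply: filterS => y /=; rewrite subr0.
  apply: filterS2 H (dfo e e0) => y /= e1.
  by rewrite !fctE /= e1 (nbhs_singleton fg).
have dg := diff_unique (diff_continuous df) dgo.
by apply/diff_locallyP; rewrite dg; split => //; apply: diff_continuous.
Qed.

Lemma open_near (T : topologicalType) (U : set T) x : open U -> U x -> \forall y \near x, U y.
Proof. by move=> oU Ux; apply: open_nbhs_nbhs. Qed.

Lemma class_C_sub n (W : normedModType R) k (U V : set 'rV[R]_n) (f : 'rV[R]_n -> W) :
  V `<=` U -> class_C k U f -> class_C k V f.
Proof.
move=> VU; elim: k f => [|k IH] f /=; first by move=> Uf x /VU /Uf.
by move=> [df Df]; split=> [x /VU /df//|v]; exact/IH.
Qed.

(** [class_C] imposes pointwise conditions on a total function and its total directional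
    derivatives, so it can be tested on singletons, although these are not open. *)
Lemma class_C_pt n (W : normedModType R) k (U : set 'rV[R]_n) (f : 'rV[R]_n -> W) :
  (forall x, U x -> class_C k [set x] f) -> class_C k U f.
Proof.
elim: k f => [|k IH] f /= H; first by move=> x /H; exact.
split=> [x /H [] + _|v]; first by apply.
by apply: IH => x /H [_]; exact.
Qed.

Lemma class_C_ext n (W : normedModType R) k (U : set 'rV[R]_n) (f g : 'rV[R]_n -> W) :
  open U -> (forall x, U x -> f x = g x) -> class_C k U f -> class_C k U g.
Proof.
move=> oU; elim: k f g => [|k IH] f g fg /=.
  move=> Uf x Ux; have := Uf x Ux.
  have nfg : {near x, f =1 g} by have := open_near oU Ux; apply: filterS => y /fg.
  rewrite /prop_for /continuous_at -(fg x Ux); apply: cvg_trans.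
  exact: (near_eq_cvg nfg).
move=> [df Df]; split=> [x Ux|v].
  apply: near_eq_differentiable (df x Ux).
  by have := open_near oU Ux; apply: filterS => y /fg.
apply: (IH _ _ _ (Df v)) => x Ux; apply: near_eq_derive.
by have := open_near oU Ux; apply: filterS => y /fg.
Qed.

Lemma class_CS n (W : normedModType R) k (U : set 'rV[R]_n) (f : 'rV[R]_n -> W) :
  class_C k.+1 U f -> class_C k U f.
Proof.
elim: k f => [|k IH] f [df Df]; first by move=> x /df; apply: differentiable_continuous.
by split=> // v; apply: IH.
Qed.

Section Closure.
Variable (n : nat) (U : set 'rV[R]_n).
Hypothesis oU : open U.

Lemma class_C_cst (W : normedModType R) k (a : W) : class_C k U (fun=> a).
Proof.
elim: k a => [|k IH] a /=; first by move=> x _; apply: cst_continuous.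
split=> [x _|v]; first exact: differentiable_cst.
by apply: class_C_ext (IH 0) => // x _; rewrite derive_cst.
Qed.

Lemma class_CD (W : normedModType R) k (f g : 'rV[R]_n -> W) :
  class_C k U f -> class_C k U g -> class_C k U (fun x => f x + g x).
Proof.
elim: k f g => [|k IH] f g /=; first by move=> cf cg x Ux; apply: continuousD; [apply: cf|apply: cg].
move=> [df Df] [dg Dg]; split=> [x Ux|v]; first by apply: differentiableD; [apply: df|apply: dg].
apply: (class_C_ext oU _ (IH _ _ (Df v) (Dg v))) => x Ux.
by rewrite -deriveD; [|apply/diff_derivable/df|apply/diff_derivable/dg].
Qed.

Lemma class_CM k (f g : 'rV[R]_n -> R) :
  class_C k U f -> class_C k U g -> class_C k U (fun x => f x * g x).
Proof.
elim: k f g => [|k IH] f g; first by move=> cf cg x Ux; apply: continuousM; [apply: cf|apply: cg].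
move=> Cf Cg; have [df Df] := Cf; have [dg Dg] := Cg.
split=> [x Ux|v]; first by apply: differentiableM; [apply: df|apply: dg].
have := class_CD (IH _ _ (class_CS Cf) (Dg v)) (IH _ _ (class_CS Cg) (Df v)).
apply: class_C_ext => // x Ux.
by rewrite [RHS](@deriveM _ _ f g x v); [|apply/diff_derivable/df|apply/diff_derivable/dg].
Qed.

Lemma class_CV k (f : 'rV[R]_n -> R) : (forall x, U x -> f x != 0) ->
  class_C k U f -> class_C k U (fun x => (f x)^-1).
Proof.
move=> f0; elim: k f f0 => [|k IH] f f0.
  by move=> cf x Ux; apply: continuousV; [apply: f0|apply: cf].
move=> Cf; have [df Df] := Cf.
split=> [x Ux|v]; first by apply: differentiableV; [apply: df|apply: f0].
have Ci := IH _ f0 (class_CS Cf).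
have := class_CM (class_C_cst k (-1 : R)) (class_CM (class_CM Ci Ci) (Df v)).
apply: class_C_ext => // x Ux.
rewrite deriveV; [|exact: f0|exact/diff_derivable/df].
by rewrite mulN1r scaleNr /GRing.scale /= expr2 invfM.
Qed.

Lemma class_C_sum (I : Type) (r : seq I) (P : pred I) (W : normedModType R) k
    (f : I -> 'rV[R]_n -> W) :
  (forall i, P i -> class_C k U (f i)) -> class_C k U (fun x => \sum_(i <- r | P i) f i x).
Proof.
move=> sf; elim: r => [|i r IH].
  by apply: class_C_ext (class_C_cst k 0) => // x _; rewrite big_nil.
case: (boolP (P i)) => Pi.
  by apply: class_C_ext (class_CD (sf i Pi) IH) => // x _; rewrite big_cons Pi.
by apply: class_C_ext IH => // x _; rewrite big_cons (negPf Pi).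
Qed.

Lemma smooth_on_open_sub (W : normedModType R) (V : set 'rV[R]_n) (f : 'rV[R]_n -> W) :
  V `<=` U -> smooth_on U f -> smooth_on V f.
Proof. by move=> VU sf k; apply: class_C_sub VU _. Qed.

Lemma smooth_on_ext (W : normedModType R) (f g : 'rV[R]_n -> W) :
  (forall x, U x -> f x = g x) -> smooth_on U f -> smooth_on U g.
Proof. by move=> fg sf k; apply: class_C_ext fg (sf k). Qed.

Lemma smooth_on_local (W : normedModType R) (f : 'rV[R]_n -> W) :
  (forall x, U x -> exists2 V : set 'rV[R]_n, V x & smooth_on V f) -> smooth_on U f.
Proof.
move=> H k; apply: class_C_pt => x /H [V Vx sf].
by apply: class_C_sub (sf k) => _ ->.
Qed.

Lemma smooth_on_diff (W : normedModType R) (f : 'rV[R]_n -> W) x :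
  smooth_on U f -> U x -> differentiable f x.
Proof. by move=> /(_ 1%N) [+ _]; apply. Qed.

Lemma smooth_on_derive (W : normedModType R) (f : 'rV[R]_n -> W) v :
  smooth_on U f -> smooth_on U (fun x => 'D_v f x).
Proof. by move=> sf k; have [_ H] := sf k.+1; exact: (H v). Qed.

Lemma smooth_on_cst (W : normedModType R) (a : W) : smooth_on U (fun=> a).
Proof. by move=> k; apply: class_C_cst. Qed.

Lemma smooth_onD (W : normedModType R) (f g : 'rV[R]_n -> W) :
  smooth_on U f -> smooth_on U g -> smooth_on U (fun x => f x + g x).
Proof. by move=> sf sg k; apply: class_CD. Qed.

Lemma smooth_onM (f g : 'rV[R]_n -> R) :
  smooth_on U f -> smooth_on U g -> smooth_on U (fun x => f x * g x).
Proof. by move=> sf sg k; apply: class_CM. Qed.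

Lemma smooth_onN (f : 'rV[R]_n -> R) :
  smooth_on U f -> smooth_on U (fun x => - f x).
Proof.
move=> sf; apply: smooth_on_ext (smooth_onM (smooth_on_cst (-1 : R)) sf) => x _.
by rewrite mulN1r.
Qed.

Lemma smooth_onB (f g : 'rV[R]_n -> R) :
  smooth_on U f -> smooth_on U g -> smooth_on U (fun x => f x - g x).
Proof. by move=> sf sg; exact: (smooth_onD sf (smooth_onN sg)). Qed.

Lemma smooth_onV (f : 'rV[R]_n -> R) : (forall x, U x -> f x != 0) ->
  smooth_on U f -> smooth_on U (fun x => (f x)^-1).
Proof. by move=> f0 sf k; apply: class_CV. Qed.

Lemma smooth_on_sum (I : Type) (r : seq I) (P : pred I) (W : normedModType R)
    (f : I -> 'rV[R]_n -> W) :
  (forall i, P i -> smooth_on U (f i)) -> smooth_on U (fun x => \sum_(i <- r | P i) f i x).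
Proof.
by move=> sf k; apply: class_C_sum => i Pi; apply: sf.
Qed.

Lemma smooth_on_prod (I : Type) (r : seq I) (P : pred I) (f : I -> 'rV[R]_n -> R) :
  (forall i, P i -> smooth_on U (f i)) -> smooth_on U (fun x => \prod_(i <- r | P i) f i x).
Proof.
move=> sf; elim: r => [|i r IH].
  by apply: smooth_on_ext (smooth_on_cst (1 : R)) => x _; rewrite big_nil.
case: (boolP (P i)) => Pi.
  by apply: smooth_on_ext (smooth_onM (sf i Pi) IH) => x _; rewrite big_cons Pi.
by apply: smooth_on_ext IH => x _; rewrite big_cons (negPf Pi).
Qed.

End Closure.

Lemma differentiable_mx n p q (f : 'rV[R]_n -> 'M[R]_(p, q)) x :
  (forall i j, differentiable (fun y => f y i j) x) -> differentiable f x.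
Proof.
move=> df.
have -> : f = \sum_(i < p) \sum_(j < q) (fun y => f y i j *: delta_mx i j).
  apply/funext => y; rewrite {1}(matrix_sum_delta (f y)) fct_sumE.
  by apply: eq_bigr => i _; rewrite fct_sumE.
by apply: differentiable_sum => i; apply: differentiable_sum => j; apply: differentiableZl.
Qed.

Lemma smooth_on_mxP n (U : set 'rV[R]_n) p q (f : 'rV[R]_n -> 'M[R]_(p, q)) : open U ->
  smooth_on U f <-> forall i j, smooth_on U (fun x => f x i j).
Proof.
move=> oU; split=> [sf i j k|sf k].
  elim: k f {sf}(sf k) => [|k IH] f /=.
    move=> cf x Ux; apply: (@continuous_comp _ _ _ f (fun N : 'M[R]_(p, q) => N i j)).
      exact: cf.
    exact: coord_continuous.
  move=> [df Df]; split=> [x Ux|v].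
    apply: (differentiable_comp (g := fun N : 'M[R]_(p, q) => N i j) (df x Ux)).
    exact: differentiable_coord.
  apply: class_C_ext (IH _ (Df v)) => // x Ux.
  by rewrite derive_mx ?mxE//; apply/diff_derivable/df.
elim: k f sf => [|k IH] f sf.
  move=> x Ux; apply: differentiable_continuous.
  by apply: differentiable_mx => i j; apply: smooth_on_diff (sf i j) Ux.
have df x : U x -> differentiable f x.
  by move=> Ux; apply: differentiable_mx => i j; apply: smooth_on_diff (sf i j) Ux.
split=> // v; apply: IH => i j.
apply: smooth_on_ext (smooth_on_derive v (sf i j)) => // x Ux.
by rewrite derive_mx ?mxE//; apply/diff_derivable/df.
Qed.

Lemma derive_comp n m (W : normedModType R) (h : 'rV[R]_n -> 'rV[R]_m) (f : 'rV[R]_m -> W) x v :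
  differentiable h x -> differentiable f (h x) ->
  'D_v (fun y => f (h y)) x = 'D_('D_v h x) f (h x).
Proof.
move=> dh df; rewrite [LHS](deriveE (f := f \o h)); last exact: differentiable_comp.
by rewrite diff_comp // !deriveE.
Qed.

Lemma derive_sumE n (W : normedModType R) (f : 'rV[R]_n -> W) x v :
  differentiable f x -> 'D_v f x = \sum_j v 0 j *: 'D_(delta_mx 0 j) f x.
Proof.
move=> df; rewrite {1}(row_sum_delta v) deriveE // linear_sum.
by apply: eq_bigr => j _; rewrite linearZ deriveE.
Qed.

(** Induction on the order for all outer functions at once: by the chain rule a directional
    derivative of the composite is a sum of products of a derivative of h with a partial derivative
    of f composed with h. *)
Lemma smooth_on_comp n m (U : set 'rV[R]_n) (V : set 'rV[R]_m)
    (h : 'rV[R]_n -> 'rV[R]_m) (f : 'rV[R]_m -> R) :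
  open U -> (forall x, U x -> V (h x)) -> smooth_on U h -> smooth_on V f ->
  smooth_on U (fun x => f (h x)).
Proof.
move=> oU UV sh sf k; elim: k f sf => [|k IH] f sf.
  move=> x Ux; apply: continuous_comp.
    exact/differentiable_continuous/(smooth_on_diff sh Ux).
  exact/differentiable_continuous/(smooth_on_diff sf (UV _ Ux)).
split=> [x Ux|v].
  exact: differentiable_comp (smooth_on_diff sh Ux) (smooth_on_diff sf (UV _ Ux)).
have Dh j : class_C k U (fun x => 'D_v h x 0 j).
  by have /(smooth_on_mxP _ oU) /(_ 0 j) := smooth_on_derive v sh; exact.
have : class_C k U (fun x => \sum_j 'D_v h x 0 j * 'D_(delta_mx 0 j) f (h x)).
  apply: class_C_sum => // j _; apply: class_CM => //.
  exact: (IH _ (smooth_on_derive (delta_mx 0 j) sf)).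
apply: class_C_ext => // x Ux; rewrite (derive_comp (h := h) (f := f)); last 2 first.
- exact: smooth_on_diff sh Ux.
- exact: smooth_on_diff sf (UV _ Ux).
by rewrite [RHS]derive_sumE//; apply: smooth_on_diff sf (UV _ Ux).
Qed.

Lemma line_MVT n (g : 'rV[R]_n -> R) y w (t : R) : 0 < t ->
  (forall s, 0 <= s <= t -> differentiable g (y + s *: w)) ->
  exists2 s, 0 <= s <= t & g (y + t *: w) - g y = 'D_w g (y + s *: w) * t.
Proof.
move=> t0 dg.
have dl s : is_diff s (fun s : R => y + s *: w) (fun s => s *: w).
  by apply: is_diff_eq; apply/funext => r; rewrite /= add0r.
have [||c] := @MVT_segment R (fun s => g (y + s *: w)) (fun s => 'D_w g (y + s *: w)) 0 t (ltW t0).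
- move=> s; rewrite in_itv /= => /andP[s0 st].
  have dgs : differentiable g (y + s *: w) by apply: dg; rewrite !ltW.
  have dc : differentiable (g \o (fun s => y + s *: w)) s by apply: differentiable_comp.
  apply: DeriveDef; first exact: diff_derivable.
  by rewrite [LHS](deriveE _ dc) diff_comp // diff_val /= scale1r deriveE.
- apply: continuous_in_subspaceT => s; rewrite inE /= in_itv /= => st.
  by apply: continuous_comp; [apply: differentiable_continuous|apply/differentiable_continuous/dg].
rewrite in_itv /= => ct; rewrite scale0r addr0 subr0 => e.
by exists c.
Qed.

Lemma derive_translate (V W : normedModType R) (f : V -> W) (a x v : V) :
  'D_v (fun y => f (y + a)) x = 'D_v f (x + a).
Proof.
rewrite /derive /=; set F1 := (X in lim (X @ _)); set F2 := (X in _ = lim (X @ _)).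
by rewrite (_ : F1 = F2) //; apply/funext => h; rewrite /F1 /F2 /= addrA.
Qed.

Lemma differentiable_translate (V W : normedModType R) (f : V -> W) (a x : V) :
  differentiable f (x + a) -> differentiable (fun y => f (y + a)) x.
Proof.
move=> df; apply: (@differentiable_comp _ _ _ _ (fun y => y + a) f) => //.
Qed.

(** Mean value theorem along u for the increment of f in the direction v, then along v for the
    derivative of f along u. *)
Lemma double_MVT n (U : set 'rV[R]_n) (f : 'rV[R]_n -> R) x u v (t : R) : 0 < t ->
  class_C 2 U f ->
  (forall s r, 0 <= s <= t -> 0 <= r <= t -> U (x + s *: u + r *: v)) ->
  exists s r, [/\ 0 <= s <= t, 0 <= r <= t &
    f (x + t *: u + t *: v) - f (x + t *: u) - (f (x + t *: v) - f x) =
    'D_v (fun y => 'D_u f y) (x + s *: u + r *: v) * t * t].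
Proof.
move=> t0 [df Df] Ut.
have t00 : (0 : R) <= 0 <= t by rewrite lexx ltW.
have tt : 0 <= t <= t by rewrite lexx ltW.
have U0 s : 0 <= s <= t -> U (x + s *: u).
  by move=> st; have := Ut s 0 st t00; rewrite scale0r addr0.
pose g := fun y => f (y + t *: v) - f y.
have dg s : 0 <= s <= t -> is_derive (x + s *: u) u g ('D_u f (x + s *: u + t *: v) - 'D_u f (x + s *: u)).
  move=> st.
  have d1 : differentiable f (x + s *: u + t *: v) by apply/df/Ut.
  have d2 : differentiable f (x + s *: u) by apply/df/U0.
  have d3 : differentiable (fun y => f (y + t *: v)) (x + s *: u).
    exact: differentiable_translate.
  apply: DeriveDef; first exact: diff_derivable (differentiableB d3 d2).
  rewrite deriveB; [|exact: diff_derivable d3|exact: diff_derivable d2].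
  by rewrite derive_translate.
have dg' s : 0 <= s <= t -> differentiable g (x + s *: u).
  move=> st; apply: differentiableB; last exact/df/U0.
  exact/differentiable_translate/df/Ut.
have [s st] := line_MVT t0 dg'.
have /@derive_val -> := dg s st.
rewrite /g => ->.
have [r rt e] : exists2 r, 0 <= r <= t &
   'D_u f (x + s *: u + t *: v) - 'D_u f (x + s *: u) =
   'D_v (fun y => 'D_u f y) (x + s *: u + r *: v) * t.
  apply: (line_MVT (g := fun y => 'D_u f y) t0) => r rt.
  by have [H _] := Df u; apply: (H _ (Ut _ _ st rt)).
by exists s, r; rewrite e.
Qed.

(** The second difference over a small parallelogram is symmetric in u and v, and equals t squared
    times either mixed derivative at some point of it. If the mixed derivatives differed at x,
    continuity would keep them apart there. *)
Lemma derive_commute n (U : set 'rV[R]_n) (f : 'rV[R]_n -> R) x u v : open U -> U x ->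
  smooth_on U f -> 'D_u (fun y => 'D_v f y) x = 'D_v (fun y => 'D_u f y) x.
Proof.
move=> oU Ux sf.
set A := fun x => 'D_u (fun y => 'D_v f y) x; set B := fun x => 'D_v (fun y => 'D_u f y) x.
apply/eqP/negP => /negP AB.
pose e := `|A x - B x| / 2.
have e0 : 0 < e by rewrite divr_gt0 // normr_gt0 subr_eq0.
have cA : {for x, continuous A}.
  by have := smooth_on_derive u (smooth_on_derive v sf); move=> /(_ 0%N); apply.
have cB : {for x, continuous B}.
  by have := smooth_on_derive v (smooth_on_derive u sf); move=> /(_ 0%N); apply.
have /nbhs_ballP[d /= d0 Hd] : \forall y \near x, [/\ U y, `|A x - A y| < e & `|B x - B y| < e].
  have h1 := open_near oU Ux.
  have h2 : \forall y \near x, `|A x - A y| < e by move/cvgrPdist_lt : cA; apply.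
  have h3 : \forall y \near x, `|B x - B y| < e by move/cvgrPdist_lt : cB; apply.
  by apply: filterS3 h1 h2 h3 => y *; split.
(* Small enough for the parallelogram with sides t u and t v to stay in the ball of radius d; the
   added 1 keeps the denominator positive when u and v vanish. *)
pose t := d / (2 * (`|u| + `|v| + 1)).
have n0 : 0 < `|u| + `|v| + 1 by rewrite ltr_wpDl // addr_ge0.
have t0 : 0 < t by rewrite divr_gt0 // mulr_gt0.
have Ht s r : 0 <= s <= t -> 0 <= r <= t -> ball x d (x + s *: u + r *: v).
  move=> /andP[s0 st] /andP[r0 rt]; rewrite -ball_normE /ball_ /= -addrA opprD addrA subrr add0r normrN.
  apply: le_lt_trans (ler_normD _ _) _; rewrite !normrZ !ger0_norm //.
  apply: (@le_lt_trans _ _ (t * (`|u| + `|v| + 1))).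
    have h1 := ler_wpM2r (normr_ge0 u) st; have h2 := ler_wpM2r (normr_ge0 v) rt.
    by apply: le_trans (lerD h1 h2) _; rewrite !mulrDr mulr1 lerDl ltW.
  have -> : t * (`|u| + `|v| + 1) = d / 2.
    by rewrite /t invfM mulrA -mulrA mulVf ?mulr1 // gt_eqF.
  by rewrite ltr_pdivrMr // mulr_natr mulr2n ltrDl.
have tU s r : 0 <= s <= t -> 0 <= r <= t -> U (x + s *: u + r *: v).
  by move=> st rt; have [] := Hd _ (Ht _ _ st rt).
have tU' s r : 0 <= s <= t -> 0 <= r <= t -> U (x + s *: v + r *: u).
  by move=> st rt; rewrite addrAC; apply: tU.
have [s [r [st rt]]] := double_MVT t0 (sf 2%N) tU.
rewrite -/(B _) => eB.
have [s' [r' [st' rt']]] := double_MVT t0 (sf 2%N) tU'.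
rewrite -/(A _) => eA.
clearbody A B.
have eAB : A (x + r' *: u + s' *: v) = B (x + s *: u + r *: v).
  have tn0 : t * t != 0 by rewrite mulf_neq0 // gt_eqF.
  apply: (mulIf tn0); rewrite (mulrA (A _)) (mulrA (B _)).
  rewrite (addrAC x (r' *: u)); apply: etrans (esym eA) (etrans _ eB).
  rewrite (addrAC x (t *: v)).
  have swap (a b c d' : R) : a - b - (c - d') = a - c - (b - d') by ring.
  exact: swap.
have [_ hA _] := Hd _ (Ht _ _ rt' st').
have [_ _ hB] := Hd _ (Ht _ _ st rt).
rewrite eAB in hA.
have := ler_normB (A x - B (x + s *: u + r *: v)) (B x - B (x + s *: u + r *: v)).
rewrite opprB addrA subrK => h.
have : `|A x - B x| < e + e by apply: le_lt_trans h _; rewrite ltrD.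
by rewrite -splitr ltxx.
Qed.

End Calculus.

(** * Smooth functions on manifolds *)

Section SmoothMatrices.
Context {R : realType} {n : nat}.
Variable U : set 'rV[R]_n.
Hypothesis oU : open U.

Lemma smooth_on_mulmx m p q (A : 'rV[R]_n -> 'M[R]_(m, p)) (B : 'rV[R]_n -> 'M[R]_(p, q)) :
  smooth_on U A -> smooth_on U B -> smooth_on U (fun x => A x *m B x).
Proof.
move=> /(smooth_on_mxP _ oU) sA /(smooth_on_mxP _ oU) sB.
apply/smooth_on_mxP => // i j.
have : smooth_on U (fun x => \sum_k A x i k * B x k j).
  by apply: (smooth_on_sum oU) => k _; apply: smooth_onM.
by apply: smooth_on_ext => // x Ux; rewrite mxE.
Qed.

Lemma smooth_on_det m (A : 'rV[R]_n -> 'M[R]_m) :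
  (forall i j, smooth_on U (fun x => A x i j)) -> smooth_on U (fun x => \det (A x)).
Proof.
move=> sA; apply: (smooth_on_sum oU) => s _; apply: smooth_onM => //.
  exact: smooth_on_cst.
by apply: (smooth_on_prod oU) => i _.
Qed.

Lemma smooth_on_invmx m (A : 'rV[R]_n -> 'M[R]_m) :
  (forall x, U x -> A x \in unitmx) -> smooth_on U A -> smooth_on U (fun x => invmx (A x)).
Proof.
move=> uA /(smooth_on_mxP _ oU) sA; apply/smooth_on_mxP => // i j.
have s1 : smooth_on U (fun x => (\det (A x))^-1).
  by apply: smooth_onV (smooth_on_det sA) => // x /uA; rewrite unitmxE unitfE.
have s2 : smooth_on U (fun x => cofactor (A x) j i).
  apply: smooth_onM => //; first exact: smooth_on_cst.
  apply: smooth_on_det => k l.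
  by apply: smooth_on_ext (sA (lift j k) (lift i l)) => // x _; rewrite !mxE.
apply: smooth_on_ext (smooth_onM oU s1 s2) => // x Ux.
by rewrite /invmx uA // !mxE.
Qed.

End SmoothMatrices.

Section ManifoldCalculus.
Context {R : realType} {n : nat} {M : manifold R n}.
Implicit Types (U V : set M) (f g : M -> R) (c : chart R M n) (p q : M).

Definition ddir f q (v : 'rV[R]_n) : R :=
  'D_v (f \o chart_inv (chart_at q)) (chart_at q q).

Definition vder (X : M -> 'rV[R]_n) f : M -> R := fun q => ddir f q (X q).

(** The rows are k vector fields, here with their components in c. The raw matrix X q refers to the
    preferred chart of q, which need not vary continuously, so smoothness can only be asked of
    [mx_in]. *)
Definition mx_in k c (X : M -> 'M[R]_(k, n)) (x : 'rV[R]_n) : 'M[R]_(k, n) :=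
  X (chart_inv c x) *m to_chart c (chart_inv c x).

Definition smooth_vfs U k (X : M -> 'M[R]_(k, n)) : Prop :=
  forall c, atlas c -> smooth_on (coord_set c U) (mx_in c X).

Lemma coord_set_open c U : open U -> open (coord_set c U).
Proof.
move=> oU; rewrite openE => x [ix Ux].
have h1 := open_near (@chart_im_open _ _ _ c) ix.
have h2 : \forall y \near x, U (chart_inv c y).
  exact: (chart_inv_cont ix (open_near oU Ux)).
by apply: filterS2 h1 h2 => y; split.
Qed.

Arguments coord_set_open c {U} oU.

Lemma coord_setP c U q : chart_dom c q -> U q -> coord_set c U (c q).
Proof. by move=> dq Uq; split; [apply: chart_funP|rewrite chart_funK]. Qed.

Lemma coord_set_sub c U V : V `<=` U -> coord_set c V `<=` coord_set c U.
Proof. by move=> VU x [ix /VU]. Qed.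

Lemma smooth_fun_sub U V f : V `<=` U -> smooth_fun U f -> smooth_fun V f.
Proof.
move=> VU sf c /sf; apply: smooth_on_open_sub; exact: coord_set_sub.
Qed.

Lemma smooth_fun_diff U f q c : smooth_fun U f -> U q -> atlas c -> chart_dom c q ->
  differentiable (f \o chart_inv c) (c q).
Proof. by move=> sf Uq ac dq; apply: smooth_on_diff (sf c ac) _; apply: coord_setP. Qed.

Lemma transition_smooth c c' : atlas c -> atlas c' ->
  smooth_on (coord_set c (chart_dom c')) (c' \o chart_inv c).
Proof. exact: atlas_compat. Qed.

Lemma transition_diff c c' q : atlas c -> atlas c' -> chart_dom c q -> chart_dom c' q ->
  differentiable (c' \o chart_inv c) (c q).
Proof.
move=> ac ac' dq dq'; apply: smooth_on_diff (transition_smooth ac ac') _.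
exact: coord_setP.
Qed.

Lemma near_chart c c' (W : Type) (h : M -> W) q : chart_dom c q -> chart_dom c' q ->
  \forall x \near c q, (h \o chart_inv c') ((c' \o chart_inv c) x) = (h \o chart_inv c) x.
Proof.
move=> dq dq'; have := open_near (coord_set_open c (@chart_dom_open _ _ _ c')) (coord_setP dq dq').
by apply: filterS => x [ix dx] /=; rewrite chart_funK.
Qed.

(** Chain rule through the transition map: the preferred chart may be replaced by any chart around
    q, provided v is transported. *)
Lemma ddirE U f q v c : smooth_fun U f -> U q -> atlas c -> chart_dom c q ->
  ddir f q v = 'D_(v *m to_chart c q) (f \o chart_inv c) (c q).
Proof.
move=> sf Uq ac dq; have ac0 := chart_at_atlas q; have dq0 := chart_at_dom q.
have e := near_chart f dq0 dq.
have dt := transition_diff ac0 ac dq0 dq.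
have ec : (c \o chart_inv (chart_at q)) (chart_at q q) = c q by rewrite /= chart_funK.
rewrite /ddir -(near_eq_derive v e).
rewrite (derive_comp (h := c \o chart_inv (chart_at q)) (f := f \o chart_inv c)); [|exact: dt|].
  by rewrite ec (@deriveEjacobian R n n (c \o chart_inv (chart_at q)) _ v dt).
by rewrite ec; apply: smooth_fun_diff sf _ _ _.
Qed.

(** Chain rule for two mutually inverse transition maps, whose composite is the identity near the
    point. *)
Lemma to_of_chart c q : atlas c -> chart_dom c q -> to_chart c q *m of_chart c (c q) = 1%:M.
Proof.
move=> ac dq; have ac0 := chart_at_atlas q; have dq0 := chart_at_dom q.
have e := near_chart (chart_at q : M -> 'rV[R]_n) dq0 dq.
have dt := transition_diff ac0 ac dq0 dq.
have dt' := transition_diff ac ac0 dq dq0.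
have ec : (c \o chart_inv (chart_at q)) (chart_at q q) = c q by rewrite /= chart_funK.
apply/row_matrixP => i; rewrite !rowE.
set v : 'rV[R]_n := delta_mx 0 i; rewrite mulmx1.
have E : 'D_v (chart_at q \o chart_inv (chart_at q)) (chart_at q q) = v.
  rewrite -[RHS](derive_id (chart_at q q)); apply: near_eq_derive.
  have := open_near (@chart_im_open _ _ _ (chart_at q)) (chart_funP dq0).
  by apply: filterS => x ix /=; rewrite chart_invK.
rewrite -[RHS]E.
rewrite -(near_eq_derive v e).
rewrite (derive_comp (h := c \o chart_inv (chart_at q)) (f := chart_at q \o chart_inv c)); [|exact: dt|by rewrite ec].
rewrite ec.
rewrite (@deriveEjacobian R n n (chart_at q \o chart_inv c) (c q) _ dt').
rewrite (@deriveEjacobian R n n (c \o chart_inv (chart_at q)) _ v dt).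
have -> : of_chart c (c q) = jacobian (chart_at q \o chart_inv c) (c q).
  by rewrite /of_chart (chart_funK dq).
exact: mulmxA.
Qed.

Lemma of_to_chart c q : atlas c -> chart_dom c q -> of_chart c (c q) *m to_chart c q = 1%:M.
Proof. by move=> ac dq; apply: mulmx1C; apply: to_of_chart. Qed.

Lemma to_chart_at q : to_chart (chart_at q) q = 1%:M.
Proof.
apply/row_matrixP => i; rewrite !rowE.
rewrite -deriveEjacobian; last exact: transition_diff (chart_at_atlas q) (chart_at_atlas q) (chart_at_dom q) (chart_at_dom q).
rewrite mulmx1 -[RHS](derive_id (chart_at q q)); apply: near_eq_derive.
have := open_near (@chart_im_open _ _ _ (chart_at q)) (chart_funP (chart_at_dom q)).
by apply: filterS => x ix /=; rewrite chart_invK.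
Qed.

Lemma mx_in_chart k c (X : M -> 'M[R]_(k, n)) q :
  chart_dom c q -> mx_in c X (c q) = X q *m to_chart c q.
Proof. by move=> dq; rewrite /mx_in chart_funK. Qed.

Section SmoothFun.
Variable U : set M.
Hypothesis oU : open U.

Let oc c := coord_set_open c oU.

Lemma smooth_fun_ext f g : (forall q, U q -> f q = g q) -> smooth_fun U f -> smooth_fun U g.
Proof. by move=> fg sf c ac; apply: smooth_on_ext (sf c ac) => // x [_ /fg]. Qed.

Lemma smooth_fun_cst (a : R) : smooth_fun U (fun=> a).
Proof. by move=> c _; apply: smooth_on_cst. Qed.

Lemma smooth_funD f g : smooth_fun U f -> smooth_fun U g -> smooth_fun U (fun q => f q + g q).
Proof. by move=> sf sg c ac; exact: (smooth_onD (@oc c) (sf c ac) (sg c ac)). Qed.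

Lemma smooth_funM f g : smooth_fun U f -> smooth_fun U g -> smooth_fun U (fun q => f q * g q).
Proof. by move=> sf sg c ac; exact: (smooth_onM (@oc c) (sf c ac) (sg c ac)). Qed.

Lemma smooth_funN f : smooth_fun U f -> smooth_fun U (fun q => - f q).
Proof. by move=> sf c ac; exact: (smooth_onN (@oc c) (sf c ac)). Qed.

Lemma smooth_funB f g : smooth_fun U f -> smooth_fun U g -> smooth_fun U (fun q => f q - g q).
Proof. by move=> sf sg; exact: (smooth_funD sf (smooth_funN sg)). Qed.

Lemma smooth_funV f : (forall q, U q -> f q != 0) -> smooth_fun U f ->
  smooth_fun U (fun q => (f q)^-1).
Proof.
move=> f0 sf c ac; apply: (smooth_onV (@oc c) _ (sf c ac)) => x [_]; exact: f0.
Qed.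

Lemma smooth_fun_sum (I : Type) (r : seq I) (P : pred I) (F : I -> M -> R) :
  (forall i, P i -> smooth_fun U (F i)) -> smooth_fun U (fun q => \sum_(i <- r | P i) F i q).
Proof.
by move=> sF c ac; apply: (smooth_on_sum (@oc c) _ (f := fun i => F i \o chart_inv c)) => i /sF; exact.
Qed.

Lemma smooth_fun_det m (A : M -> 'M[R]_m) :
  (forall i j, smooth_fun U (fun q => A q i j)) -> smooth_fun U (fun q => \det (A q)).
Proof.
by move=> sA c ac; apply: (smooth_on_det (@oc c) (A := A \o chart_inv c)) => i j; exact: sA.
Qed.

Lemma smooth_fun_local f :
  (forall q, U q -> exists2 V, V q & smooth_fun V f) -> smooth_fun U f.
Proof.
move=> H c ac; apply: smooth_on_local => x [ix Ux].
by have [V Vx sf] := H _ Ux; exists (coord_set c V) => //; exact: sf.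
Qed.

Lemma smooth_fun_cont f q : smooth_fun U f -> U q -> {for q, continuous f}.
Proof.
move=> sf Uq; pose c := chart_at q.
have dq : chart_dom c q := chart_at_dom q.
have h1 : {for q, continuous ((f \o chart_inv c) \o c)}.
  apply: continuous_comp; first exact: chart_fun_cont.
  exact/differentiable_continuous/(smooth_fun_diff sf Uq (chart_at_atlas q)).
have e : {near q, (f \o chart_inv c) \o c =1 f}.
  have := open_near (@chart_dom_open _ _ _ c) dq.
  by apply: filterS => y dy /=; rewrite chart_funK.
rewrite /prop_for /continuous_at -(nbhs_singleton e).
by apply: cvg_trans h1; exact: near_eq_cvg e.
Qed.

Lemma ddir_near f g q v : U q -> (forall q, U q -> f q = g q) -> ddir f q v = ddir g q v.
Proof.
move=> Uq fg; apply: near_eq_derive.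
have := open_near (@oc (chart_at q)) (coord_setP (chart_at_dom q) Uq).
by apply: filterS => x [_ /fg].
Qed.

Let df0 f q : smooth_fun U f -> U q ->
  differentiable (f \o chart_inv (chart_at q)) (chart_at q q).
Proof.
by move=> sf Uq; exact: (smooth_fun_diff sf Uq (chart_at_atlas q) (chart_at_dom q)).
Qed.

Lemma ddirD f g q v : smooth_fun U f -> smooth_fun U g -> U q ->
  ddir (fun q => f q + g q) q v = ddir f q v + ddir g q v.
Proof.
by move=> sf sg Uq; rewrite /ddir -deriveD //; apply: diff_derivable; apply: df0.
Qed.

Lemma ddirM f g q v : smooth_fun U f -> smooth_fun U g -> U q ->
  ddir (fun q => f q * g q) q v = ddir f q v * g q + f q * ddir g q v.
Proof.
move=> sf sg Uq; rewrite /ddir.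
rewrite [LHS](@deriveM _ _ (f \o chart_inv (chart_at q)) (g \o chart_inv (chart_at q)));
  [|exact: diff_derivable (df0 sf Uq)|exact: diff_derivable (df0 sg Uq)].
have e (h : M -> R) : (h \o chart_inv (chart_at q)) (chart_at q q) = h q.
  by rewrite /= (chart_funK (chart_at_dom q)).
by rewrite !e addrC; congr (_ + _); exact: mulrC.
Qed.

Lemma ddir_cst (a : R) q v : ddir (fun=> a) q v = 0.
Proof. exact: derive_cst. Qed.

Lemma ddirZ (a : R) f q v : smooth_fun U f -> U q ->
  ddir (fun q => a * f q) q v = a * ddir f q v.
Proof.
move=> sf Uq; rewrite (ddirM v (smooth_fun_cst a) sf Uq) ddir_cst mul0r add0r//.
Qed.

Lemma ddirN f q v : smooth_fun U f -> U q -> ddir (fun q => - f q) q v = - ddir f q v.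
Proof.
by move=> sf Uq; rewrite /ddir -deriveN //; apply: diff_derivable; apply: df0.
Qed.

Lemma ddirB f g q v : smooth_fun U f -> smooth_fun U g -> U q ->
  ddir (fun q => f q - g q) q v = ddir f q v - ddir g q v.
Proof.
by move=> sf sg Uq; rewrite (ddirD v sf (smooth_funN sg)) // ddirN.
Qed.

Lemma ddirV f q v : smooth_fun U f -> U q -> f q != 0 ->
  ddir (fun q => (f q)^-1) q v = - ddir f q v / f q ^+ 2.
Proof.
move=> sf Uq f0; rewrite /ddir.
have e : f (chart_inv (chart_at q) (chart_at q q)) = f q by rewrite chart_funK; last exact: chart_at_dom.
rewrite [LHS](@deriveV _ _ (f \o chart_inv (chart_at q))) /= ?e //.
  by rewrite scaleNr mulNr mulrC.
by apply: diff_derivable; apply: df0.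
Qed.

Lemma ddir_sum (I : Type) (r : seq I) (P : pred I) (F : I -> M -> R) q v :
  (forall i, P i -> smooth_fun U (F i)) -> U q ->
  ddir (fun q => \sum_(i <- r | P i) F i q) q v = \sum_(i <- r | P i) ddir (F i) q v.
Proof.
move=> sF Uq; elim: r => [|i r IH].
  have -> : (fun q => \sum_(i <- [::] | P i) F i q) = fun=> 0 by apply/funext => x; rewrite big_nil.
  by rewrite big_nil ddir_cst.
rewrite big_cons; case: (boolP (P i)) => Pi.
  have -> : (fun q => \sum_(i <- i :: r | P i) F i q) = fun q => F i q + \sum_(i <- r | P i) F i q.
    by apply/funext => x; rewrite big_cons Pi.
  by rewrite (ddirD v (sF i Pi) (smooth_fun_sum r sF) Uq) IH.
have -> : (fun q => \sum_(i <- i :: r | P i) F i q) = fun q => \sum_(i <- r | P i) F i q.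
  by apply/funext => x; rewrite big_cons (negPf Pi).
exact: IH.
Qed.

Lemma ddir_linear f q : smooth_fun U f -> U q -> linear (ddir f q : 'rV[R]_n -> R^o).
Proof.
by move=> sf Uq a u v; rewrite /ddir !deriveE ?linearP //; exact: df0.
Qed.

Lemma ddir_add f q u v : smooth_fun U f -> U q -> ddir f q (u + v) = ddir f q u + ddir f q v.
Proof. by move=> sf Uq; have := ddir_linear sf Uq 1 u v; rewrite !scale1r. Qed.

Lemma ddir0 f q : ddir f q 0 = 0.
Proof. exact: derive0. Qed.

Lemma ddir_scale f q a v : smooth_fun U f -> U q -> ddir f q (a *: v) = a * ddir f q v.
Proof.
move=> sf Uq; have := ddir_linear sf Uq a v 0.
by rewrite addr0 ddir0 addr0.
Qed.

Lemma ddir_opp f q v : smooth_fun U f -> U q -> ddir f q (- v) = - ddir f q v.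
Proof. by move=> sf Uq; rewrite -scaleN1r ddir_scale // mulN1r. Qed.

Lemma ddir_mulmx f q m (a : 'rV[R]_m) (V : 'M[R]_(m, n)) : smooth_fun U f -> U q ->
  ddir f q (a *m V) = \sum_i a 0 i * ddir f q (row i V).
Proof.
move=> sf Uq; rewrite mulmx_sum_row.
elim/big_ind2 : _ => [|x1 x2 y1 y2 <- <-|i _]; first by rewrite ddir0.
  by rewrite ddir_add.
by rewrite ddir_scale.
Qed.

Lemma dfunE f q v : smooth_fun U f -> U q -> (v *m (dfun f q)^T) 0 0 = ddir f q v.
Proof.
move=> sf Uq; rewrite -[v in RHS]mulmx1 ddir_mulmx // mxE; apply: eq_bigr => j _.
rewrite !mxE /extd big_ord1 expr0 mul1r; congr (_ * _).
by rewrite row1 row_id.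
Qed.

End SmoothFun.

End ManifoldCalculus.
Arguments coord_set_open {R n M} c {U} oU.

(** * Vector fields and the exterior derivative *)

Section DeriveMultilinear.
Context {R : realType} {V : normedModType R}.

Lemma derive_add (f g : V -> R) x v : differentiable f x -> differentiable g x ->
  'D_v (fun y => f y + g y) x = 'D_v f x + 'D_v g x.
Proof. by move=> df dg; rewrite -deriveD //; apply: diff_derivable. Qed.

Lemma derive_mul (f g : V -> R) x v : differentiable f x -> differentiable g x ->
  'D_v (fun y => f y * g y) x = 'D_v f x * g x + f x * 'D_v g x.
Proof.
move=> df dg; rewrite [LHS](@deriveM _ _ f g); [|exact: diff_derivable..].
by rewrite addrC; congr (_ + _); exact: mulrC.
Qed.

Lemma differentiable_bigsum (I : Type) (r : seq I) (F : I -> V -> R) x :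
  (forall i, differentiable (F i) x) -> differentiable (fun y => \sum_(i <- r) F i y) x.
Proof.
move=> dF; elim: r => [|i r IH].
  have -> : (fun y => \sum_(i <- [::]) F i y) = cst 0 by apply/funext => y; rewrite big_nil.
  exact: differentiable_cst.
have -> : (fun y => \sum_(i <- i :: r) F i y) = F i + fun y => \sum_(i <- r) F i y.
  by apply/funext => y; rewrite big_cons.
exact: differentiableD.
Qed.

Lemma derive_bigsum (I : Type) (r : seq I) (F : I -> V -> R) x v :
  (forall i, differentiable (F i) x) ->
  'D_v (fun y => \sum_(i <- r) F i y) x = \sum_(i <- r) 'D_v (F i) x.
Proof.
move=> dF; elim: r => [|i r IH].
  have -> : (fun y => \sum_(i <- [::]) F i y) = cst 0 by apply/funext => y; rewrite big_nil.
  by rewrite big_nil derive_cst.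
have -> : (fun y => \sum_(i <- i :: r) F i y) = fun y => F i y + \sum_(i <- r) F i y.
  by apply/funext => y; rewrite big_cons.
by rewrite big_cons -IH derive_add //; apply: differentiable_bigsum.
Qed.

Lemma differentiable_bigprod k (F : 'I_k -> V -> R) x :
  (forall i, differentiable (F i) x) -> differentiable (fun y => \prod_i F i y) x.
Proof.
elim: k F => [|k IH] F dF.
  have -> : (fun y => \prod_i F i y) = cst 1 by apply/funext => y; rewrite big_ord0.
  exact: differentiable_cst.
have -> : (fun y => \prod_i F i y) = F ord0 * fun y => \prod_i F (lift ord0 i) y.
  by apply/funext => y; rewrite big_ord_recl.
by apply: differentiableM => //; apply: IH.
Qed.

Lemma derive_bigprod k (F : 'I_k -> V -> R) x v :
  (forall i, differentiable (F i) x) ->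
  'D_v (fun y => \prod_i F i y) x =
  \sum_l \prod_i (if i == l then 'D_v (F i) x else F i x).
Proof.
elim: k F => [|k IH] F dF.
  have -> : (fun y => \prod_i F i y) = cst 1 by apply/funext => y; rewrite big_ord0.
  by rewrite big_ord0 derive_cst.
have -> : (fun y => \prod_i F i y) = fun y => F ord0 y * \prod_i F (lift ord0 i) y.
  by apply/funext => y; rewrite big_ord_recl.
rewrite derive_mul //; last exact: differentiable_bigprod.
rewrite IH // [RHS]big_ord_recl; congr (_ + _).
  by rewrite [RHS]big_ord_recl; congr (_ * _); apply: eq_bigr.
rewrite mulr_sumr; apply: eq_bigr => l _; rewrite [RHS]big_ord_recl.
by congr (_ * _); apply: eq_bigr => i _; rewrite (inj_eq (@lift_inj _ ord0)).
Qed.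

(** Product rule: expanded on the standard basis, the function is a polynomial in the entries of Z
    whose coefficients are the values of A on constant matrices. *)
Lemma derive_multilinear n k (U : set V) (A : V -> 'M[R]_(k, n) -> R) (Z : V -> 'M[R]_(k, n)) x v :
  open U -> U x -> (forall y, U y -> multilinear (A y)) ->
  (forall W, differentiable (A^~ W) x) -> (forall i j, differentiable (fun y => Z y i j) x) ->
  'D_v (fun y => A y (Z y)) x =
  'D_v (A^~ (Z x)) x + \sum_l A x (rset (Z x) l (\row_j 'D_v (fun y => Z y l j) x)).
Proof.
move=> oU Ux mA dA dZ.
have expand (Z' : V -> 'M[R]_(k, n)) : {near x, (fun y => A y (Z' y)) =1
   fun y => \sum_(f : {ffun 'I_k -> 'I_n}) (\prod_i Z' y i (f i)) * A y (rowsub f 1%:M)}.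
  by have := open_near oU Ux; apply: filterS => y Uy; rewrite (multilinear_expand _ (mA y Uy)).
have dp f : differentiable (fun y => \prod_i Z y i (f i)) x.
  exact: (differentiable_bigprod (F := fun i y => Z y i (f i))).
rewrite (near_eq_derive v (expand Z)) (near_eq_derive v (expand (fun=> Z x))).
rewrite derive_bigsum; last by move=> f; exact: (differentiableM (dp f) (dA _)).
rewrite derive_bigsum; last by move=> f; exact: (differentiableM (differentiable_cst _ _) (dA _)).
have -> : \sum_l A x (rset (Z x) l (\row_j 'D_v (fun y => Z y l j) x)) =
   \sum_(f : {ffun 'I_k -> 'I_n}) 'D_v (fun y => \prod_i Z y i (f i)) x * A x (rowsub f 1%:M).
  under eq_bigr do rewrite (multilinear_expand _ (mA x Ux)).
  rewrite exchange_big; apply: eq_bigr => f _ /=.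
  rewrite -mulr_suml (derive_bigprod _ (F := fun i y => Z y i (f i))) //; congr (_ * _).
  apply: eq_bigr => l _; apply: eq_bigr => i _.
  by rewrite !mxE; case: eqP => [->|_]; rewrite mxE.
rewrite -big_split; apply: eq_bigr => f _ /=.
rewrite (derive_mul _ (dp f) (dA _)) (derive_mul _ (differentiable_cst _ _) (dA _)).
by rewrite derive_cst mul0r add0r addrC.
Qed.

End DeriveMultilinear.

Lemma row_row' (R : realType) n k (W : 'M[R]_(k.+1, n)) i l : row l (row' i W) = row (lift i l) W.
Proof. by apply/rowP => j; rewrite !mxE. Qed.

Section VectorFields.
Context {R : realType} {n : nat} {M : manifold R n}.
Implicit Types (f g : M -> R) (c : chart R M n) (p q : M).
Variable U : set M.
Hypothesis oU : open U.
Let oc c := coord_set_open c oU.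
#[local] Hint Extern 0 (open (coord_set _ _)) => (exact: oc) : core.

Lemma smooth_vfsP k (X : M -> 'M[R]_(k, n)) : smooth_vfs U X <->
  forall c i j, atlas c -> smooth_on (coord_set c U) (fun x => mx_in c X x i j).
Proof.
split=> [sX c i j ac|sX c ac]; first by have /(smooth_on_mxP _ (@oc c)) := sX c ac; exact.
by apply/smooth_on_mxP => // i j; apply: sX.
Qed.

Lemma smooth_vfs_mulmx k m (A : M -> 'M[R]_(m, k)) (X : M -> 'M[R]_(k, n)) :
  (forall i j, smooth_fun U (fun q => A q i j)) -> smooth_vfs U X ->
  smooth_vfs U (fun q => A q *m X q).
Proof.
move=> sA sX c ac; have sAc : smooth_on (coord_set c U) (A \o chart_inv c).
  by apply/(smooth_on_mxP _ (@oc c)) => i j; exact: (sA i j c ac).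
apply: smooth_on_ext (smooth_on_mulmx (@oc c) sAc (sX c ac)) => // x _.
by rewrite /mx_in mulmxA.
Qed.

Lemma smooth_vfs_row k (X : M -> 'M[R]_(k, n)) i :
  smooth_vfs U X -> smooth_vfs U (fun q => row i (X q)).
Proof.
move=> /smooth_vfsP sX; apply/smooth_vfsP => c j l ac.
apply: (smooth_on_ext (@oc c) _ (sX c i l ac)) => x _.
by rewrite /mx_in -row_mul [RHS]mxE.
Qed.

Lemma smooth_vfsD k (X Y : M -> 'M[R]_(k, n)) :
  smooth_vfs U X -> smooth_vfs U Y -> smooth_vfs U (fun q => X q + Y q).
Proof.
move=> sX sY c ac; apply: smooth_on_ext (smooth_onD (@oc c) (sX c ac) (sY c ac)) => // x _.
by rewrite /mx_in mulmxDl.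
Qed.

Lemma vder_in (X : M -> 'rV[R]_n) f c x : smooth_fun U f -> atlas c -> coord_set c U x ->
  vder X f (chart_inv c x) =
  \sum_j mx_in c X x 0 j * 'D_(delta_mx 0 j) (f \o chart_inv c) x.
Proof.
move=> sf ac [ix Ux]; have dx := chart_invP ix.
rewrite /vder (ddirE _ sf Ux ac dx) chart_invK // derive_sumE //.
by have := smooth_fun_diff sf Ux ac dx; rewrite (chart_invK ix).
Qed.

Lemma smooth_vder (X : M -> 'rV[R]_n) f :
  smooth_fun U f -> smooth_vfs U X -> smooth_fun U (vder X f).
Proof.
move=> sf /smooth_vfsP sX c ac.
have s : smooth_on (coord_set c U) (fun x => \sum_j mx_in c X x 0 j * 'D_(delta_mx 0 j) (f \o chart_inv c) x).
  apply: smooth_on_sum => // j _; apply: smooth_onM => //; first exact: sX.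
  exact: smooth_on_derive (sf c ac).
by apply: smooth_on_ext s => // x Ux; rewrite /= vder_in.
Qed.

Definition lie (X Y : M -> 'rV[R]_n) q : 'rV[R]_n :=
  let c := chart_at q in
  'D_(X q) (mx_in c Y) (c q) - 'D_(Y q) (mx_in c X) (c q).

Lemma mx_in_at k (X : M -> 'M[R]_(k, n)) q : mx_in (chart_at q) X (chart_at q q) = X q.
Proof. by rewrite mx_in_chart ?to_chart_at ?mulmx1 //; apply: chart_at_dom. Qed.

(** The second term, where Y q is frozen, is the Hessian of f in the chart. It is symmetric in the
    two vectors and cancels in a commutator. *)
Lemma vder2 (X Y : M -> 'rV[R]_n) f q : smooth_fun U f -> smooth_vfs U X -> smooth_vfs U Y -> U q ->
  let fc := f \o chart_inv (chart_at q) in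
  vder X (vder Y f) q =
   'D_('D_(X q) (mx_in (chart_at q) Y) (chart_at q q)) fc (chart_at q q) +
   'D_(X q) (fun x => 'D_(Y q) fc x) (chart_at q q).
Proof.
move=> sf sX sY Uq; set c := chart_at q => fc.
have ac : atlas c by apply: chart_at_atlas.
have dq : chart_dom c q by apply: chart_at_dom.
have oC := coord_set_open c oU.
have Cq := coord_setP dq Uq.
have sfc : smooth_on (coord_set c U) fc by apply: sf.
have sD v : smooth_on (coord_set c U) (fun x => 'D_v fc x) by apply: smooth_on_derive.
have dfc : differentiable fc (c q) by apply: smooth_on_diff sfc Cq.
have sYc : forall j, smooth_on (coord_set c U) (fun x => mx_in c Y x 0 j).
  by move=> j; move/smooth_vfsP : sY; apply.
have dYc : differentiable (mx_in c Y) (c q) by apply: smooth_on_diff (sY c ac) Cq.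
have near_e : {near c q, vder Y f \o chart_inv c =1
   fun x => \sum_j mx_in c Y x 0 j * 'D_(delta_mx 0 j) fc x}.
  by have := open_near oC Cq; apply: filterS => x Ux; rewrite /= vder_in.
rewrite {1}/vder /ddir -/c (near_eq_derive _ near_e).
rewrite derive_bigsum; last first.
  by move=> j; apply: differentiableM; [apply: smooth_on_diff (sYc j) Cq|apply: smooth_on_diff (sD _) Cq].
under eq_bigr => j _.
  rewrite derive_mul; [|apply: smooth_on_diff (sYc j) Cq|apply: smooth_on_diff (sD _) Cq].
  over.
rewrite big_split; congr (_ + _) => /=.
  rewrite [RHS]derive_sumE //; apply: eq_bigr => j _; congr (_ * _).
  by rewrite derive_mx ?mxE //; apply: diff_derivable.
rewrite (derive_commute _ _ oC Cq sfc) derive_sumE; last exact: smooth_on_diff (sD _) Cq.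
have eY : mx_in c Y (c q) = Y q by exact: mx_in_at.
apply: eq_bigr => j _; rewrite eY -[LHS]/(_ * _) -[RHS]/(_ * _).
by rewrite (derive_commute _ _ oC Cq sfc).
Qed.

Lemma vder_lie (X Y : M -> 'rV[R]_n) f q : smooth_fun U f -> smooth_vfs U X -> smooth_vfs U Y -> U q ->
  vder X (vder Y f) q - vder Y (vder X f) q = ddir f q (lie X Y q).
Proof.
move=> sf sX sY Uq; have e1 := vder2 sf sX sY Uq; have e2 := vder2 sf sY sX Uq.
have oC := coord_set_open (chart_at q) oU.
have Cq := coord_setP (chart_at_dom q) Uq.
have E := derive_commute (X q) (Y q) oC Cq (sf _ (chart_at_atlas q)).
have cancel (a b c d : R) : b = d -> (a + b) - (c + d) = a - c.
  by move=> ->; rewrite opprD addrACA subrr addr0.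
apply: etrans (congr2 (fun a b => a - b) e1 e2) _.
apply: etrans (cancel _ _ _ _ E) _.
by rewrite /lie (ddir_add _ _ sf Uq) (ddir_opp _ sf Uq).
Qed.

Lemma form_eval k (a : dform M k) (X : M -> 'M[R]_(k, n)) c x : atlas c -> coord_set c U x ->
  a (chart_inv c x) (X (chart_inv c x)) = form_in c a x (mx_in c X x).
Proof.
move=> ac [ix Ux]; rewrite /form_in /mx_in -mulmxA.
have := to_of_chart ac (chart_invP ix).
by rewrite (chart_invK ix) => ->; rewrite mulmx1.
Qed.

Lemma form_in_alternating k (a : dform M k) c x : is_form U a -> coord_set c U x ->
  alternating (form_in c a x).
Proof. by move=> [alt_a _] [_ Ux]; apply: alternating_mulr; apply: alt_a. Qed.

Lemma smooth_eval k (a : dform M k) (X : M -> 'M[R]_(k, n)) :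
  is_form U a -> smooth_vfs U X -> smooth_fun U (fun q => a q (X q)).
Proof.
move=> fa /smooth_vfsP sX c ac.
have s : smooth_on (coord_set c U) (fun x => \sum_(f : {ffun 'I_k -> 'I_n})
     (\prod_i mx_in c X x i (f i)) * form_in c a x (rowsub f 1%:M)).
  apply: smooth_on_sum => // f _; apply: smooth_onM => //.
    by apply: smooth_on_prod => // i _; exact: sX.
  by have [_] := fa; apply.
apply: smooth_on_ext s => // x Ux.
rewrite /= (form_eval a X ac Ux) [RHS]multilinear_expand //.
exact: alternating_multilinear (form_in_alternating fa Ux).
Qed.

Section ExteriorDerivative.
Variables (k : nat) (a : dform M k) (q : M).
Hypotheses (fa : is_form U a) (Uq : U q).
Let c := chart_at q.
Let ac : atlas c := chart_at_atlas q.
Let Cq : coord_set c U (c q) := coord_setP (chart_at_dom q) Uq.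
Let oC : open (coord_set c U) := coord_set_open c oU.

Let alt_in x : coord_set c U x -> alternating (form_in c a x).
Proof. exact: form_in_alternating. Qed.

Let diff_in W : differentiable (fun x => form_in c a x W) (c q).
Proof. by have [_ sa] := fa; apply: smooth_on_diff (sa c W ac) Cq. Qed.

(** Row j is either the direction of differentiation or an argument of the form, and the expression
    is linear in both roles. For equal rows i and j, all terms but the two removing i or j still
    contain both rows, and these two cancel by [alternating_row']. *)
Lemma extd_alternating : alternating (extd a q).
Proof.
split=> [W j r u v subst|W i j ij eW].
  rewrite /extd mulr_sumr -big_split; apply: eq_bigr => i _ /=.
  rewrite [r * _]mulrCA -mulrDr; congr (_ * _).
  have [->|ij] := eqVneq i j.
    have eR w : row' j (subst w) = row' j W.
      by apply/row_matrixP => l; rewrite !row_row' rowK eq_sym (negPf (neq_lift _ _)).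
    by rewrite !eR !rowK eqxx !deriveE // linearP.
  have eR w : row i (subst w) = row i W by rewrite rowK (negPf ij).
  rewrite !eR; have [l jl] : exists l, j = lift i l by case: (unlift_some ij) => l ->; exists l.
  have eS w : row' i (subst w) = rset (row' i W) l w.
    by apply/row_matrixP => m; rewrite row_row' !rowK jl (inj_eq (@lift_inj _ i)) row_row'.
  have e : {near c q, (fun x => form_in c a x (row' i (subst (r *: u + v)))) =1
     fun x => r * form_in c a x (row' i (subst u)) + form_in c a x (row' i (subst v))}.
    have := open_near oC Cq; apply: filterS => x Cx.
    by rewrite !eS (alternating_multilinear (alt_in Cx)).
  rewrite (near_eq_derive _ e) derive_add; [|exact: differentiableM|exact: diff_in].
  rewrite derive_mul; [|exact: differentiable_cst|exact: diff_in].
  by rewrite derive_cst mul0r add0r.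
have z (b : 'rV[R]_n -> R) v : {near c q, b =1 fun=> 0} -> 'D_v b (c q) = 0.
  by move=> e; rewrite (near_eq_derive _ e) derive_cst.
rewrite /extd (bigD1 i) //= (bigD1 j) 1?eq_sym //= big1 ?addr0; last first.
  move=> m /andP[mi mj]; rewrite z ?mulr0 //.
  have [i' ei] : exists l, i = lift m l by case: (unlift_some mi) => l ->; exists l.
  have [j' ej] : exists l, j = lift m l by case: (unlift_some mj) => l ->; exists l.
  have := open_near oC Cq; apply: filterS => x Cx.
  apply: (alternating_eq (i := i') (j := j') (alt_in Cx)).
    by apply: contraNneq ij => e; rewrite ei ej e.
  by rewrite !row_row' -ei -ej.
rewrite -eW.
have e : {near c q, (fun x => (-1) ^+ i * form_in c a x (row' i W) + (-1) ^+ j * form_in c a x (row' j W)) =1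
   fun=> 0}.
  have := open_near oC Cq; apply: filterS => x Cx.
  exact: (alternating_row' (alt_in Cx) ij eW).
have := z _ (row i W) e.
rewrite derive_add; [|exact: differentiableM|exact: differentiableM].
rewrite !derive_mul; try exact: differentiable_cst; try exact: diff_in.
by rewrite !derive_cst !mul0r !add0r.
Qed.

(** The definition of [extd] freezes the vectors in the chart. Letting the fields vary adds the
    derivatives of X_j along X_i; commutation makes these symmetric in i and j, while the signs of
    the exterior derivative are antisymmetric, so the corrections cancel. *)
Lemma extd_frame (X : M -> 'M[R]_(k.+1, n)) :
  smooth_vfs U X ->
  (forall i j, lie (fun q => row i (X q)) (fun q => row j (X q)) q = 0) ->
  extd a q (X q) =
  \sum_(i < k.+1) (-1) ^+ i * ddir (fun q' => a q' (row' i (X q'))) q (row i (X q)).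
Proof.
move=> sX lieX.
pose Xc := mx_in c X.
have sXc i j : smooth_on (coord_set c U) (fun x => Xc x i j) by move/smooth_vfsP : sX; apply.
have Xcq : Xc (c q) = X q by exact: mx_in_at.
(* The derivative of the j-th field along the i-th, in coordinates. *)
pose S i j : 'rV[R]_n := \row_m 'D_(row i (X q)) (fun x => Xc x j m) (c q).
have SC i j : S i j = S j i.
  have D i' j' : S i' j' = 'D_(row i' (X q)) (mx_in c (fun q => row j' (X q))) (c q).
    rewrite derive_mx; last first.
      by apply: diff_derivable; apply: smooth_on_diff (smooth_vfs_row j' sX ac) Cq.
    apply/rowP => m; rewrite [LHS]mxE [RHS]mxE.
    have -> : (fun x => Xc x j' m) = (fun x => mx_in c (fun q => row j' (X q)) x 0 m) => //.
    by apply/funext => x; rewrite /Xc /mx_in -row_mul [RHS]mxE.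
  by apply/eqP; rewrite !D -subr_eq0; apply/eqP; exact: lieX.
have e1 i : ddir (fun q' => a q' (row' i (X q'))) q (row i (X q)) =
    'D_(row i (X q)) (fun x => form_in c a x (row' i (X q))) (c q) +
    \sum_l form_in c a (c q) (rset (row' i (X q)) l (S i (lift i l))).
  have e : {near c q, (fun q' => a q' (row' i (X q'))) \o chart_inv c =1
      fun x => form_in c a x (row' i (Xc x))}.
    have := open_near oC Cq; apply: filterS => x Cx.
    rewrite /= (form_eval a (fun q => row' i (X q)) ac Cx) /mx_in.
    congr form_in; rewrite /Xc /mx_in; apply/row_matrixP => l.
    by rewrite row_mul !row_row' row_mul.
  rewrite /ddir (near_eq_derive _ e).
  rewrite (derive_multilinear (Z := fun x => row' i (Xc x)) _ oC Cq); first last.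
  - move=> l m; apply: smooth_on_diff _ Cq.
    by apply: (smooth_on_ext oC _ (sXc (lift i l) m)) => x _; rewrite [RHS]mxE.
  - exact: diff_in.
  - by move=> y /alt_in /alternating_multilinear.
  rewrite Xcq; congr (_ + _); apply: eq_bigr => l _; congr (form_in _ _ _ (rset _ _ _)).
  apply/rowP => m; rewrite [LHS]mxE [RHS]mxE.
  have -> : (fun y => row' i (Xc y) l m) = (fun x => Xc x (lift i l) m) => //.
  by apply/funext => x; rewrite mxE.
under [RHS]eq_bigr do rewrite e1 mulrDr.
rewrite big_split /=.
set T := (X in _ = _ + X).
suff -> : T = 0 by rewrite addr0.
pose A := form_in c a (c q).
have altA : alternating A by exact: alt_in.
(* Indexed by all pairs, with zeros on the diagonal, so that the order of summation can be
   exchanged. *)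
pose t (i j : 'I_k.+1) := if j == i then 0 else (-1) ^+ i * A (row' i (rset (X q) j (S i j))).
have TE : T = \sum_i \sum_j t i j.
  apply: eq_bigr => i _; rewrite mulr_sumr [RHS](@bigD1_ord _ _ _ _ i xpredT) // /t eqxx [RHS]add0r /=.
  apply: eq_bigr => l _; rewrite [lift i l == i]eq_sym (negPf (neq_lift _ _)); congr (_ * A _).
  apply/row_matrixP => m; rewrite !row_row' !rowK (inj_eq (@lift_inj _ i)).
  by rewrite row_row'.
(* The terms of (i, j) and (j, i) are obtained from one matrix whose rows i and j both equal S i j,
   by removing row i or row j. *)
have TT : T + T = 0.
  rewrite {2}TE exchange_big TE -big_split big1 // => i _.
  rewrite -big_split big1 // => j _ /=; rewrite /t eq_sym; case: eqVneq => [|ij]; first by rewrite addr0.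
  rewrite (_ : row' i _ = row' i (rset (rset (X q) j (S i j)) i (S i j))); last first.
    by apply/row_matrixP => m; rewrite !row_row' !rowK [lift i m == i]eq_sym (negPf (neq_lift _ _)).
  rewrite (_ : row' j _ = row' j (rset (rset (X q) j (S i j)) i (S i j))); last first.
    apply/row_matrixP => m; rewrite !row_row' !rowK [lift j m == j]eq_sym (negPf (neq_lift _ _)).
    by rewrite SC.
  by apply: alternating_row' => //; rewrite !rowK !eqxx; case: ifP.
by apply/eqP; move/eqP: TT; rewrite -mulr2n mulrn_eq0.
Qed.

End ExteriorDerivative.

End VectorFields.

(** * Frames of commuting vector fields *)

Section Frames.
Context {R : realType} {n : nat} {M : manifold R n}.
Implicit Types (c : chart R M n) (q : M).

(* The rows of [frame phi] are the vector fields dual to the differentials of phi. *)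
Definition jac (phi : 'I_n -> M -> R) q : 'M[R]_n :=
  \matrix_(j, i) ddir (phi i) q (delta_mx 0 j).
Definition frame phi q : 'M[R]_n := invmx (jac phi q).

Variables (U : set M) (phi : 'I_n -> M -> R).
Hypotheses (oU : open U) (sphi : forall i, smooth_fun U (phi i))
  (ujac : forall q, U q -> jac phi q \in unitmx).

Lemma mul_jac k (X : 'M[R]_(k, n)) q i l : U q ->
  (X *m jac phi q) l i = ddir (phi i) q (row l X).
Proof.
move=> Uq; rewrite -[row l X]mulmx1 (ddir_mulmx _ _ (sphi i) Uq) mxE.
by apply: eq_bigr => j _; rewrite !mxE row1.
Qed.

Lemma frame_dual q k i : U q -> ddir (phi i) q (row k (frame phi q)) = (k == i)%:R.
Proof. by move=> Uq; rewrite -mul_jac // mulVmx ?ujac // mxE. Qed.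

(** Read in a chart, the frame is the inverse of the matrix of partial derivatives of the functions
    phi, which is smooth by the cofactor formula. *)
Lemma smooth_frame : smooth_vfs U (frame phi).
Proof.
move=> c ac; pose Jc x := \matrix_(j, i) 'D_(delta_mx 0 j) (phi i \o chart_inv c) x.
have oC := coord_set_open c oU.
have E x : coord_set c U x -> jac phi (chart_inv c x) = to_chart c (chart_inv c x) *m Jc x.
  move=> [ix Ux]; have dx := chart_invP ix; apply/matrixP => j i.
  rewrite mxE (ddirE _ (sphi i) Ux ac dx) (chart_invK ix).
  rewrite derive_sumE; last by have := smooth_fun_diff (sphi i) Ux ac dx; rewrite (chart_invK ix).
  by rewrite mxE; apply: eq_bigr => k _; rewrite -rowE !mxE.
have uJ x : coord_set c U x -> Jc x \in unitmx.
  move=> Cx; have [ix Ux] := Cx; have := ujac Ux.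
  by rewrite (E x Cx) unitmx_mul => /andP[].
have sJ : smooth_on (coord_set c U) Jc.
  apply/(smooth_on_mxP _ oC) => j i.
  apply: smooth_on_ext (smooth_on_derive (delta_mx 0 j) (sphi i ac)) => // x _.
  by rewrite mxE.
apply: smooth_on_ext (smooth_on_invmx oC uJ sJ) => // x Cx.
have [ix Ux] := Cx; have dx := chart_invP ix.
have h : mx_in c (frame phi) x *m Jc x = 1%:M.
  by rewrite /mx_in -mulmxA -(E x Cx) mulVmx // ujac.
by rewrite -[LHS]mul1mx -h (mulmxK (uJ x Cx)).
Qed.

(** The fields of the frame have constant derivatives on every phi k, so their bracket annihilates
    all phi k; the differentials of these functions form a basis. *)
Lemma lie_frame q i j : U q ->
  lie (fun q => row i (frame phi q)) (fun q => row j (frame phi q)) q = 0.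
Proof.
move=> Uq; set X := fun q => row i _; set Y := fun q => row j _.
have sX : smooth_vfs U X by apply: smooth_vfs_row; [exact: oU|exact: smooth_frame].
have sY : smooth_vfs U Y by apply: smooth_vfs_row; [exact: oU|exact: smooth_frame].
suff h : lie X Y q *m jac phi q = 0 by rewrite -[LHS](mulmxK (ujac Uq)) h mul0mx.
apply/rowP => k; rewrite [RHS]mxE mul_jac // row_id -(vder_lie oU (sphi k) sX sY Uq).
have e l : ddir (vder (fun q => row l (frame phi q)) (phi k)) q = fun=> 0.
  apply/funext => v.
  by rewrite (ddir_near oU (g := fun=> (l == k)%:R)) ?ddir_cst // => q' Uq'; exact: frame_dual.
by rewrite /vder -/(vder Y _) -/(vder X _) !e subrr.
Qed.

End Frames.

(** * Coordinate fields of a chart *)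

Section ChartFrames.
Context {R : realType} {n : nat} {M : manifold R n}.
Variable c : chart R M n.
Hypothesis ac : atlas c.

Lemma smooth_coord (i : 'I_n) : smooth_fun (chart_dom c) (fun q => c q 0 i).
Proof.
move=> c' ac'; have := transition_smooth ac' ac.
by move/(smooth_on_mxP _ (coord_set_open _ (@chart_dom_open _ _ _ c))); exact.
Qed.

Lemma ddir_coord q v (i : 'I_n) : chart_dom c q ->
  ddir (fun q => c q 0 i) q v = (v *m to_chart c q) 0 i.
Proof.
move=> dq; rewrite -deriveEjacobian; last first.
  exact: transition_diff (chart_at_atlas q) ac (chart_at_dom q) dq.
rewrite derive_mx ?mxE //; apply: diff_derivable.
exact: transition_diff (chart_at_atlas q) ac (chart_at_dom q) dq.
Qed.

Lemma jac_coord q : chart_dom c q -> jac (fun i q => c q 0 i) q = to_chart c q.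
Proof. by move=> dq; apply/matrixP => j i; rewrite mxE ddir_coord // -rowE mxE. Qed.

Lemma to_chart_unit q : chart_dom c q -> to_chart c q \in unitmx.
Proof. by move=> dq; have [h _] := mulmx1_unit (to_of_chart ac dq); exact: h. Qed.

(** The rows of [of_chart] are the frame dual to the coordinate functions of the chart. *)
Lemma smooth_of_chart : smooth_vfs (chart_dom c) (fun q => of_chart c (c q)).
Proof.
have s : smooth_vfs (chart_dom c) (frame (fun i q => c q 0 i)).
  apply: smooth_frame; [exact: chart_dom_open|exact: smooth_coord|].
  by move=> q dq; rewrite jac_coord // to_chart_unit.
move=> c' ac'; apply: smooth_on_ext (s c' ac') => [|x [ix dx]].
  exact: coord_set_open (@chart_dom_open _ _ _ c).
rewrite /mx_in /frame jac_coord //; congr (_ *m _).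
by rewrite -[LHS]mul1mx -(of_to_chart ac dx) (mulmxK (to_chart_unit dx)).
Qed.

End ChartFrames.

(** * Functions pulled back along the projection *)

Section Projection.
Context {R : realType} {m n : nat} {M : manifold R m} {B : manifold R n}.
Variable pi : M -> B.
Hypothesis spi : smooth_map pi.

Lemma open_preim (U : set B) : open U -> open (pi @^-1` U).
Proof. by have [cpi _] := spi; move: cpi => /continuousP; apply. Qed.

Lemma smooth_pull (U : set B) (f : B -> R) : open U -> smooth_fun U f ->
  smooth_fun (pi @^-1` U) (f \o pi).
Proof.
move=> oU sf c ac; apply: smooth_on_local => x [ix Ux].
pose c' := chart_at (pi (chart_inv c x)).
have ac' : atlas c' by apply: chart_at_atlas.
have dc' : chart_dom c' (pi (chart_inv c x)) by apply: chart_at_dom.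
pose W := coord_set c (pi @^-1` (U `&` chart_dom c')).
have oW : open W by apply/coord_set_open/open_preim/openI => //; apply: chart_dom_open.
exists W; first by split.
have [_ sp] := spi.
have h1 : smooth_on W (c' \o pi \o chart_inv c).
  by apply: smooth_on_open_sub (sp c c' ac ac') => y [iy [_ ?]]; split.
have h2 y : W y -> coord_set c' U ((c' \o pi \o chart_inv c) y).
  by move=> [iy [Uy dy]]; exact: coord_setP.
apply: smooth_on_ext (smooth_on_comp oW h2 h1 (sf c' ac')) => // y [iy [Uy dy]] /=.
by rewrite chart_funK.
Qed.

Lemma ddir_pull (U : set B) (f : B -> R) q v : open U -> smooth_fun U f -> U (pi q) ->
  ddir (f \o pi) q v = ddir f (pi q) (v *m tangent pi q).
Proof.
move=> oU sf Uq; have [cpi sp] := spi.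
pose c := chart_at q; pose c' := chart_at (pi q).
have ac : atlas c by apply: chart_at_atlas.
have ac' : atlas c' by apply: chart_at_atlas.
have dc : chart_dom c q by apply: chart_at_dom.
have dc' : chart_dom c' (pi q) by apply: chart_at_dom.
have ec : (c' \o pi \o chart_inv c) (c q) = c' (pi q) by rewrite /= (chart_funK dc).
have dp : differentiable (c' \o pi \o chart_inv c) (c q).
  apply: smooth_on_diff (sp c c' ac ac') _.
  by split; [exact: chart_funP|rewrite (chart_funK dc)].
have near_e : {near c q, (f \o chart_inv c') \o (c' \o pi \o chart_inv c) =1 (f \o pi) \o chart_inv c}.
  have oW : open (coord_set c (pi @^-1` chart_dom c')).
    by apply/coord_set_open/open_preim/chart_dom_open.
  have := open_near oW (coord_setP dc (U := pi @^-1` _) dc').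
  by apply: filterS => y [iy dy] /=; rewrite chart_funK.
rewrite /ddir -/c -/c' -(near_eq_derive v near_e).
rewrite (derive_comp (h := c' \o pi \o chart_inv c) (f := f \o chart_inv c')); [|exact: dp|].
  by rewrite ec (@deriveEjacobian R m n (c' \o pi \o chart_inv c) _ v dp).
by rewrite ec; apply: smooth_fun_diff sf _ _ _.
Qed.

End Projection.

(** * Exterior and interior products *)

Section ExteriorProducts.
Context {R : realType} {n : nat}.

Lemma row_perm_rset k (W : 'M[R]_(k, n)) (s : 'S_k) i w :
  row_perm s (rset W i w) = rset (row_perm s W) ((s^-1)%g i) w.
Proof.
apply/row_matrixP => l; rewrite row_row_perm !rowK row_row_perm.
by rewrite (can2_eq (permK s) (permKV s)).
Qed.

Lemma usubmx_rset k l (X : 'M[R]_(k + l, n)) i w :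
  usubmx (rset X i w) = if fintype.split i is inl i' then rset (usubmx X) i' w else usubmx X.
Proof.
case: split_ordP => j ->; apply/row_matrixP => m; rewrite row_usubmx !rowK.
  by rewrite (inj_eq (@lshift_inj _ _)) row_usubmx.
by rewrite eq_lrshift row_usubmx.
Qed.

Lemma dsubmx_rset k l (X : 'M[R]_(k + l, n)) i w :
  dsubmx (rset X i w) = if fintype.split i is inr i' then rset (dsubmx X) i' w else dsubmx X.
Proof.
case: split_ordP => j ->; apply/row_matrixP => m; rewrite row_dsubmx !rowK.
  by rewrite eq_rlshift row_dsubmx.
by rewrite (inj_eq (@rshift_inj _ _)) row_dsubmx.
Qed.

Lemma row_perm_tperm_eq k (W : 'M[R]_(k, n)) i j :
  row i W = row j W -> row_perm (tperm i j) W = W.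
Proof.
move=> eW; apply/row_matrixP=> l; rewrite row_row_perm.
by case: tpermP => [->|->|].
Qed.

(** For equal rows i and j, composing permutations with the transposition of i and j turns the sum
    into its negative. *)
Lemma wedge_alternating k l (a : 'M[R]_(k, n) -> R) (b : 'M[R]_(l, n) -> R) :
  alternating a -> alternating b -> alternating (wedge a b).
Proof.
move=> /alternating_multilinear Ha /alternating_multilinear Hb.
split=> [W i r u v subst|W i j ij eW]; rewrite /wedge.
  rewrite [r * _]mulrCA -mulrDr; congr (_ * _); rewrite mulr_sumr -big_split.
  apply: eq_bigr => s _ /=; rewrite [r * _]mulrCA -mulrDr; congr (_ * _).
  rewrite -![subst _]/(rset _ _ _) !row_perm_rset !usubmx_rset !dsubmx_rset.
  by case: fintype.split => m; rewrite ?Ha ?Hb; ring.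
apply/eqP; rewrite mulf_eq0; apply/orP; right.
set S := \sum_s _; suff : S = - S by move/eqP; rewrite -addr_eq0 -mulr2n mulrn_eq0.
rewrite {1}/S (reindex_inj (mulIg (tperm i j))) -sumrN; apply: eq_bigr => s _ /=.
rewrite odd_permM odd_tperm ij signr_addb mulrN1 mulNr.
by rewrite row_permM (row_perm_tperm_eq eW).
Qed.

Lemma big_lift_perm k (G : 'S_k.+1 -> R) i0 :
  \sum_s G s = \sum_j \sum_t G (lift_perm i0 j t).
Proof.
rewrite (partition_big (fun s : 'S_k.+1 => s i0) predT) //=.
apply: eq_bigr => j _; rewrite (reindex (lift_perm i0 j)) /=; last first.
  (* Deletes i from the source of the permutation and its image from the target; the default value
     is never taken. *)
  pose ulsf i (s : 'S_k.+1) k := odflt k (unlift (s i) (s (lift i k))).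
  have ulsfK i (s : 'S_k.+1) l : lift (s i) (ulsf i s l) = s (lift i l).
    rewrite /ulsf; have := neq_lift i l.
    by rewrite -(can_eq (permK s)) => /unlift_some[] ? ? ->.
  have inj_ulsf : injective (ulsf i0 _).
    move=> s; apply: can_inj (ulsf (s i0) s^-1%g) _ => k'.
    by rewrite {1}/ulsf ulsfK !permK liftK.
  exists (fun s => perm (inj_ulsf s)) => [s _ | s].
    by apply/permP=> k'; rewrite permE /ulsf lift_perm_lift lift_perm_id liftK.
  move/(s _ =P _) => si0; apply/permP=> l.
  case: (unliftP i0 l) => [k'|] ->; rewrite ?lift_perm_id //.
  by rewrite lift_perm_lift -si0 permE ulsfK.
by apply: eq_bigl => s; rewrite lift_perm_id eqxx.
Qed.

(** Permutations with the same image i of the last index contribute k! equal terms. The maps [us]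
    and [ds] stand for [usubmx] and [dsubmx], whose types mention k + 1; this is convertible to
    [k.+1] only for numerals, where the lemma is used. *)
Lemma wedge_r1 k (a : 'M[R]_(k, n) -> R) (b : 'M[R]_(1, n) -> R) (W : 'M[R]_(k.+1, n))
    (us : 'M[R]_(k.+1, n) -> 'M[R]_(k, n)) (ds : 'M[R]_(k.+1, n) -> 'M[R]_(1, n)) :
  alternating a -> us =1 row' ord_max -> ds =1 row ord_max ->
  (k`! * 1`!)%:R^-1 * (\sum_(s : 'S_k.+1) (-1) ^+ s *
    (a (us (row_perm s W)) * b (ds (row_perm s W)))) =
  \sum_(i < k.+1) (-1) ^+ (k + i) * (a (row' i W) * b (row i W)).
Proof.
move=> Ha Hus Hds; rewrite muln1 (big_lift_perm _ ord_max).
have f0 : (k`!)%:R != 0 :> R by rewrite pnatr_eq0 -lt0n fact_gt0.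
apply: (mulfI f0); rewrite mulrA divff // mul1r mulr_sumr; apply: eq_bigr => i _.
have e t : (-1) ^+ lift_perm ord_max i t * (a (us (row_perm (lift_perm ord_max i t) W)) *
    b (ds (row_perm (lift_perm ord_max i t) W))) = (-1) ^+ (k + i) * (a (row' i W) * b (row i W)).
  rewrite Hus Hds row'_row_perm row_row_perm lift_perm_id alternating_row_perm //.
  rewrite odd_lift_perm -oddD signr_addb (signr_odd _ (_ + _)) /=.
  rewrite -!mulrA; congr (_ * _).
  by rewrite !mulrA -expr2 sqrr_sign mul1r.
under eq_bigr do rewrite e.
by rewrite sumr_const card_Sn mulr_natl.
Qed.

End ExteriorProducts.

(** * Wedge products and determinants of low order *)

Section SmallWedges.
Context {R : realType} {n : nat}.

Lemma rows2E (W : 'M[R]_(2, n)) : W = col_mx (row 0 W) (row 1 W).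
Proof.
apply/row_matrixP => i; case: (split_ordP (i : 'I_(1 + 1))) => j ->; rewrite (ord1 j).
  by rewrite -[RHS](@row_usubmx _ 1 1) col_mxKu row_id; congr row; apply: val_inj.
by rewrite -[RHS](@row_dsubmx _ 1 1) col_mxKd row_id; congr row; apply: val_inj.
Qed.

Lemma rows3E (W : 'M[R]_(3, n)) : W = col_mx (row 0 W) (col_mx (row 1 W) (row 2%:R W)).
Proof.
apply/row_matrixP => i; case: (split_ordP (i : 'I_(1 + 2))) => j ->.
  by rewrite (ord1 j) -[RHS](@row_usubmx _ 1 2) col_mxKu row_id; congr row; apply: val_inj.
rewrite -[RHS](@row_dsubmx _ 1 2) col_mxKd.
case: (split_ordP (j : 'I_(1 + 1))) => j' ->; rewrite (ord1 j').
  by rewrite -[RHS](@row_usubmx _ 1 1) col_mxKu row_id; congr row; apply: val_inj.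
by rewrite -[RHS](@row_dsubmx _ 1 1) col_mxKd row_id; congr row; apply: val_inj.
Qed.

Lemma wedge11 (a b : 'M[R]_(1, n) -> R) (W : 'M[R]_(2, n)) : alternating a ->
  wedge a b W = a (row 0 W) * b (row 1 W) - a (row 1 W) * b (row 0 W).
Proof.
move=> Ha; rewrite [LHS](wedge_r1 (k := 1) b W Ha); first last.
- by move=> X; apply/matrixP => i j; rewrite !mxE; congr (X _ _); apply: val_inj; rewrite (ord1 i).
- by move=> X; apply/matrixP => i j; rewrite !mxE; congr (X _ _); apply: val_inj; rewrite (ord1 i).
rewrite !big_ord_recl big_ord0.
have -> : row' ord0 W = row 1 W by apply/matrixP => i j; rewrite !mxE (ord1 i); congr (W _ _); apply: val_inj.
have -> : row' (lift ord0 ord0) W = row 0 W by apply/matrixP => i j; rewrite !mxE (ord1 i); congr (W _ _); apply: val_inj.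
have -> : lift ord0 ord0 = 1 :> 'I_2 by apply: val_inj.
by rewrite /= !exprS expr0; ring.
Qed.

End SmallWedges.

Section SmallDeterminants.
Context {R : realType}.

Lemma det2E (A : 'M[R]_2) : \det A = A 0 0 * A 1 1 - A 0 1 * A 1 0.
Proof.
pose F i j := A (inord i) (inord j).
have -> : A = \matrix_(i < 2, j < 2) F i j.
  by apply/matrixP => i j; rewrite mxE /F !inord_val.
rewrite (expand_det_row _ 0) !big_ord_recl big_ord0 /cofactor !det_mx11 !mxE /=.
by rewrite /bump /= !exprS expr0; ring.
Qed.

Lemma det3E (A : 'M[R]_3) : \det A =
  A 0 0 * (A 1 1 * A 2%:R 2%:R - A 1 2%:R * A 2%:R 1) -
  A 0 1 * (A 1 0 * A 2%:R 2%:R - A 1 2%:R * A 2%:R 0) +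
  A 0 2%:R * (A 1 0 * A 2%:R 1 - A 1 1 * A 2%:R 0).
Proof.
pose F i j := A (inord i) (inord j).
have -> : A = \matrix_(i < 3, j < 3) F i j.
  by apply/matrixP => i j; rewrite mxE /F !inord_val.
rewrite (expand_det_row _ 0) !big_ord_recl big_ord0 /cofactor !det2E !mxE /=.
by rewrite /bump /= !exprS expr0; ring.
Qed.

Lemma det_col3 (u v w : 'rV[R]_3) : \det (col_mx u (col_mx v w) : 'M[R]_3) =
  u 0 0 * (v 0 1 * w 0 2%:R - v 0 2%:R * w 0 1) -
  u 0 1 * (v 0 0 * w 0 2%:R - v 0 2%:R * w 0 0) +
  u 0 2%:R * (v 0 0 * w 0 1 - v 0 1 * w 0 0).
Proof.
have e0 j : (col_mx u (col_mx v w) : 'M[R]_3) 0 j = u 0 j.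
  by rewrite -[RHS](@col_mxEu _ 1 2 3 u (col_mx v w)); congr (_ _ _); apply: val_inj.
have e1 j : (col_mx u (col_mx v w) : 'M[R]_3) 1 j = v 0 j.
  rewrite -[RHS](@col_mxEu _ 1 1 3 v w) -[RHS](@col_mxEd _ 1 2 3 u (col_mx v w)).
  by congr (_ _ _); apply: val_inj.
have e2 j : (col_mx u (col_mx v w) : 'M[R]_3) 2%:R j = w 0 j.
  rewrite -[RHS](@col_mxEd _ 1 1 3 v w) -[RHS](@col_mxEd _ 1 2 3 u (col_mx v w)).
  by congr (_ _ _); apply: val_inj.
by rewrite det3E !e0 !e1 !e2.
Qed.

End SmallDeterminants.

Section SmallWedges2.
Context {R : realType} {n : nat}.
Implicit Types b : 'M[R]_(1, n) -> R.

Lemma wedge21 (a : 'M[R]_(2, n) -> R) b (W : 'M[R]_(3, n)) : alternating a ->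
  wedge a b W = a (col_mx (row 0 W) (row 1 W)) * b (row 2%:R W)
    - a (col_mx (row 0 W) (row 2%:R W)) * b (row 1 W)
    + a (col_mx (row 1 W) (row 2%:R W)) * b (row 0 W).
Proof.
move=> Ha; rewrite [LHS](wedge_r1 (k := 2) b W Ha); first last.
- by move=> X; apply/matrixP => i j; rewrite !mxE; congr (X _ _); apply: val_inj; rewrite (ord1 i).
- move=> X; apply/row_matrixP => i; rewrite row_row' row_usubmx; congr row; apply: val_inj => /=.
  by rewrite /bump leqNgt ltn_ord.
rewrite !big_ord_recl big_ord0.
have e1 : lift ord0 ord0 = 1 :> 'I_3 by apply: val_inj.
have e2 : lift ord0 (lift ord0 ord0) = 2%:R :> 'I_3 by apply: val_inj.
rewrite e1 in e2 *; rewrite e2.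
have R3 (i j k : 'I_3) : lift i (0 : 'I_2) = j -> lift i (1 : 'I_2) = k -> row' i W = col_mx (row j W) (row k W).
  by move=> <- <-; rewrite [LHS]rows2E !row_row'.
rewrite (R3 ord0 1 2%:R); try exact: val_inj.
rewrite (R3 1 0 2%:R); try exact: val_inj.
rewrite (R3 2%:R 0 1); try exact: val_inj.
by rewrite /= !exprS expr0; ring.
Qed.

Lemma wedge31 (a : 'M[R]_(3, n) -> R) b (u v w x : 'rV[R]_n) : alternating a ->
  wedge a b (col_mx (col_mx u (col_mx v w)) x) =
    a (col_mx u (col_mx v w)) * b x - a (col_mx u (col_mx v x)) * b w
    + a (col_mx u (col_mx w x)) * b v - a (col_mx v (col_mx w x)) * b u.
Proof.
set W : 'M[R]_(4, n) := (X in wedge a b X).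
have r0 : row 0 W = u.
  rewrite (_ : 0 = lshift 1 (lshift 2 (0 : 'I_1)) :> 'I_4); last exact: val_inj.
  by rewrite /W (@rowKu _ 3 1) (@rowKu _ 1 2) row_id.
have r1 : row 1 W = v.
  rewrite (_ : 1 = lshift 1 (rshift 1 (lshift 1 (0 : 'I_1))) :> 'I_4); last exact: val_inj.
  by rewrite /W (@rowKu _ 3 1) (@rowKd _ 1 2) (@rowKu _ 1 1) row_id.
have r2 : row 2%:R W = w.
  rewrite (_ : 2%:R = lshift 1 (rshift 1 (rshift 1 (0 : 'I_1))) :> 'I_4); last exact: val_inj.
  by rewrite /W (@rowKu _ 3 1) (@rowKd _ 1 2) (@rowKd _ 1 1) row_id.
have r3 : row 3%:R W = x.
  rewrite (_ : 3%:R = rshift 3 (0 : 'I_1) :> 'I_4); last exact: val_inj.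
  by rewrite /W (@rowKd _ 3 1) row_id.
move=> Ha; rewrite [LHS](wedge_r1 (k := 3) b W Ha); first last.
- by move=> X; apply/matrixP => i j; rewrite !mxE; congr (X _ _); apply: val_inj; rewrite (ord1 i).
- move=> X; apply/row_matrixP => i; rewrite row_row' row_usubmx; congr row; apply: val_inj => /=.
  by rewrite /bump leqNgt ltn_ord.
rewrite !big_ord_recl big_ord0.
have e1 : lift ord0 ord0 = 1 :> 'I_4 by apply: val_inj.
have e2 : lift ord0 (lift ord0 ord0) = 2%:R :> 'I_4 by apply: val_inj.
have e3 : lift ord0 (lift ord0 (lift ord0 ord0)) = 3%:R :> 'I_4 by apply: val_inj.
have R4 (i j k l : 'I_4) : lift i (0 : 'I_3) = j -> lift i (1 : 'I_3) = k -> lift i (2%:R : 'I_3) = l ->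
    row' i W = col_mx (row j W) (col_mx (row k W) (row l W)).
  by move=> <- <- <-; rewrite [LHS]rows3E !row_row'.
rewrite e3 e2 e1 r0 r1 r2 r3.
rewrite (R4 ord0 1 2%:R 3%:R); try exact: val_inj.
rewrite (R4 1 0 2%:R 3%:R); try exact: val_inj.
rewrite (R4 2%:R 0 1 3%:R); try exact: val_inj.
rewrite (R4 3%:R 0 1 2%:R); try exact: val_inj.
by rewrite r0 r1 r2 r3 /= !exprS expr0; ring.
Qed.

End SmallWedges2.

(** * Determinants as decomposable forms and multivectors *)

Section Determinants.
Context {R : realType}.

Lemma det_alternating k : alternating (fun X : 'M[R]_k => \det X).
Proof.
split=> [W i r u v subst|W i j ij eW].
  have e w w' : row' i (subst w) = row' i (subst w').
    by apply/matrixP => l m; rewrite !mxE [lift i l == i]eq_sym (negPf (neq_lift _ _)).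
  rewrite (@determinant_multilinear _ _ _ (subst u) (subst v) i r 1) ?mul1r //.
  by rewrite scale1r !rowK eqxx.
by apply: (determinant_alternate ij) => l; move/rowP/(_ l): eW; rewrite !mxE.
Qed.

Lemma alternating_scale n k (a : 'M[R]_(k, n) -> R) (r : R) :
  alternating a -> alternating (fun W => r * a W).
Proof.
move=> [Ha Hb]; split=> [W i s u v subst|W i j ij eW].
  by rewrite Ha mulrDr mulrCA.
by rewrite (Hb _ _ _ ij eW) mulr0.
Qed.

Lemma alternating_add n k (a b : 'M[R]_(k, n) -> R) :
  alternating a -> alternating b -> alternating (fun W => a W + b W).
Proof.
move=> [Ha Hb] [Ga Gb]; split=> [W i s u v subst|W i j ij eW].
  by rewrite Ha Ga mulrDr addrACA.
by rewrite (Hb _ _ _ ij eW) (Gb _ _ _ ij eW) addr0.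
Qed.

Lemma det_form_alternating n k (A : 'M[R]_(n, k)) (r : R) :
  alternating (fun W : 'M[R]_(k, n) => r * \det (W *m A)).
Proof. by apply/alternating_scale/(alternating_mulr (a := fun X => \det X))/det_alternating. Qed.

Lemma alternating_col n k l (b : 'M[R]_(k + l, n) -> R) (W : 'M[R]_(l, n)) :
  alternating b -> alternating (fun U : 'M[R]_(k, n) => b (col_mx U W)).
Proof.
move=> Hb; have e U i v : rset (col_mx U W) (lshift l i) v = col_mx (rset U i v) W.
  apply/row_matrixP => m; rewrite rowK; case: (split_ordP m) => m' ->.
    by rewrite (inj_eq (@lshift_inj _ _)) !rowKu rowK.
  by rewrite eq_rlshift !rowKd.
split=> [U i r u v subst|U i j ij eU].
  by rewrite -![subst _]/(rset _ _ _) -!e (alternating_multilinear Hb).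
apply: (alternating_eq (i := lshift l i) (j := lshift l j) Hb).
  by rewrite (inj_eq (@lshift_inj _ _)).
by rewrite !rowKu.
Qed.

(** The k-vector is r times the wedge of the columns of A, so contraction inserts these columns into
    b. They enter in reverse order, whence the sign of the reversal. *)
Lemma iprod_det n k l (A : 'M[R]_(n, k)) (r : R) (b : 'M[R]_(k + l, n) -> R) (W : 'M[R]_(l, n)) :
  alternating b ->
  iprod (fun Xi => r * \det (Xi *m A)) b W =
  r * (-1) ^+ perm (@rev_ord_inj k) * b (col_mx A^T W).
Proof.
move=> Hb; pose c U := b (col_mx U W).
have Hc : alternating c by exact: alternating_col.
have f0 : (k`!)%:R != 0 :> R by rewrite pnatr_eq0 -lt0n fact_gt0.
set rv := perm _; rewrite /iprod; apply: (mulfI f0); rewrite mulrA divff // mul1r.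
(* After the Leibniz expansion, summing over J gives the same value for every permutation s; the k!
   equal values cancel the normalisation. *)
pose F (J : {ffun 'I_k -> 'I_n}) (s : 'S_k) :=
  r * ((-1) ^+ s * (\prod_i A (J i) (s i) * c (\matrix_i delta_mx 0 (J (rev_ord i))))).
transitivity (\sum_J \sum_s F J s).
  apply: eq_bigr => J _; rewrite -mulr_sumr -mulrA; congr (_ * _).
  rewrite /(\det _) big_distrl; apply: eq_bigr => s _; rewrite -[LHS]mulrA; congr (_ * (_ * _)).
  apply: eq_bigr => i _; rewrite mxE (bigD1 (J i)) //= big1 => [|j ji].
    by rewrite !mxE !eqxx mul1r addr0.
  by rewrite !mxE (negPf ji) andbF mul0r.
rewrite exchange_big /=.
have e s : \sum_J F J s = r * (-1) ^+ rv * c A^T.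
  transitivity (r * ((-1) ^+ s * c (row_perm (rv * s)%g A^T))).
    rewrite -2!mulr_sumr; congr (_ * (_ * _)).
    rewrite [RHS](multilinear_expand _ (alternating_multilinear Hc)).
    rewrite (reindex_inj (h := fun J : {ffun 'I_k -> 'I_n} => [ffun i => J (rev_ord i)])).
      apply: eq_bigr => J _; congr (_ * c _).
        rewrite [RHS](reindex_inj (@rev_ord_inj k)).
        by apply: eq_bigr => i _; rewrite ffunE !mxE permM permE rev_ordK.
      by apply/matrixP => i j; rewrite !mxE ffunE rev_ordK !eqxx /= eq_sym.
    by move=> J J' /ffunP e; apply/ffunP => i; have := e (rev_ord i); rewrite !ffunE rev_ordK.
  rewrite alternating_row_perm // odd_permM signr_addb -!mulrA; congr (_ * _).
  by rewrite [LHS]mulrCA; congr (_ * _); rewrite mulrA -expr2 sqrr_sign mul1r.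
under eq_bigr do rewrite e.
by rewrite sumr_const card_Sn mulr_natl.
Qed.

Lemma odd_rev1 : perm (@rev_ord_inj 1) = false :> bool.
Proof. by rewrite (_ : perm _ = 1%g) ?odd_perm1 //; apply/permP => i; rewrite !(ord1 (_ i)). Qed.

Lemma odd_rev2 : perm (@rev_ord_inj 2) = true :> bool.
Proof.
rewrite (_ : perm _ = tperm 0 1) ?odd_tperm //; apply/permP => i; apply: val_inj.
rewrite permE; case: tpermP => [->|->|] //=.
by case: i => [[|[|//]]] hi //= h h'; [case: h|case: h']; apply: val_inj.
Qed.

Lemma odd_rev3 : perm (@rev_ord_inj 3) = true :> bool.
Proof.
rewrite (_ : perm _ = tperm 0 2%:R) ?odd_tperm //; apply/permP => i; apply: val_inj.
rewrite permE; case: tpermP => [->|->|] //=.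
by case: i => [[|[|[|//]]]] hi //= h h'; [case: h|case: h']; apply: val_inj.
Qed.

(* The Laplace expansion of a determinant of order 5 along its first two columns. *)
Lemma wedge_det (T : 'M[R]_(5, 2)) (H : 'M[R]_(5, 3)) (r s : R) (W : 'M[R]_5) :
  wedge (fun U : 'M[R]_(2, 5) => r * \det (U *m T)) (fun U : 'M[R]_(3, 5) => s * \det (U *m H)) W
  = r * s * \det (W *m (row_mx T H : 'M[R]_5)).
Proof.
(* The case where T and H select the first two and the last three columns; the general case follows
   by composing with [row_mx T H]. *)
pose pa (U : 'M[R]_(2, 5)) := \det (@lsubmx R 2 2 3 U).
pose pb (U : 'M[R]_(3, 5)) := \det (@rsubmx R 3 2 3 U).
have pab_alt : alternating (wedge pa pb).
  apply: wedge_alternating.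
    have := det_form_alternating (@col_mx R 2 3 2 1%:M 0 : 'M[R]_(5, 2)) 1.
    congr alternating; apply/funext => U; rewrite mul1r /pa -[in LHS](@hsubmxK _ 2 2 3 U).
    by rewrite (@mul_row_col _ 2 2 3 2) mulmx1 mulmx0 addr0.
  have := det_form_alternating (@col_mx R 2 3 3 0 1%:M : 'M[R]_(5, 3)) 1.
  congr alternating; apply/funext => U; rewrite mul1r /pb -[in LHS](@hsubmxK _ 3 2 3 U).
  by rewrite (@mul_row_col _ 3 2 3 3) mulmx1 mulmx0 add0r.
have -> : wedge (fun U : 'M[R]_(2, 5) => r * \det (U *m T)) (fun U : 'M[R]_(3, 5) => s * \det (U *m H)) W =
    r * s * wedge pa pb (W *m (row_mx T H : 'M[R]_5)).
  rewrite /wedge mulrCA; congr (_ * _); rewrite mulr_sumr; apply: eq_bigr => t _.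
  rewrite [r * s * _]mulrCA; congr (_ * _).
  have -> : row_perm t (W *m (row_mx T H : 'M[R]_5)) = row_perm t W *m row_mx T H.
    by rewrite !row_permE mulmxA.
  have -> : usubmx (row_perm t W *m row_mx T H) = usubmx (row_perm t W) *m row_mx T H.
    by rewrite mul_usub_mx.
  have -> : dsubmx (row_perm t W *m row_mx T H) = dsubmx (row_perm t W) *m row_mx T H.
    by rewrite mul_dsub_mx.
  rewrite /pa /pb !mul_mx_row !row_mxKl !row_mxKr; ring.
congr (_ * _); rewrite -[X in wedge _ _ X]mulmx1 alternating_mulmx // -[RHS]mulr1; congr (_ * _).
rewrite /wedge.
(* The permutations preserving the first two indices. At the identity matrix only they contribute,
   each by 1, because the permutation matrix is block triangular and its two blocks share its
   sign. *)
pose st (t : 'S_5) := (t ord0 < 2)%N && (t (lift ord0 ord0) < 2)%N.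
have term (t : 'S_5) : (-1) ^+ t * (pa (@usubmx R 2 3 5 (row_perm t 1%:M)) * pb (@dsubmx R 2 3 5 (row_perm t 1%:M))) =
    (st t)%:R.
  rewrite -/(perm_mx t) -det_perm; set P : 'M[R]_(2 + 3) := perm_mx t.
  have Pij i j : P i j = (t i == j)%:R by rewrite /P !mxE.
  have detP : \det P = (-1) ^+ t by rewrite /P det_perm.
  clearbody P.
  rewrite /pa /pb -/(ulsubmx P) -/(drsubmx P).
  case: (boolP (st t)) => [/andP[t0 t1]|nst].
    have u0 : ursubmx P = 0.
      apply/matrixP => i j; rewrite !mxE Pij; apply/eqP; rewrite pnatr_eq0 eqb0.
      have ti : (t (lshift 3 i) < 2)%N.
        by case: (split_ordP (i : 'I_(1 + 1))) => m ->; rewrite (ord1 m);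
          [move: t0|move: t1]; congr (t _ < 2)%N; apply: val_inj.
      by apply: contraTN ti => /eqP ->.
    have dP : \det P = \det (ulsubmx P) * \det (drsubmx P).
      by rewrite -[in LHS](submxK P) u0 det_lblock.
    by rewrite -dP detP -expr2 sqrr_sign.
  suff [i ti] : exists i : 'I_2, (1 < t (lshift 3 i))%N.
    have -> : \det (ulsubmx P) = 0.
      apply: (multilinear_row0 (i := i) (alternating_multilinear (@det_alternating 2))).
      apply/rowP => j; rewrite !mxE Pij; apply/eqP; rewrite pnatr_eq0 eqb0.
      by apply: contraTN ti => /eqP ->; rewrite -leqNgt -ltnS /= ltn_ord.
    by rewrite mul0r mulr0.
  move: nst; rewrite negb_and -!leqNgt => /orP[h|h].
    by exists 0; move: h; congr (_ < t _)%N; apply: val_inj.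
  by exists 1; move: h; congr (_ < t _)%N; apply: val_inj.
have f0 : (2`! * 3`!)%:R != 0 :> R by rewrite pnatr_eq0.
apply: (mulfI f0); rewrite mulrA divff // mul1r mulr1.
under eq_bigr do rewrite term.
rewrite (big_lift_perm _ ord0).
(* Once the images of the first two indices are fixed, 3! = 6 permutations remain. *)
have inner (j : 'I_5) : \sum_(t : 'S_4) (st (lift_perm ord0 j t))%:R =
    6%:R * \sum_(m < 4) ((j < 2)%N && (lift j m < 2)%N)%:R :> R.
  rewrite (big_lift_perm _ ord0) mulr_sumr; apply: eq_bigr => m _.
  have e (t : 'S_3) : (st (lift_perm ord0 j (lift_perm ord0 m t)))%:R =
      ((j < 2)%N && (lift j m < 2)%N)%:R :> R.
    by rewrite /st lift_perm_id lift_perm_lift lift_perm_id.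
  by under eq_bigr do rewrite e; rewrite sumr_const card_Sn -[LHS]mulr_natl; congr (_%:R * _).
under eq_bigr do rewrite inner.
rewrite !big_ord_recl !big_ord0 /= /bump /=.
rewrite (_ : (2`! * 3`!)%N = 12%N) //; ring.
Qed.

End Determinants.

(** * Components along two complementary projections *)

Section Bicomponents.
Context {R : realType} {n : nat}.

(** Every row lies in the range of one projection and the kernel of the other; any index set other
    than S0 sends some row to 0. *)
Lemma bicomp_homog (P1 P2 : 'M[R]_n) p k (a : 'M[R]_(k, n) -> R) (W : 'M[R]_(k, n)) (S0 : {set 'I_k}) :
  multilinear a ->
  (forall i, i \in S0 -> row i W *m P1 = row i W /\ row i W *m P2 = 0) ->
  (forall i, i \notin S0 -> row i W *m P1 = 0 /\ row i W *m P2 = row i W) ->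
  bicomp P1 P2 p a W = if #|S0| == p then a W else 0.
Proof.
move=> Ha H1 H2.
have z S : S != S0 -> a (\matrix_i (row i W *m (if i \in S then P1 else P2))) = 0.
  move=> SS0; have [i iS] : exists i, (i \in S) != (i \in S0).
    by apply/existsP; apply: contraR SS0 => /existsPn h; apply/eqP/setP => i; apply/eqP; exact: negbNE (h i).
  apply: (multilinear_row0 (i := i) Ha); rewrite rowK.
  case: (boolP (i \in S0)) iS => [/H1 [_ h]|/H2 [h _]]; case: (i \in S) => //.
rewrite /bicomp; case: ifP => [/eqP <-|/eqP c].
  rewrite (bigD1 S0) //= big1 ?addr0 => [|S /andP[_ /z //]].
  congr a; apply/row_matrixP => i; rewrite rowK.
  by case: (boolP (i \in S0)) => [/H1 []|/H2 []].
by rewrite big1 // => S /eqP cS; apply: z; apply: contra_not_neq c => <-.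
Qed.

Lemma bicomp0 (P1 P2 : 'M[R]_n) k (a : 'M[R]_(k, n) -> R) W : bicomp P1 P2 0 a W = a (W *m P2).
Proof.
rewrite /bicomp (eq_bigl (pred1 finset.set0)) => [|S]; last by rewrite /= cards_eq0.
rewrite big_pred1_eq; congr a; apply/row_matrixP => i; rewrite rowK.
by rewrite finset.in_set0 row_mul.
Qed.

Lemma bicomp_full (P1 P2 : 'M[R]_n) k (a : 'M[R]_(k, n) -> R) W : bicomp P1 P2 k a W = a (W *m P1).
Proof.
rewrite /bicomp (eq_bigl (pred1 [set: 'I_k]%SET)) => [|S].
  rewrite big_pred1_eq; congr a; apply/row_matrixP => i; rewrite rowK.
  by rewrite finset.in_setT row_mul.
have le : (#|S| <= k)%N by rewrite -[X in (_ <= X)%N]card_ord max_card.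
by rewrite /= eqEcard finset.subsetT cardsT card_ord eqn_leq le.
Qed.

(** When rows i and j agree, exchanging i and j in the index sets permutes the terms and changes
    their signs, so the sum is its own negative. *)
Lemma bicomp_alternating (P1 P2 : 'M[R]_n) p k (a : 'M[R]_(k, n) -> R) :
  alternating a -> alternating (bicomp P1 P2 p a).
Proof.
move=> Ha; have Hm := alternating_multilinear Ha.
split=> [W i r u v subst|W i j ij eW]; rewrite /bicomp.
  rewrite mulr_sumr -big_split; apply: eq_bigr => S _ /=.
  have e w : \matrix_l (row l (subst w) *m (if l \in S then P1 else P2)) =
     rset (\matrix_l (row l W *m (if l \in S then P1 else P2))) i (w *m (if i \in S then P1 else P2)).
    by apply/row_matrixP => l; rewrite !rowK; case: eqP => [->|].
  by rewrite !e mulmxDl -scalemxAl Hm.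
set T := \sum_(S | _) _; suff : T = - T by move/eqP; rewrite -addr_eq0 -mulr2n mulrn_eq0 => /eqP.
pose t := tperm i j.
rewrite {1}/T (reindex_inj (h := fun S : {set 'I_k} => [set l | t l \in S]%SET)); last first.
  move=> S S' /setP e; apply/setP => l; have := e (t l).
  by rewrite !inE tpermK.
rewrite -sumrN; apply: eq_big => [S|S _].
  rewrite -(card_imset (mem S) (@perm_inj _ t)); congr (_ == _); apply: eq_card => l.
  rewrite inE; apply/idP/imsetP => [h|[m mS ->]]; last by rewrite tpermK.
  by exists (t l); rewrite ?tpermK.
rewrite -(alternating_swap _ Ha ij); congr a; apply/row_matrixP => l.
rewrite row_row_perm !rowK inE; congr (_ *m _).
by rewrite -row_row_perm row_perm_tperm_eq.
Qed.

End Bicomponents.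

(** * Fibred coordinates *)

(** Through this lemma every object named by [get] is replaced by an explicit formula, from
    existence and uniqueness. *)
Lemma get_eq (T : pointedType) (P : set T) x : P x -> (forall y, P y -> y = x) -> get P = x.
Proof. by move=> Px Pu; apply: Pu; apply: getPex; exists x. Qed.

Section AdaptedFrame.
Context {R : realType} {M : manifold R 5} {B : manifold R 2}.
Variable pi : M -> B.
Hypothesis bundle : fiber_bundle pi.
Let spi : smooth_map pi. Proof. by case: bundle. Qed.

(** Two functions come from a chart of B and three are functions z on M; only smoothness and
    independent differentials are asked of them, as the calculus uses the dual frame alone. *)
Definition adapted (cB : chart R B 2) (z : 'I_3 -> M -> R) (i : 'I_(2 + 3)) : M -> R :=
  match fintype.split i with inl j => fun q => cB (pi q) 0 j | inr a => z a end.

Record adapted_frame (O : set M) (cB : chart R B 2) (z : 'I_3 -> M -> R) : Prop := AdaptedFrame {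
  af_open : open O;
  af_atlas : atlas cB;
  af_dom : forall q, O q -> chart_dom cB (pi q);
  af_smooth : forall a, smooth_fun O (z a);
  af_unit : forall q, O q -> jac (adapted cB z : 'I_5 -> M -> R) q \in unitmx }.

Lemma smooth_base (U : set M) cB (j : 'I_2) : atlas cB ->
  (forall q, U q -> chart_dom cB (pi q)) -> smooth_fun U (fun q => cB (pi q) 0 j).
Proof.
move=> acB UcB; apply: smooth_fun_sub (smooth_pull spi (@chart_dom_open _ _ _ cB) (smooth_coord acB j)).
by move=> q /UcB.
Qed.

Lemma smooth_adapted O cB z i : adapted_frame O cB z -> smooth_fun O (adapted cB z i).
Proof.
move=> [oO acB dO sz _]; rewrite /adapted; case: fintype.split => [j|a]; last exact: sz.
exact: smooth_base.
Qed.

Lemma ddir_base cB (j : 'I_2) q v : atlas cB -> chart_dom cB (pi q) ->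
  ddir (fun q => cB (pi q) 0 j) q v = (v *m tangent pi q *m to_chart cB (pi q)) 0 j.
Proof.
move=> acB dq.
rewrite [LHS](ddir_pull spi v (@chart_dom_open _ _ _ cB) (smooth_coord acB j) dq).
by rewrite ddir_coord.
Qed.

(** In the factorisation of T by Gaussian elimination, the first two columns of the left invertible
    factor span the columns of T; its last three complete them. *)
Lemma complete_cols (T : 'M[R]_(5, 2)) : row_full T ->
  exists S : 'M[R]_(5, 3), (row_mx T S : 'M[R]_5) \in unitmx.
Proof.
move=> fT; have rT : \rank T = 2%N by apply/eqP.
pose L := col_ebase T; pose L1 := @lsubmx R 5 2 3 L; pose L2 := @rsubmx R 5 2 3 L.
exists L2.
have eT : T = L1 *m row_ebase T.
  rewrite -{1}(mulmx_ebase T) rT -/L -[L](@hsubmxK _ 5 2 3) -/L1 -/L2.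
  have -> : (pid_mx 2 : 'M[R]_(5, 2)) = @col_mx R 2 3 2 1%:M 0.
    by rewrite (@pid_mx_col _ 3 2).
  by rewrite (@mul_row_col _ 5 2 3 2) mulmx1 mulmx0 addr0.
have -> : (row_mx T L2 : 'M[R]_5) = L *m (@block_mx R 2 3 2 3 (row_ebase T) 0 0 1%:M).
  rewrite -[L](@hsubmxK _ 5 2 3) (@mul_row_block _ 5 2 3 2 3) !mulmx0 mulmx1 addr0 add0r.
  by rewrite -eT.
rewrite unitmx_mul col_ebase_unit /= unitmxE (@det_ublock _ 2 3) det1 mulr1 -unitmxE.
exact: row_ebase_unit.
Qed.

(** Completing the tangent map of pi at p0 to an invertible matrix gives independence there; a
    determinant then keeps it nearby. *)
Lemma adapted_frame_exists (U : set M) p0 : open U -> U p0 ->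
  exists O cB z, [/\ adapted_frame O cB z, O p0 & O `<=` U].
Proof.
move=> oU Up0; pose cB := chart_at (pi p0); pose c0 := chart_at p0.
have acB : atlas cB by apply: chart_at_atlas.
have ac0 : atlas c0 by apply: chart_at_atlas.
have [S uS] := complete_cols (let: And3 _ _ h := bundle in h p0).
(* Linear in the coordinates of the preferred chart at p0, with the completing columns as
   coefficients. *)
pose z (a : 'I_3) q := \sum_j c0 q 0 j * S j a.
pose W := U `&` (chart_dom c0 `&` (pi @^-1` chart_dom cB)).
have oW : open W.
  apply: openI => //; apply: openI; first exact: chart_dom_open.
  by apply: open_preim => //; apply: chart_dom_open.
have dc0 q : W q -> chart_dom c0 q by move=> [_ []].
have dcB q : W q -> chart_dom cB (pi q) by move=> [_ []].
have sc0 j : smooth_fun W (fun q => c0 q 0 j) by apply: smooth_fun_sub (smooth_coord ac0 j) => q /dc0.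
have sz a : smooth_fun W (z a).
  apply: smooth_fun_sum => // j _; apply: smooth_funM => //; exact: smooth_fun_cst.
pose Phi : 'I_5 -> M -> R := adapted cB z.
have sPhi i : smooth_fun W (Phi i).
  rewrite /Phi /adapted; case: fintype.split => [j|a]; last exact: sz.
  exact: smooth_base.
(* The Jacobian matrix read in the fixed chart c0. [jac] itself refers to the preferred charts of
   nearby points and need not be continuous. *)
pose G q := \matrix_(j, i) ddir (Phi i) q (row j (of_chart c0 (c0 q))).
have GJ q : W q -> G q = of_chart c0 (c0 q) *m jac Phi q.
  move=> Wq; apply/matrixP => j i; rewrite mxE; apply: esym.
  exact: (mul_jac sPhi _ _ _ Wq).
have Gu q : W q -> (jac Phi q \in unitmx) = (\det (G q) != 0).
  move=> Wq; rewrite GJ // -unitfE -unitmxE unitmx_mul.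
  by have [_ ->] := mulmx1_unit (to_of_chart ac0 (dc0 q Wq)).
have sG : smooth_fun W (fun q => \det (G q)).
  apply: smooth_fun_det => // j i.
  have sX : smooth_vfs W (fun q => row j (of_chart c0 (c0 q))).
    apply: smooth_vfs_row => // c ac.
    apply: smooth_on_open_sub (smooth_of_chart ac0 ac); apply: coord_set_sub => q; exact: dc0.
  have s := smooth_vder oW (sPhi i) sX.
  by apply: smooth_fun_ext s => // q _; rewrite mxE.
exists (W `&` [set q | \det (G q) != 0]), cB, z; split.
- split=> //.
  + rewrite openE => q [Wq Gq].
    have c : {for q, continuous (fun q => \det (G q))} by apply: smooth_fun_cont sG Wq.
    have n1 := open_near oW Wq.
    have n2 : \forall y \near q, \det (G y) != 0 by exact: (c _ (open_near (@open_neq _ 0) Gq)).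
    by apply: filterS2 n1 n2.
  + by move=> q [/dcB].
  + by move=> a; apply: smooth_fun_sub (sz a) => q [].
  + by move=> q [Wq Gq]; rewrite Gu.
- have Wp0 : W p0 by split=> //; split; apply: chart_at_dom.
  split=> //=; rewrite -Gu //.
  suff -> : jac Phi p0 = row_mx (tangent pi p0) S by [].
  apply/matrixP => j i; rewrite [LHS]mxE.
  case: (split_ordP (i : 'I_(2 + 3))) => m ->.
    rewrite /Phi /adapted (unsplitK (inl m)) (ddir_base _ _ acB (dcB _ Wp0)) to_chart_at mulmx1.
    by rewrite (@row_mxEl _ 5 2 3) -rowE mxE.
  rewrite /Phi /adapted (unsplitK (inr m)) (@row_mxEr _ 5 2 3).
  rewrite (ddir_sum oW) //; last by move=> l _; apply: smooth_funM => //; exact: smooth_fun_cst.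
  rewrite (bigD1 j) //= big1 => [|l lj].
    rewrite (ddirM _ (sc0 j) (smooth_fun_cst oW (S j m)) Wp0).
    by rewrite ddir_cst mulr0 addr0 (ddir_coord ac0 _ _ (dc0 _ Wp0)) to_chart_at mulmx1 mxE !eqxx mul1r addr0.
  rewrite (ddirM _ (sc0 l) (smooth_fun_cst oW (S l m)) Wp0).
  by rewrite ddir_cst mulr0 addr0 (ddir_coord ac0 _ _ (dc0 _ Wp0)) to_chart_at mulmx1 mxE (negPf lj) andbF mul0r.
- by move=> q [[]].
Qed.

End AdaptedFrame.

(** * Connections and volume forms in fibred coordinates *)

Section AdaptedCalculus.
Context {R : realType} {M : manifold R 5} {B : manifold R 2}.
Variable pi : M -> B.
Hypothesis bundle : fiber_bundle pi.
Variables (O : set M) (cB : chart R B 2) (z : 'I_3 -> M -> R).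
Hypothesis af : adapted_frame pi O cB z.
Let Phi : 'I_5 -> M -> R := adapted pi cB z.
Let oO : open O := af_open af.
Let sPhi i : smooth_fun O (Phi i) := smooth_adapted bundle i af.
Let uJ q : O q -> jac Phi q \in unitmx := @af_unit _ _ _ _ _ _ _ af q.
Let E q : 'M[R]_(2 + 3, 5) := frame Phi q.
Let J q : 'M[R]_(5, 2 + 3) := jac Phi q.

(** The columns of [db] and [dz] are the differentials of the base and fibre coordinates; the rows
    of [Db] and [Dz] are the dual vector fields. *)
Definition db q : 'M[R]_(5, 2) := lsubmx (J q).
Definition dz q : 'M[R]_(5, 3) := rsubmx (J q).
Definition Db q : 'M[R]_(2, 5) := usubmx (E q).
Definition Dz q : 'M[R]_(3, 5) := dsubmx (E q).

Section Point.
Variable q : M.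
Hypothesis Oq : O q.

Lemma frame_blocks : [/\ Db q *m db q = 1%:M, Db q *m dz q = 0, Dz q *m db q = 0 & Dz q *m dz q = 1%:M].
Proof.
have : E q *m J q = 1%:M by exact: mulVmx (uJ Oq).
rewrite -[E q]vsubmxK -[J q]hsubmxK mul_col_row scalar_mx_block.
by case/eq_block_mx.
Qed.

Lemma coframe_blocks : db q *m Db q + dz q *m Dz q = 1%:M.
Proof.
have : J q *m E q = 1%:M by exact: mulmxV (uJ Oq).
by rewrite -[J q]hsubmxK -[E q]vsubmxK mul_row_col.
Qed.

Lemma Db_db : Db q *m db q = 1%:M. Proof. by case: frame_blocks. Qed.
Lemma Db_dz : Db q *m dz q = 0. Proof. by case: frame_blocks. Qed.
Lemma Dz_db : Dz q *m db q = 0. Proof. by case: frame_blocks. Qed.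
Lemma Dz_dz : Dz q *m dz q = 1%:M. Proof. by case: frame_blocks. Qed.

Lemma dbE : db q = tangent pi q *m to_chart cB (pi q).
Proof.
apply/matrixP => j i; rewrite /db mxE mxE /Phi /adapted (unsplitK (inl i)).
by rewrite (ddir_base bundle _ _ (af_atlas af) (af_dom af Oq)) -mulmxA -rowE mxE.
Qed.

Lemma tangentE : tangent pi q = db q *m of_chart cB (cB (pi q)).
Proof. by rewrite dbE -mulmxA (to_of_chart (af_atlas af) (af_dom af Oq)) mulmx1. Qed.

Lemma verticalP v : vertical pi q v <-> v *m db q = 0.
Proof.
rewrite /vertical tangentE; split=> [h|h]; last by rewrite mulmxA h mul0mx.
rewrite -[db q]mulmx1 -(of_to_chart (af_atlas af) (af_dom af Oq)).
by rewrite 2!mulmxA -(mulmxA v) h mul0mx.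
Qed.

Lemma ddir_z v (a : 'I_3) : ddir (z a) q v = (v *m dz q) 0 a.
Proof.
have := mul_jac sPhi v (rshift 2 a) 0 Oq.
rewrite /Phi /adapted (unsplitK (inr a)) row_id => <-.
by rewrite -[jac _ _](@hsubmxK _ 5 2 3) (@mul_mx_row _ 1 5 2 3) (@row_mxEr _ 1 2 3).
Qed.

End Point.

Lemma smooth_Db : smooth_vfs O Db.
Proof.
have sE := smooth_frame oO sPhi uJ.
apply/(smooth_vfsP oO) => c i j ac.
apply: (smooth_on_ext (coord_set_open c oO) _ (_ : smooth_on _ (fun x => mx_in c (frame Phi) x (lshift 3 i : 'I_(2 + 3)) j))).
  by move=> x _; rewrite /mx_in /Db mul_usub_mx [RHS]mxE.
by move/(smooth_vfsP oO) : sE; apply.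
Qed.

Lemma smooth_Dz : smooth_vfs O Dz.
Proof.
have sE := smooth_frame oO sPhi uJ.
apply/(smooth_vfsP oO) => c i j ac.
apply: (smooth_on_ext (coord_set_open c oO) _ (_ : smooth_on _ (fun x => mx_in c (frame Phi) x (rshift 2 i : 'I_(2 + 3)) j))).
  by move=> x _; rewrite /mx_in /Dz mul_dsub_mx [RHS]mxE.
by move/(smooth_vfsP oO) : sE; apply.
Qed.

(** * A connection in fibred coordinates *)

Section Connection.
Variable gamma : M -> 'M[R]_5.
Hypothesis cg : connection pi O gamma.

(* The horizontal lift of the i-th coordinate field is Db i + sum_a hz i a Dz a. *)
Definition hz q : 'M[R]_(2, 3) := - (Db q *m gamma q *m dz q).
Definition Yh q : 'M[R]_(2, 5) := Db q + hz q *m Dz q.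
(** The columns are the connection 1-forms: they annihilate the lifts [Yh] and are dual to the
    vertical frame [Dz]. *)
Definition vcov q : 'M[R]_(5, 3) := dz q - db q *m hz q.

Section Point.
Variable q : M.
Hypothesis Oq : O q.

Lemma gamma_db : gamma q *m db q = 0.
Proof.
apply/row_matrixP => i; have [_ /(_ q Oq) h] := cg.
have [/(verticalP Oq) v _] := h (delta_mx 0 i).
by rewrite !rowE mulmxA v mulmx0.
Qed.

Lemma Dz_gamma : Dz q *m gamma q = Dz q.
Proof.
apply/row_matrixP => i; have [_ /(_ q Oq) h] := cg.
have [_ h2] := h (row i (Dz q)); rewrite row_mul; apply: h2.
by apply/verticalP => //; rewrite -row_mul (Dz_db Oq) row0.
Qed.

Lemma gammaE : gamma q = vcov q *m Dz q.
Proof.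
have e1 : Db q *m gamma q = - (hz q *m Dz q).
  rewrite /hz mulNmx opprK -[LHS]mulmx1 -(coframe_blocks Oq) mulmxDr !mulmxA.
  by rewrite -(mulmxA (Db q)) gamma_db mulmx0 mul0mx add0r.
rewrite -[LHS]mul1mx -(coframe_blocks Oq) mulmxDl -!mulmxA e1 Dz_gamma.
by rewrite mulmxN /vcov mulmxBl addrC !mulmxA.
Qed.

Lemma Dz_vcov : Dz q *m vcov q = 1%:M.
Proof. by rewrite /vcov mulmxBr (Dz_dz Oq) mulmxA (Dz_db Oq) mul0mx subr0. Qed.
Lemma Yh_vcov : Yh q *m vcov q = 0.
Proof.
rewrite /Yh mulmxDl -[hz q *m _ *m _]mulmxA Dz_vcov mulmx1 /vcov mulmxBr (Db_dz Oq).
by rewrite mulmxA (Db_db Oq) mul1mx sub0r addNr.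
Qed.
Lemma Yh_db : Yh q *m db q = 1%:M.
Proof. by rewrite /Yh mulmxDl (Db_db Oq) -mulmxA (Dz_db Oq) mulmx0 addr0. Qed.

Lemma cogammaE : 1%:M - gamma q = db q *m Yh q.
Proof.
rewrite -(coframe_blocks Oq) gammaE /vcov /Yh mulmxBl mulmxDr opprB mulmxA.
by rewrite -addrA; congr (_ + _); rewrite addrC subrK.
Qed.

(** The choice of right inverse disappears: 1 - gamma factors through [db], hence through the
    tangent map that the right inverse undoes. *)
Lemma hliftE : hlift pi gamma q = to_chart cB (pi q) *m Yh q.
Proof.
have ft : row_full (tangent pi q) by case: bundle.
rewrite /hlift cogammaE dbE // !mulmxA; congr (_ *m _).
by rewrite mulVpmx // mul1mx.
Qed.

Lemma frame_Yh : (col_mx (Yh q) (Dz q) : 'M[R]_5) =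
  (block_mx 1%:M (hz q) 0 1%:M : 'M[R]_(2 + 3)) *m col_mx (Db q) (Dz q).
Proof. by rewrite mul_block_col !mul1mx mul0mx add0r. Qed.

Lemma coframe_Yh : (col_mx (Yh q) (Dz q) : 'M[R]_5) *m (row_mx (db q) (vcov q) : 'M[R]_5) = 1%:M.
Proof.
by rewrite (@mul_col_row _ 2 3 5 2 3) Yh_db Yh_vcov (Dz_db Oq) Dz_vcov -scalar_mx_block.
Qed.

Lemma decomp k (W : 'M[R]_(k, 5)) : W = (W *m db q) *m Yh q + (W *m vcov q) *m Dz q.
Proof. by rewrite -!mulmxA -cogammaE // -gammaE -mulmxDr subrK mulmx1. Qed.

Lemma gamma_vcov : gamma q *m vcov q = vcov q.
Proof. by rewrite gammaE -mulmxA Dz_vcov mulmx1. Qed.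

Lemma Yh_gamma : Yh q *m gamma q = 0.
Proof. by rewrite gammaE mulmxA Yh_vcov mul0mx. Qed.

Lemma horizontal_Yh i : horizontal gamma q (row i (Yh q)).
Proof. by rewrite /horizontal -row_mul Yh_gamma row0. Qed.

End Point.

(** The coefficients are minus the derivatives of the fibre coordinates along the smooth fields
    obtained by applying gamma to [Db]. *)
Lemma smooth_Yh_in : forall i a, smooth_fun O (fun q => hz q i a).
Proof.
move=> i a.
have sX : smooth_vfs O (fun q => Db q *m gamma q).
  move=> c ac; have [sg _] := cg.
  apply: (smooth_on_ext (coord_set_open c oO) _ (smooth_on_mulmx (coord_set_open c oO) (smooth_Db ac) (sg c ac))).
  move=> x [ix Ux]; rewrite /mx_in /endo_in.
  have tf : to_chart c (chart_inv c x) *m of_chart c x = 1%:M.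
    by have := to_of_chart ac (chart_invP ix); rewrite (chart_invK ix).
  have conj_mx (A : 'M[R]_(2, 5)) (T F G : 'M[R]_5) : T *m F = 1%:M ->
      A *m T *m (F *m G *m T) = A *m G *m T.
    by move=> h; rewrite 2!mulmxA -(mulmxA A) h mulmx1.
  exact: conj_mx.
have s := smooth_vder oO (@af_smooth _ _ _ _ _ _ _ af a) (smooth_vfs_row oO i sX).
apply: smooth_fun_ext (smooth_funN oO s) => // q Oq.
by rewrite /vder (ddir_z Oq) /hz -row_mul [RHS]mxE [in LHS]mxE.
Qed.

Lemma smooth_Yh : smooth_vfs O Yh.
Proof.
apply: (smooth_vfsD oO) smooth_Db _; apply: (smooth_vfs_mulmx oO) _ smooth_Dz.
exact: smooth_Yh_in.
Qed.

End Connection.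

(** * Volume forms and their dual multivectors in the frame *)

Section VolumeForms.
Variables (Omega : dform M 5) (omega : dform B 2).
Hypotheses (vO : volume_form Omega) (vo : volume_form omega).

(** [wt] is the value of omega on the coordinate fields of cB. [dens] is the value on [Dz] of the
    vertical factor of Omega, once the factor pulled back from B is divided out. *)
Definition wt q : R := omega (pi q) (of_chart cB (cB (pi q))).
Definition dens q : R := Omega q (col_mx (Db q) (Dz q) : 'M[R]_5) / wt q.

Lemma smooth_wt : smooth_fun O wt.
Proof.
have s : smooth_fun (chart_dom cB) (fun b => omega b (of_chart cB (cB b))).
  apply: smooth_eval (smooth_of_chart (af_atlas af)); first exact: chart_dom_open.
  have [[alt sm] _] := vo; split=> [p _|c W ac]; first exact: alt.
  by apply: smooth_on_open_sub (sm c W ac); apply: coord_set_sub.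
apply: smooth_fun_sub (smooth_pull _ (@chart_dom_open _ _ _ cB) s); last by case: bundle.
by move=> q /(af_dom af).
Qed.

(** [wt] is pulled back from B, hence constant along the fibres; this will make it a Casimir
    function of every vertical bracket. *)
Lemma ddir_wt q v : O q -> v *m db q = 0 -> ddir wt q v = 0.
Proof.
move=> Oq v0.
have s : smooth_fun (chart_dom cB) (fun b => omega b (of_chart cB (cB b))).
  apply: smooth_eval (smooth_of_chart (af_atlas af)); first exact: chart_dom_open.
  have [[alt sm] _] := vo; split=> [p _|c W ac]; first exact: alt.
  by apply: smooth_on_open_sub (sm c W ac); apply: coord_set_sub.
have spi : smooth_map pi by case: bundle.
rewrite [LHS](ddir_pull spi v (@chart_dom_open _ _ _ cB) s (af_dom af Oq)).
by rewrite (tangentE Oq) mulmxA v0 mul0mx ddir0.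
Qed.

Lemma smooth_DbDz : smooth_vfs O (fun q => col_mx (Db q) (Dz q) : 'M[R]_5).
Proof.
have -> : (fun q => col_mx (Db q) (Dz q) : 'M[R]_5) = frame Phi.
  by apply/funext => q; exact: (@vsubmxK _ 2 3 5).
exact: smooth_frame oO sPhi uJ.
Qed.

Section Point.
Variable q : M.
Hypothesis Oq : O q.

Lemma pullbackE W : pullback pi omega q W = wt q * \det (W *m db q).
Proof.
have [[alt _] _] := vo.
by rewrite /pullback (tangentE Oq) mulmxA (alternating_mulmx _ _ (alt (pi q) I)) mulrC.
Qed.

Lemma wt_neq0 : wt q != 0.
Proof.
have [[alt _] /(_ (pi q)) [W]] := vo.
rewrite -[W]mulmx1 -(to_of_chart (af_atlas af) (af_dom af Oq)) mulmxA.
by rewrite (alternating_mulmx _ _ (alt (pi q) I)) mulf_eq0 negb_or => /andP[].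
Qed.

Lemma dens_neq0 : dens q != 0.
Proof.
rewrite mulf_neq0 ?invr_eq0 ?wt_neq0 //.
have [[alt _] /(_ q) [W]] := vO.
rewrite -[W]mulmx1 -(coframe_blocks Oq) -(@mul_row_col _ 5 2 3 5) mulmxA.
by rewrite (alternating_mulmx (k := 5) _ _ (alt q I)) mulf_eq0 negb_or => /andP[].
Qed.

End Point.

Lemma smooth_dens : smooth_fun O dens.
Proof.
apply: (smooth_funM oO); last first.
  by apply: (smooth_funV oO) smooth_wt => q Oq; apply: wt_neq0.
apply: (smooth_eval oO) smooth_DbDz.
have [[alt sm] _] := vO; split=> [p _|c W ac]; first exact: alt.
by apply: smooth_on_open_sub (sm c W ac); apply: coord_set_sub.
Qed.

Section Connection.
Variable gamma : M -> 'M[R]_5.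
Hypothesis cg : connection pi O gamma.
Notation Yh := (Yh gamma). Notation vcov := (vcov gamma).

Section Point.
Variable q : M.
Hypothesis Oq : O q.

Lemma Omega_Yh : Omega q (col_mx (Yh q) (Dz q) : 'M[R]_5) = wt q * dens q.
Proof.
have [[alt _] _] := vO.
rewrite frame_Yh (alternating_mulmx (k := 5) _ _ (alt q I)).
by rewrite (@det_ublock _ 2 3) !det1 !mul1r /dens mulrCA divff ?mulr1 // wt_neq0.
Qed.

(** Existence is the Laplace expansion of [wedge_det] in the frame (Yh, Dz). For uniqueness, a form
    of bidegree (0, 3) is determined by its value on [Dz], and the wedge equation fixes that
    value. *)
Lemma OmegaVE : OmegaV pi Omega omega gamma q = fun W => dens q * \det (W *m vcov q).
Proof.
have [[alt _] _] := vO; have altq := alt q I.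
have pE : pullback pi omega q = fun W => wt q * \det (W *m db q) by apply/funext => W; exact: pullbackE.
apply: get_eq => /= [|a [[alt_a bic] Oa]].
  split; first split.
  - exact: det_form_alternating.
  - by apply/funext => W; rewrite bicomp0 -mulmxA gamma_vcov.
  - apply/funext => W; rewrite pE wedge_det -Omega_Yh mulrC -(alternating_mulmx (k := 5) _ _ altq).
    by rewrite -mulmxA (mulmx1C (coframe_Yh gamma Oq)) mulmx1.
have aE W : a W = a (Dz q) * \det (W *m vcov q).
  by rewrite -[in LHS]bic bicomp0 (gammaE cg Oq) mulmxA alternating_mulmx // mulrC.
apply/funext => W; rewrite aE; congr (_ * _).
have := congr1 (fun f => f (col_mx (Yh q) (Dz q) : 'M[R]_5)) Oa.
rewrite Omega_Yh pE (_ : a = fun W => a (Dz q) * \det (W *m vcov q)); last by apply/funext.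
rewrite wedge_det coframe_Yh // det1 mulr1 (Dz_vcov gamma Oq) det1 mulr1.
by move/(mulfI (wt_neq0 Oq)).
Qed.

(** The minus sign is that of the reversal: contraction with the wedge of X and Y evaluates on (Y,
    X). *)
Lemma QHE : QH pi omega gamma q = fun Xi => - (wt q)^-1 * \det (Xi *m (Yh q)^T).
Proof.
have pE : pullback pi omega q = fun W => wt q * \det (W *m db q) by apply/funext => W; exact: pullbackE.
have palt : alternating (pullback pi omega q) by rewrite pE; exact: det_form_alternating.
have ip r W : @iprod _ _ 2 0 (fun Xi => r * \det (Xi *m (Yh q)^T)) (pullback pi omega q) W = - r * wt q.
  rewrite iprod_det // odd_rev2 trmxK expr1 mulrN1 pE; congr (_ * _).
  rewrite (_ : (col_mx (Yh q) W : 'M[R]_(2 + 0, 5)) *m db q = 1%:M) ?det1 ?mulr1 //.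
  rewrite -(Yh_db gamma Oq); apply/matrixP => i j; rewrite !mxE; apply: eq_bigr => l _; congr (_ * _).
  transitivity (col_mx (Yh q) W (lshift 0 (i : 'I_2)) l); last exact: col_mxEu.
  by congr (col_mx (Yh q) W _ l); exact: val_inj.
apply: get_eq => /= [|A [[alt_A bic] iA]].
  split; first split.
  - exact: det_form_alternating.
  - apply/funext => Xi; rewrite bicomp_full -mulmxA -trmx_mul.
    by rewrite (mulmxBr (Yh q)) mulmx1 (Yh_gamma cg Oq) subr0.
  - by move=> W; rewrite ip opprK mulVf // wt_neq0.
have AE Xi : A Xi = A (db q)^T * \det (Xi *m (Yh q)^T).
  rewrite -[in LHS]bic bicomp_full (cogammaE cg Oq) trmx_mul mulmxA.
  by rewrite alternating_mulmx // mulrC.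
apply/funext => Xi; rewrite AE; congr (_ * _).
(* The remaining argument has no rows, so any matrix may be given. *)
have := iA (const_mx 0).
rewrite (_ : A = fun Xi => A (db q)^T * \det (Xi *m (Yh q)^T)); last by apply/funext.
rewrite ip -trmx_mul (Yh_db gamma Oq) trmx1 det1 mulr1 => h.
by apply: (mulIf (wt_neq0 Oq)); rewrite mulNr mulVf ?wt_neq0 // -h mulNr opprK.
Qed.

(** As for [QHE], the reversal of three vectors being odd too. Only [Dz] and [dens] occur on the
    right, so the 3-vector does not change with the connection. *)
Lemma QVE : QV pi Omega omega gamma q = fun Xi => - (dens q)^-1 * \det (Xi *m (Dz q)^T).
Proof.
have palt : alternating (OmegaV pi Omega omega gamma q) by rewrite OmegaVE; exact: det_form_alternating.
have ip r W : @iprod _ _ 3 0 (fun Xi => r * \det (Xi *m (Dz q)^T)) (OmegaV pi Omega omega gamma q) W = - r * dens q.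
  rewrite iprod_det // odd_rev3 trmxK expr1 mulrN1 OmegaVE; congr (_ * _).
  rewrite (_ : (col_mx (Dz q) W : 'M[R]_(3 + 0, 5)) *m vcov q = 1%:M) ?det1 ?mulr1 //.
  rewrite -(Dz_vcov gamma Oq); apply/matrixP => i j; rewrite !mxE; apply: eq_bigr => l _; congr (_ * _).
  transitivity (col_mx (Dz q) W (lshift 0 (i : 'I_3)) l); last exact: col_mxEu.
  by congr (col_mx (Dz q) W _ l); exact: val_inj.
apply: get_eq => /= [|A [[alt_A bic] iA]].
  split; first split.
  - exact: det_form_alternating.
  - by apply/funext => Xi; rewrite bicomp0 -mulmxA -trmx_mul (Dz_gamma cg Oq).
  - by move=> W; rewrite ip opprK mulVf // dens_neq0.
have AE Xi : A Xi = A (vcov q)^T * \det (Xi *m (Dz q)^T).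
  rewrite -[in LHS]bic bicomp0 (gammaE cg Oq) trmx_mul mulmxA.
  by rewrite alternating_mulmx // mulrC.
apply/funext => Xi; rewrite AE; congr (_ * _).
have := iA (const_mx 0).
rewrite (_ : A = fun Xi => A (vcov q)^T * \det (Xi *m (Dz q)^T)); last by apply/funext.
rewrite ip -trmx_mul (Dz_vcov gamma Oq) trmx1 det1 mulr1 => h.
by apply: (mulIf (dens_neq0 Oq)); rewrite mulNr mulVf ?dens_neq0 // -h mulNr opprK.
Qed.

End Point.

End Connection.

End VolumeForms.

End AdaptedCalculus.

(** * Exterior derivatives on frames *)

Section Rows.
Context {R : realType} {n : nat}.
Implicit Types u v w x y : 'rV[R]_n.

Definition row2 u v : 'M[R]_(2, n) := col_mx u v.
Definition row3 u v w : 'M[R]_(3, n) := col_mx u (col_mx v w).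
Definition row4 u v w x : 'M[R]_(4, n) := col_mx u (col_mx v (col_mx w x)).

Lemma row2K0 u v : row 0 (row2 u v) = u.
Proof.
rewrite (_ : 0 = lshift 1 (0 : 'I_1) :> 'I_2); last exact: val_inj.
by rewrite (@rowKu _ 1 1) row_id.
Qed.

Lemma row2K1 u v : row 1 (row2 u v) = v.
Proof.
rewrite (_ : 1 = rshift 1 (0 : 'I_1) :> 'I_2); last exact: val_inj.
by rewrite (@rowKd _ 1 1) row_id.
Qed.

Lemma row3K0 u v w : row 0 (row3 u v w) = u.
Proof.
rewrite (_ : 0 = lshift 2 (0 : 'I_1) :> 'I_3); last exact: val_inj.
by rewrite (@rowKu _ 1 2) row_id.
Qed.

Lemma row3K1 u v w : row 1 (row3 u v w) = v.
Proof.
rewrite (_ : 1 = rshift 1 (0 : 'I_2) :> 'I_3); last exact: val_inj.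
by rewrite (@rowKd _ 1 2); exact: row2K0.
Qed.

Lemma row3K2 u v w : row 2%:R (row3 u v w) = w.
Proof.
rewrite (_ : 2%:R = rshift 1 (1 : 'I_2) :> 'I_3); last exact: val_inj.
by rewrite (@rowKd _ 1 2); exact: row2K1.
Qed.

Lemma row4K0 u v w x : row 0 (row4 u v w x) = u.
Proof.
rewrite (_ : 0 = lshift 3 (0 : 'I_1) :> 'I_4); last exact: val_inj.
by rewrite (@rowKu _ 1 3) row_id.
Qed.

Lemma row4K1 u v w x : row 1 (row4 u v w x) = v.
Proof.
rewrite (_ : 1 = rshift 1 (0 : 'I_3) :> 'I_4); last exact: val_inj.
by rewrite (@rowKd _ 1 3); exact: row3K0.
Qed.

Lemma row4K2 u v w x : row 2%:R (row4 u v w x) = w.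
Proof.
rewrite (_ : 2%:R = rshift 1 (1 : 'I_3) :> 'I_4); last exact: val_inj.
by rewrite (@rowKd _ 1 3); exact: row3K1.
Qed.

Lemma row4K3 u v w x : row 3%:R (row4 u v w x) = x.
Proof.
rewrite (_ : 3%:R = rshift 1 (2%:R : 'I_3) :> 'I_4); last exact: val_inj.
by rewrite (@rowKd _ 1 3); exact: row3K2.
Qed.

Definition rowsK := (row2K0, row2K1, row3K0, row3K1, row3K2, row4K0, row4K1, row4K2, row4K3).

Lemma ord2P (P : 'I_2 -> Prop) : P 0 -> P 1 -> forall i, P i.
Proof.
by move=> h0 h1 [[|[|//]] hi]; [move: h0|move: h1]; congr P; apply: val_inj.
Qed.

Lemma ord3P (P : 'I_3 -> Prop) : P 0 -> P 1 -> P 2%:R -> forall i, P i.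
Proof.
by move=> h0 h1 h2 [[|[|[|//]]] hi]; [move: h0|move: h1|move: h2]; congr P; apply: val_inj.
Qed.

Lemma ord4P (P : 'I_4 -> Prop) : P 0 -> P 1 -> P 2%:R -> P 3%:R -> forall i, P i.
Proof.
by move=> h0 h1 h2 h3 [[|[|[|[|//]]]] hi]; [move: h0|move: h1|move: h2|move: h3];
  congr P; apply: val_inj.
Qed.

Lemma sum2E (A : nmodType) (F : 'I_2 -> A) : \sum_i F i = F 0 + F 1.
Proof.
by rewrite !big_ord_recl big_ord0 addr0; congr (F _ + F _); apply: val_inj.
Qed.

Lemma sum3E (A : nmodType) (F : 'I_3 -> A) : \sum_i F i = F 0 + F 1 + F 2%:R.
Proof.
by rewrite !big_ord_recl big_ord0 addr0 addrA; congr (F _ + F _ + F _); apply: val_inj.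
Qed.

Lemma sum4E (A : nmodType) (F : 'I_4 -> A) : \sum_i F i = F 0 + F 1 + F 2%:R + F 3%:R.
Proof.
by rewrite !big_ord_recl big_ord0 addr0 !addrA; congr (F _ + F _ + F _ + F _); apply: val_inj.
Qed.

Section One.
Variable a : 'M[R]_(1, n) -> R.
Hypothesis Ha : alternating a.

Lemma rset1 (W : 'M[R]_(1, n)) v : rset W 0 v = v.
Proof. by apply/row_matrixP => i; rewrite (ord1 i) rowK eqxx row_id. Qed.

Lemma form1_lin r u v : a (r *: u + v) = r * a u + a v.
Proof. by have := alternating_multilinear Ha 0 0 r u v; rewrite !rset1. Qed.

Lemma form1_add u v : a (u + v) = a u + a v.
Proof. by have := form1_lin 1 u v; rewrite scale1r mul1r. Qed.

Lemma form1_mul m (C : 'rV[R]_m) (F : 'M[R]_(m, n)) : a (C *m F) = \sum_j C 0 j * a (row j F).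
Proof.
have := multilinear_rset_sum 0 0 (fun j => C 0 j) (fun j => row j F) (alternating_multilinear Ha).
rewrite rset1 mulmx_sum_row => ->; apply: eq_bigr => j _; by rewrite rset1.
Qed.

End One.

Section Two.
Variable a : 'M[R]_(2, n) -> R.
Hypothesis Ha : alternating a.

Lemma form2_lin0 r u v w : a (row2 (r *: u + v) w) = r * a (row2 u w) + a (row2 v w).
Proof.
have e x : row2 x w = rset (row2 0 w) 0 x.
  by apply/row_matrixP; apply: ord2P; rewrite rowsK rowK ?rowsK.
by rewrite (e (r *: u + v)) (e u) (e v) (alternating_multilinear Ha).
Qed.

Lemma form2_eq u : a (row2 u u) = 0.
Proof. by apply: (alternating_eq (i := 0) (j := 1) Ha) => //; rewrite !rowsK. Qed.

Lemma form2_swap u v : a (row2 u v) = - a (row2 v u).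
Proof.
rewrite -(alternating_swap (i := 0) (j := 1) _ Ha) //; congr a.
apply/row_matrixP; apply: ord2P; rewrite row_row_perm rowsK.
  by rewrite tpermL rowsK.
by rewrite tpermR rowsK.
Qed.

Lemma form2_lin1 r u v w : a (row2 w (r *: u + v)) = r * a (row2 w u) + a (row2 w v).
Proof. by rewrite form2_swap form2_lin0 (form2_swap u w) (form2_swap v w); ring. Qed.

End Two.

Section Four.
Variable a : 'M[R]_(4, n) -> R.
Hypothesis Ha : alternating a.

Lemma form4_lin0 r u v w x y : a (row4 (r *: u + v) w x y) = r * a (row4 u w x y) + a (row4 v w x y).
Proof.
have e t : row4 t w x y = rset (row4 0 w x y) 0 t.
  by apply/row_matrixP; apply: ord4P; rewrite rowsK rowK ?rowsK.
by rewrite (e (r *: u + v)) (e u) (e v) (alternating_multilinear Ha).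
Qed.

Lemma form4_lin1 r u v w x y : a (row4 w (r *: u + v) x y) = r * a (row4 w u x y) + a (row4 w v x y).
Proof.
have e t : row4 w t x y = rset (row4 w 0 x y) 1 t.
  by apply/row_matrixP; apply: ord4P; rewrite rowsK rowK ?rowsK.
by rewrite (e (r *: u + v)) (e u) (e v) (alternating_multilinear Ha).
Qed.

Lemma form4_lin3 r u v w x y : a (row4 w x y (r *: u + v)) = r * a (row4 w x y u) + a (row4 w x y v).
Proof.
have e t : row4 w x y t = rset (row4 w x y 0) 3%:R t.
  by apply/row_matrixP; apply: ord4P; rewrite rowsK rowK ?rowsK.
by rewrite (e (r *: u + v)) (e u) (e v) (alternating_multilinear Ha).
Qed.

Lemma form4_eq01 u x y : a (row4 u u x y) = 0.
Proof. by apply: (alternating_eq (i := 0) (j := 1) Ha) => //; rewrite !rowsK. Qed.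
Lemma form4_eq02 u x y : a (row4 u x u y) = 0.
Proof. by apply: (alternating_eq (i := 0) (j := 2%:R) Ha) => //; rewrite !rowsK. Qed.
Lemma form4_eq03 u x y : a (row4 u x y u) = 0.
Proof. by apply: (alternating_eq (i := 0) (j := 3%:R) Ha) => //; rewrite !rowsK. Qed.
Lemma form4_eq12 u x y : a (row4 x u u y) = 0.
Proof. by apply: (alternating_eq (i := 1) (j := 2%:R) Ha) => //; rewrite !rowsK. Qed.
Lemma form4_eq13 u x y : a (row4 x u y u) = 0.
Proof. by apply: (alternating_eq (i := 1) (j := 3%:R) Ha) => //; rewrite !rowsK. Qed.
Lemma form4_eq23 u x y : a (row4 x y u u) = 0.
Proof. by apply: (alternating_eq (i := 2%:R) (j := 3%:R) Ha) => //; rewrite !rowsK. Qed.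

Lemma form4_swap01 u v x y : a (row4 u v x y) = - a (row4 v u x y).
Proof.
rewrite -(alternating_swap (i := 0) (j := 1) _ Ha) //; congr a.
by apply/row_matrixP; apply: ord4P; rewrite row_row_perm rowsK ?tpermL ?tpermR ?tpermD ?rowsK.
Qed.
Lemma form4_swap12 u v x y : a (row4 x u v y) = - a (row4 x v u y).
Proof.
rewrite -(alternating_swap (i := 1) (j := 2%:R) _ Ha) //; congr a.
by apply/row_matrixP; apply: ord4P; rewrite row_row_perm rowsK ?tpermL ?tpermR ?tpermD ?rowsK.
Qed.
Lemma form4_swap23 u v x y : a (row4 x y u v) = - a (row4 x y v u).
Proof.
rewrite -(alternating_swap (i := 2%:R) (j := 3%:R) _ Ha) //; congr a.
by apply/row_matrixP; apply: ord4P; rewrite row_row_perm rowsK ?tpermL ?tpermR ?tpermD ?rowsK.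
Qed.
Lemma form4_block u v x y : a (row4 u v x y) = a (row4 x y u v).
Proof.
by rewrite form4_swap12 form4_swap01 form4_swap23 form4_swap12 !opprK.
Qed.

End Four.

End Rows.

(** * The exterior derivative on a commuting frame *)

Section FrameDerivatives.
Context {R : realType} {n : nat} {M : manifold R n}.
Variables (U : set M) (phi : 'I_n -> M -> R).
Hypotheses (oU : open U) (sphi : forall i, smooth_fun U (phi i))
  (ujac : forall q, U q -> jac phi q \in unitmx).

Definition fld i q : 'rV[R]_n := row i (frame phi q).

Lemma smooth_fld i : smooth_vfs U (fld i).
Proof. by apply: smooth_vfs_row => //; apply: smooth_frame. Qed.

Lemma fld_commute i j f q : smooth_fun U f -> U q ->
  vder (fld i) (vder (fld j) f) q = vder (fld j) (vder (fld i) f) q.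
Proof.
move=> sf Uq; apply/eqP; rewrite -subr_eq0.
by rewrite (vder_lie oU sf (smooth_fld i) (smooth_fld j) Uq) (lie_frame oU sphi ujac) // ddir0.
Qed.

Lemma extd_fld k (a : dform M k) (f : 'I_k.+1 -> 'I_n) q : is_form U a -> U q ->
  extd a q (rowsub f (frame phi q)) =
  \sum_(i < k.+1) (-1) ^+ i * vder (fld (f i)) (fun q' => a q' (rowsub (f \o lift i) (frame phi q'))) q.
Proof.
move=> fa Uq; pose X q := rowsub f (frame phi q).
have rX i q' : row i (X q') = fld (f i) q' by apply/rowP => j; rewrite !mxE.
have sX : smooth_vfs U X.
  apply/(smooth_vfsP oU) => c i j ac.
  have := smooth_fld (f i) ac; move/(smooth_on_mxP _ (coord_set_open c oU))/(_ 0 j).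
  apply: smooth_on_ext => [|x _]; first exact: coord_set_open.
  by rewrite /mx_in -[X in X *m _](rX i) -row_mul mxE.
rewrite (extd_frame oU fa Uq sX) => [|i j].
  apply: eq_bigr => i _; rewrite /vder rX.
  suff -> : (fun q' => a q' (row' i (X q'))) =
      (fun q' => a q' (rowsub (f \o lift i) (frame phi q'))) by [].
  by apply/funext => q'; congr a; apply/matrixP => l m; rewrite !mxE.
have -> : (fun q => row i (X q)) = fld (f i) by apply/funext => q'; exact: rX.
have -> : (fun q => row j (X q)) = fld (f j) by apply/funext => q'; exact: rX.
exact: (lie_frame oU sphi ujac _ _ Uq).
Qed.

Lemma extd_two (a : dform M 1) i j q : is_form U a -> U q ->
  extd a q (row2 (fld i q) (fld j q)) =
  vder (fld i) (fun q => a q (fld j q)) q - vder (fld j) (fun q => a q (fld i q)) q.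
Proof.
move=> fa Uq; pose f (l : 'I_2) := if l == 0 then i else j.
have -> : row2 (fld i q) (fld j q) = rowsub f (frame phi q).
  by apply/row_matrixP; apply: ord2P; rewrite rowsK; apply/rowP => l; rewrite !mxE.
rewrite extd_fld // sum2E mul1r expr1 mulN1r.
have r1 g q' : rowsub g (frame phi q') = fld (g 0) q'.
  by apply/row_matrixP => l; rewrite (ord1 l); apply/rowP => m; rewrite !mxE.
have -> : (fun q' => a q' (rowsub (f \o lift 0) (frame phi q'))) = (fun q => a q (fld j q)).
  by apply/funext => q'; rewrite r1.
have -> // : (fun q' => a q' (rowsub (f \o lift 1) (frame phi q'))) = (fun q => a q (fld i q)).
by apply/funext => q'; rewrite r1.
Qed.

Lemma extd_four (a : dform M 3) i j k l q : is_form U a -> U q ->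
  extd a q (row4 (fld i q) (fld j q) (fld k q) (fld l q)) =
  vder (fld i) (fun q => a q (row3 (fld j q) (fld k q) (fld l q))) q
  - vder (fld j) (fun q => a q (row3 (fld i q) (fld k q) (fld l q))) q
  + vder (fld k) (fun q => a q (row3 (fld i q) (fld j q) (fld l q))) q
  - vder (fld l) (fun q => a q (row3 (fld i q) (fld j q) (fld k q))) q.
Proof.
move=> fa Uq.
pose f (m : 'I_4) := if m == 0 then i else if m == 1 then j else if m == 2%:R then k else l.
have -> : row4 (fld i q) (fld j q) (fld k q) (fld l q) = rowsub f (frame phi q).
  by apply/row_matrixP; apply: ord4P; rewrite rowsK; apply/rowP => m; rewrite !mxE.
have r3 g q' : rowsub g (frame phi q') = row3 (fld (g 0) q') (fld (g 1) q') (fld (g 2%:R) q').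
  by apply/row_matrixP; apply: ord3P; rewrite rowsK; apply/rowP => m; rewrite !mxE.
rewrite extd_fld // sum4E !exprS expr0 !mulr1 !mulN1r opprK !mul1r mulN1r.
have r4 i' (g : 'I_3 -> 'I_n) : f \o lift i' =1 g ->
    (fun q' => a q' (rowsub (f \o lift i') (frame phi q'))) =
    (fun q' => a q' (row3 (fld (g 0) q') (fld (g 1) q') (fld (g 2%:R) q'))).
  by move=> e; apply/funext => q'; rewrite r3 !e.
pose g i j k (m : 'I_3) : 'I_n := if m == 0 then i else if m == 1 then j else k.
rewrite (r4 0 (g j k l)); last exact: ord3P.
rewrite (r4 1 (g i k l)); last exact: ord3P.
rewrite (r4 2%:R (g i j l)); last exact: ord3P.
by rewrite (r4 3%:R (g i j k)); last exact: ord3P.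
Qed.

End FrameDerivatives.

(** * The vertical volume form *)

Lemma wedge_mulmx (R : realType) n m k l (a : 'M[R]_(k, m) -> R) (b : 'M[R]_(l, m) -> R)
    (P : 'M[R]_(n, m)) (W : 'M[R]_(k + l, n)) :
  wedge (fun U => a (U *m P)) (fun U => b (U *m P)) W = wedge a b (W *m P).
Proof.
rewrite /wedge; congr (_ * _); apply: eq_bigr => s _.
have -> : row_perm s (W *m P) = row_perm s W *m P by rewrite !row_permE mulmxA.
by rewrite !mul_usub_mx !mul_dsub_mx.
Qed.

(* Replaces derivatives and matrix entries by variables, for [ring]. *)
Ltac abstract_atoms :=
  repeat match goal with
  | |- context [ddir ?f ?q ?v] => generalize (ddir f q v); intro
  end;
  repeat match goal with
  | |- context [fun_of_matrix ?A ?i ?j] => generalize (fun_of_matrix A i j); intro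
  end.

Section TripleEquations.
Context {R : realType} {M : manifold R 5} {B : manifold R 2}.
Variable pi : M -> B.
Hypothesis bundle : fiber_bundle pi.
Variables (O : set M) (cB : chart R B 2) (z : 'I_3 -> M -> R).
Hypothesis af : adapted_frame pi O cB z.
Let Phi : 'I_5 -> M -> R := adapted pi cB z.
Let oO : open O := af_open af.
Let sPhi i : smooth_fun O (Phi i) := smooth_adapted bundle i af.
Let uJ q : O q -> jac Phi q \in unitmx := @af_unit _ _ _ _ _ _ _ af q.
Notation db := (db pi cB z). Notation dz := (dz pi cB z).
Notation Db := (Db pi cB z). Notation Dz := (Dz pi cB z).

Definition eD (i : 'I_2) : M -> 'rV[R]_5 := fld Phi (lshift 3 i : 'I_(2 + 3)).
Definition eV (a : 'I_3) : M -> 'rV[R]_5 := fld Phi (rshift 2 a : 'I_(2 + 3)).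

Lemma eDE i q : row i (Db q) = eD i q. Proof. exact: (@row_usubmx _ 2 3 5). Qed.
Lemma eVE a q : row a (Dz q) = eV a q. Proof. exact: (@row_dsubmx _ 2 3 5). Qed.
Lemma smooth_eD i : smooth_vfs O (eD i). Proof. exact: smooth_fld. Qed.
Lemma smooth_eV a : smooth_vfs O (eV a). Proof. exact: smooth_fld. Qed.

Lemma smooth_coframe c : atlas c ->
  smooth_on (coord_set c O) (fun x => of_chart c x *m jac Phi (chart_inv c x)).
Proof.
move=> ac; have oC := coord_set_open c oO.
apply/(smooth_on_mxP _ oC) => j i.
apply: (smooth_on_ext oC _ (smooth_on_derive (delta_mx 0 j) (sPhi i ac))) => x [ix Ox].
have dx := chart_invP ix.
rewrite (mul_jac sPhi) // (ddirE _ (sPhi i) Ox ac dx) (chart_invK ix); congr ('D_ _ _ _).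
have := of_to_chart ac dx; rewrite (chart_invK ix) => h.
by rewrite -row_mul h row1.
Qed.

Lemma smooth_db_in c : atlas c ->
  smooth_on (coord_set c O) (fun x => of_chart c x *m db (chart_inv c x)).
Proof.
move=> ac; have oC := coord_set_open c oO.
apply/(smooth_on_mxP _ oC) => j i.
have /(smooth_on_mxP _ oC) /(_ j (lshift 3 i : 'I_(2 + 3))) := smooth_coframe ac.
by apply: (smooth_on_ext oC) => x _; rewrite -[jac _ _](@hsubmxK _ 5 2 3) (@mul_mx_row _ 5 5 2 3) (@row_mxEl _ 5 2 3).
Qed.

Lemma smooth_dz_in c : atlas c ->
  smooth_on (coord_set c O) (fun x => of_chart c x *m dz (chart_inv c x)).
Proof.
move=> ac; have oC := coord_set_open c oO.
apply/(smooth_on_mxP _ oC) => j i.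
have /(smooth_on_mxP _ oC) /(_ j (rshift 2 i : 'I_(2 + 3))) := smooth_coframe ac.
by apply: (smooth_on_ext oC) => x _; rewrite -[jac _ _](@hsubmxK _ 5 2 3) (@mul_mx_row _ 5 5 2 3) (@row_mxEr _ 5 2 3).
Qed.

Variables (Omega : dform M 5) (omega : dform B 2).
Hypotheses (vO : volume_form Omega) (vo : volume_form omega).
Notation dens := (dens pi cB z Omega omega).

Variable gamma : M -> 'M[R]_5.
Hypothesis cg : connection pi O gamma.
Notation hz := (hz pi cB z gamma). Notation Yh := (Yh pi cB z gamma).
Notation vcov := (vcov pi cB z gamma).
Notation OmegaV := (OmegaV pi Omega omega gamma).

Definition eY (i : 'I_2) q : 'rV[R]_5 := row i (Yh q).

Lemma eYE i q : eY i q = eD i q + (hz q i 0 *: eV 0 q + (hz q i 1 *: eV 1 q + hz q i 2%:R *: eV 2%:R q)).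
Proof.
rewrite /eY /Yh linearD /= eDE row_mul mulmx_sum_row sum3E !eVE !addrA.
by rewrite !(mxE _ _ 0).
Qed.

Lemma vder_eY i f V q : smooth_fun V f -> V q -> vder (eY i) f q =
  vder (eD i) f q + hz q i 0 * vder (eV 0) f q + hz q i 1 * vder (eV 1) f q
  + hz q i 2%:R * vder (eV 2%:R) f q.
Proof.
move=> sf Vq; rewrite /vder eYE !(ddir_add _ _ sf Vq) !(ddir_scale _ _ sf Vq).
have e4 (x y s t : R) : x + (y + (s + t)) = x + y + s + t by rewrite !addrA.
exact: e4.
Qed.

Lemma smooth_hz i a : smooth_fun O (fun q => hz q i a).
Proof. exact: (smooth_Yh_in bundle af cg). Qed.

Lemma smooth_eY i : smooth_vfs O (eY i).
Proof. by apply: smooth_vfs_row => //; apply: smooth_Yh. Qed.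

(** [OmegaV] is chosen point by point; its smoothness comes from the formula of [OmegaVE]. *)
Lemma form_OmegaV : is_form O OmegaV.
Proof.
split=> [q Oq|c W ac].
  by rewrite (OmegaVE bundle af vO vo cg Oq); apply: det_form_alternating.
have oC := coord_set_open c oO.
have se : smooth_on (coord_set c O) (fun x => of_chart c x *m vcov (chart_inv c x)).
  apply/(smooth_on_mxP _ oC) => i j.
  have s1 : smooth_on (coord_set c O) (fun x => (of_chart c x *m dz (chart_inv c x)) i j).
    by move: i j; apply/(smooth_on_mxP _ oC)/smooth_dz_in.
  have s2 : smooth_on (coord_set c O) (fun x => (of_chart c x *m db (chart_inv c x) *m hz (chart_inv c x)) i j).
    move: i j {s1}; apply/(smooth_on_mxP _ oC)/(smooth_on_mulmx oC (smooth_db_in ac)).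
    by apply/(smooth_on_mxP _ oC) => i j; exact: (smooth_hz i j ac).
  apply: (smooth_on_ext oC _ (smooth_onB oC s1 s2)) => x _.
  by rewrite /vcov mulmxBr mulmxA [RHS]mxE [X in _ = _ + X]mxE.
have s3 : smooth_on (coord_set c O) (fun x => \det (W *m (of_chart c x *m vcov (chart_inv c x)))).
  apply: (smooth_on_det oC); apply/(smooth_on_mxP _ oC).
  exact: (smooth_on_mulmx oC (smooth_on_cst oC W) se).
apply: (smooth_on_ext oC _ (smooth_onM oC (smooth_dens bundle af vO vo ac) s3)) => x [ix Ox].
by rewrite /form_in (OmegaVE bundle af vO vo cg Ox) mulmxA.
Qed.

Section OmegaVValues.
Variable q : M.
Hypothesis Oq : O q.

Lemma eV_vcov a : eV a q *m vcov q = delta_mx 0 a.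
Proof. by rewrite -eVE -row_mul (Dz_vcov af gamma Oq) row1. Qed.

Lemma eD_vcov i : eD i q *m vcov q = - row i (hz q).
Proof.
rewrite -eDE -row_mul /vcov mulmxBr mulmxA (Db_dz af Oq) (Db_db af Oq).
by rewrite mul1mx sub0r linearN.
Qed.

Lemma OmegaV_row3 u v w : OmegaV q (row3 u v w) =
  dens q * \det (row3 (u *m vcov q) (v *m vcov q) (w *m vcov q)).
Proof.
rewrite (OmegaVE bundle af vO vo cg Oq); congr (_ * \det _).
by apply/row_matrixP; apply: ord3P; rewrite row_mul !rowsK.
Qed.

Lemma OmegaV_vvv : OmegaV q (row3 (eV 0 q) (eV 1 q) (eV 2%:R q)) = dens q.
Proof. by rewrite OmegaV_row3 det_col3 !eV_vcov !mxE /=; ring. Qed.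

Lemma OmegaV_dvv01 i : OmegaV q (row3 (eD i q) (eV 0 q) (eV 1 q)) = - (dens q * hz q i 2%:R).
Proof. by rewrite OmegaV_row3 det_col3 !eV_vcov !eD_vcov !mxE /=; ring. Qed.
Lemma OmegaV_dvv02 i : OmegaV q (row3 (eD i q) (eV 0 q) (eV 2%:R q)) = dens q * hz q i 1.
Proof. by rewrite OmegaV_row3 det_col3 !eV_vcov !eD_vcov !mxE /=; ring. Qed.
Lemma OmegaV_dvv12 i : OmegaV q (row3 (eD i q) (eV 1 q) (eV 2%:R q)) = - (dens q * hz q i 0).
Proof. by rewrite OmegaV_row3 det_col3 !eV_vcov !eD_vcov !mxE /=; ring. Qed.
Lemma OmegaV_vvd01 i : OmegaV q (row3 (eV 0 q) (eV 1 q) (eD i q)) = - (dens q * hz q i 2%:R).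
Proof. by rewrite OmegaV_row3 det_col3 !eV_vcov !eD_vcov !mxE /=; ring. Qed.
Lemma OmegaV_vvd02 i : OmegaV q (row3 (eV 0 q) (eV 2%:R q) (eD i q)) = dens q * hz q i 1.
Proof. by rewrite OmegaV_row3 det_col3 !eV_vcov !eD_vcov !mxE /=; ring. Qed.
Lemma OmegaV_vvd12 i : OmegaV q (row3 (eV 1 q) (eV 2%:R q) (eD i q)) = - (dens q * hz q i 0).
Proof. by rewrite OmegaV_row3 det_col3 !eV_vcov !eD_vcov !mxE /=; ring. Qed.
Lemma OmegaV_ddv0 : OmegaV q (row3 (eD 0 q) (eD 1 q) (eV 0 q)) =
  dens q * (hz q 0 1 * hz q 1 2%:R - hz q 0 2%:R * hz q 1 1).
Proof. by rewrite OmegaV_row3 det_col3 !eV_vcov !eD_vcov !mxE /=; ring. Qed.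
Lemma OmegaV_ddv1 : OmegaV q (row3 (eD 0 q) (eD 1 q) (eV 1 q)) =
  dens q * (hz q 0 2%:R * hz q 1 0 - hz q 0 0 * hz q 1 2%:R).
Proof. by rewrite OmegaV_row3 det_col3 !eV_vcov !eD_vcov !mxE /=; ring. Qed.
Lemma OmegaV_ddv2 : OmegaV q (row3 (eD 0 q) (eD 1 q) (eV 2%:R q)) =
  dens q * (hz q 0 0 * hz q 1 1 - hz q 0 1 * hz q 1 0).
Proof. by rewrite OmegaV_row3 det_col3 !eV_vcov !eD_vcov !mxE /=; ring. Qed.

End OmegaVValues.

(** Component of the Lie bracket of the two horizontal lifts along [eV c]: the curvature of the
    connection. *)
Definition curv (c : 'I_3) q : R :=
  vder (eY 0) (fun q => hz q 1 c) q - vder (eY 1) (fun q => hz q 0 c) q.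

(** The density of the Lie derivative of the vertical volume form along the i-th lift; it is the
    only component of its d_(1,0) in the direction of that lift. *)
Definition divh (i : 'I_2) q : R :=
  vder (eD i) dens q + vder (eV 0) (fun q => dens q * hz q i 0) q
  + vder (eV 1) (fun q => dens q * hz q i 1) q
  + vder (eV 2%:R) (fun q => dens q * hz q i 2%:R) q.

(** * The components of the derivative of the vertical volume form *)

Section ExtdOmegaV.
Variable q : M.
Hypothesis Oq : O q.
Let sdens : smooth_fun O dens := smooth_dens bundle af vO vo.
Let fOV := form_OmegaV.
Let altT : alternating (extd OmegaV q) := extd_alternating oO fOV Oq.

Lemma extd_vvvd i : extd OmegaV q (row4 (eV 0 q) (eV 1 q) (eV 2%:R q) (eD i q)) = - divh i q.
Proof.
rewrite [LHS](extd_four oO sPhi uJ _ _ _ _ fOV Oq).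
rewrite /vder (ddir_near oO _ Oq (fun q' Oq' => OmegaV_vvd12 Oq' i)).
rewrite (ddir_near oO _ Oq (fun q' Oq' => OmegaV_vvd02 Oq' i)).
rewrite (ddir_near oO _ Oq (fun q' Oq' => OmegaV_vvd01 Oq' i)).
rewrite (ddir_near oO _ Oq (fun q' Oq' => OmegaV_vvv Oq')).
rewrite !(ddirN _ (smooth_funM oO sdens (smooth_hz _ _)) Oq) /divh /vder.
by rewrite /eV /eD; ring.
Qed.

Lemma eY_lin i : eY i q =
  hz q i 0 *: eV 0 q + (hz q i 1 *: eV 1 q + (hz q i 2%:R *: eV 2%:R q + eD i q)).
Proof. by rewrite eYE addrC -!addrA. Qed.

Let dM (f g : M -> R) v (sf : smooth_fun O f) (sg : smooth_fun O g) :
  ddir (fun q => f q * g q) q v = ddir f q v * g q + f q * ddir g q v := ddirM v sf sg Oq.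
Let sh i a : smooth_fun O (fun q => hz q i a) := smooth_hz i a.
Let shh i a j b : smooth_fun O (fun q => hz q i a * hz q j b) := smooth_funM oO (sh i a) (sh j b).
Let shB i a j b k c l d :
  smooth_fun O (fun q => hz q i a * hz q j b - hz q k c * hz q l d) := smooth_funB oO (shh i a j b) (shh k c l d).

(** This and the next two compute d_(2,-1): minus the vertical volume form contracted with the
    curvature. The lifts are expanded in coordinate fields, which commute; the derivatives of [dens]
    then cancel. *)
Lemma extd_YYvv01 :
  extd OmegaV q (row4 (eY 0 q) (eY 1 q) (eV 0 q) (eV 1 q)) = - (dens q * curv 2%:R q).
Proof.
rewrite !eY_lin !(form4_lin0 altT) !(form4_lin1 altT).
rewrite !(form4_eq01 altT) !(form4_eq02 altT) !(form4_eq03 altT) !(form4_eq12 altT) !(form4_eq13 altT).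
rewrite (form4_block altT (eV 2%:R q)) (form4_block altT (eD 0 q) (eV 2%:R q)) (form4_swap23 altT (eD 0 q)).
rewrite !extd_vvvd.
rewrite (extd_four oO sPhi uJ _ _ _ _ fOV Oq) -!/(eD _) -!/(eV _).
rewrite /vder (ddir_near oO _ Oq (fun q' Oq' => OmegaV_dvv01 Oq' 1)).
rewrite (ddir_near oO _ Oq (fun q' Oq' => OmegaV_dvv01 Oq' 0)).
rewrite (ddir_near oO _ Oq (fun q' Oq' => OmegaV_ddv1 Oq')).
rewrite (ddir_near oO _ Oq (fun q' Oq' => OmegaV_ddv0 Oq')).
rewrite !(ddirN _ (smooth_funM oO sdens (sh _ _)) Oq) /divh /vder.
rewrite !(dM _ sdens (shB _ _ _ _ _ _ _ _)) !(dM _ sdens (sh _ _)).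
rewrite !(ddirB oO _ (shh _ _ _ _) (shh _ _ _ _) Oq) !(dM _ (sh _ _) (sh _ _)).
rewrite /curv !(vder_eY _ (sh _ _) Oq) /vder.
move: (dens q) => d0; abstract_atoms; ring.
Qed.

Lemma extd_YYvv02 :
  extd OmegaV q (row4 (eY 0 q) (eY 1 q) (eV 0 q) (eV 2%:R q)) = dens q * curv 1 q.
Proof.
rewrite !eY_lin !(form4_lin0 altT) !(form4_lin1 altT).
rewrite !(form4_eq01 altT) !(form4_eq02 altT) !(form4_eq03 altT) !(form4_eq12 altT) !(form4_eq13 altT).
rewrite (form4_block altT (eV 1 q)) (form4_swap12 altT (eV 2%:R q) (eV 1 q)).
rewrite (form4_block altT (eD 0 q) (eV 1 q)) (form4_swap23 altT (eD 0 q)) (form4_swap12 altT (eV 2%:R q) (eV 1 q)).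
rewrite !extd_vvvd.
rewrite (extd_four oO sPhi uJ _ _ _ _ fOV Oq) -!/(eD _) -!/(eV _).
rewrite /vder (ddir_near oO _ Oq (fun q' Oq' => OmegaV_dvv02 Oq' 1)).
rewrite (ddir_near oO _ Oq (fun q' Oq' => OmegaV_dvv02 Oq' 0)).
rewrite (ddir_near oO _ Oq (fun q' Oq' => OmegaV_ddv2 Oq')).
rewrite (ddir_near oO _ Oq (fun q' Oq' => OmegaV_ddv0 Oq')).
rewrite /divh /vder.
rewrite !(dM _ sdens (shB _ _ _ _ _ _ _ _)) !(dM _ sdens (sh _ _)).
rewrite !(ddirB oO _ (shh _ _ _ _) (shh _ _ _ _) Oq) !(dM _ (sh _ _) (sh _ _)).
rewrite /curv !(vder_eY _ (sh _ _) Oq) /vder.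
move: (dens q) => d0; abstract_atoms; ring.
Qed.

Lemma extd_YYvv12 :
  extd OmegaV q (row4 (eY 0 q) (eY 1 q) (eV 1 q) (eV 2%:R q)) = - (dens q * curv 0 q).
Proof.
rewrite !eY_lin !(form4_lin0 altT) !(form4_lin1 altT).
rewrite !(form4_eq01 altT) !(form4_eq02 altT) !(form4_eq03 altT) !(form4_eq12 altT) !(form4_eq13 altT).
rewrite (form4_swap12 altT (eD 1 q) (eV 1 q)) (form4_swap23 altT (eD 1 q)).
rewrite (form4_swap01 altT (eD 0 q) (eV 0 q)) (form4_swap12 altT (eD 0 q) (eV 1 q)) (form4_swap23 altT (eD 0 q)).
rewrite !extd_vvvd.
rewrite (extd_four oO sPhi uJ _ _ _ _ fOV Oq) -!/(eD _) -!/(eV _).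
rewrite /vder (ddir_near oO _ Oq (fun q' Oq' => OmegaV_dvv12 Oq' 1)).
rewrite (ddir_near oO _ Oq (fun q' Oq' => OmegaV_dvv12 Oq' 0)).
rewrite (ddir_near oO _ Oq (fun q' Oq' => OmegaV_ddv2 Oq')).
rewrite (ddir_near oO _ Oq (fun q' Oq' => OmegaV_ddv1 Oq')).
rewrite !(ddirN _ (smooth_funM oO sdens (sh _ _)) Oq) /divh /vder.
rewrite !(dM _ sdens (shB _ _ _ _ _ _ _ _)) !(dM _ sdens (sh _ _)).
rewrite !(ddirB oO _ (shh _ _ _ _) (shh _ _ _ _) Oq) !(dM _ (sh _ _) (sh _ _)).
rewrite /curv !(vder_eY _ (sh _ _) Oq) /vder.
move: (dens q) => d0; abstract_atoms; ring.
Qed.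

End ExtdOmegaV.

End TripleEquations.

(** * The bracket of a vertical 1-form *)

Lemma alternating1 (R : realType) n (a : 'M[R]_(1, n) -> R) :
  (forall r u v, a (r *: u + v) = r * a u + a v) -> alternating a.
Proof.
move=> Ha; split=> [W i r u v subst|W i j]; last by rewrite (ord1 i) (ord1 j) eqxx.
have e w : subst w = w.
  by apply/row_matrixP => l; rewrite rowK (ord1 l) (ord1 i) eqxx row_id.
by rewrite !e.
Qed.

Section TripleOneForm.
Context {R : realType} {M : manifold R 5} {B : manifold R 2}.
Variable pi : M -> B.
Hypothesis bundle : fiber_bundle pi.
Variables (O : set M) (cB : chart R B 2) (z : 'I_3 -> M -> R).
Hypothesis af : adapted_frame pi O cB z.
Let Phi : 'I_5 -> M -> R := adapted pi cB z.
Let oO : open O := af_open af.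
Let sPhi i : smooth_fun O (Phi i) := smooth_adapted bundle i af.
Let uJ q : O q -> jac Phi q \in unitmx := @af_unit _ _ _ _ _ _ _ af q.
Variables (Omega : dform M 5) (omega : dform B 2).
Hypotheses (vO : volume_form Omega) (vo : volume_form omega).
Variable gamma : M -> 'M[R]_5.
Hypothesis cg : connection pi O gamma.
Notation db := (db pi cB z). Notation Dz := (Dz pi cB z).
Notation dens := (dens pi cB z Omega omega).
Notation hz := (hz pi cB z gamma). Notation Yh := (Yh pi cB z gamma).
Notation vcov := (vcov pi cB z gamma).
Notation eD := (eD pi cB z). Notation eV := (eV pi cB z). Notation eY := (eY pi cB z gamma).

Lemma eV_gamma a q : O q -> eV a q *m gamma q = eV a q.
Proof. by move=> Oq; rewrite -eVE -row_mul (Dz_gamma bundle af cg Oq). Qed.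

Lemma eV_db a q : O q -> eV a q *m db q = 0.
Proof. by move=> Oq; rewrite -eVE -row_mul (Dz_db af Oq) row0. Qed.

Lemma eY_gamma i q : O q -> eY i q *m gamma q = 0.
Proof. by move=> Oq; rewrite /eY -row_mul (Yh_gamma bundle af cg Oq) row0. Qed.

Lemma eY_vcov i q : O q -> eY i q *m vcov q = 0.
Proof. by move=> Oq; rewrite /eY -row_mul (Yh_vcov af gamma Oq) row0. Qed.

Lemma eV_cogamma a q : O q -> eV a q *m (1%:M - gamma q) = 0.
Proof. by move=> Oq; rewrite mulmxBr mulmx1 eV_gamma // subrr. Qed.

Lemma eY_cogamma i q : O q -> eY i q *m (1%:M - gamma q) = eY i q.
Proof. by move=> Oq; rewrite mulmxBr mulmx1 eY_gamma // subr0. Qed.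

(** The rows of [Yh] and [Dz] form a basis, so a 2-form is decided on pairs of them, sorted here by
    bidegree. *)
Lemma two_form_zero (a : 'M[R]_(2, 5) -> R) q : O q -> alternating a ->
  a (row2 (eY 0 q) (eY 1 q)) = 0 -> (forall i c, a (row2 (eY i q) (eV c q)) = 0) ->
  (forall c d, a (row2 (eV c q) (eV d q)) = 0) -> forall W, a W = 0.
Proof.
move=> Oq alt_a YY YV VV W.
pose F : 'M[R]_(2 + 3, 5) := col_mx (Yh q) (Dz q).
have -> : W = row_mx (W *m db q) (W *m vcov q) *m F.
  by rewrite mul_row_col; exact: (decomp bundle af cg Oq).
rewrite multilinear_mulmx; last exact: alternating_multilinear.
apply: big1 => f _; suff -> : a (rowsub f F) = 0 by rewrite mulr0.
have -> : rowsub f F = row2 (row (f 0) F) (row (f 1) F).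
  by apply/row_matrixP; apply: ord2P; rewrite rowsK; apply/rowP => l; rewrite !mxE.
have FY i : row (lshift 3 i) F = eY i q by exact: rowKu.
have FV c : row (rshift 2 c) F = eV c q by rewrite /F rowKd eVE.
case: (split_ordP (f 0)) => i ->; case: (split_ordP (f 1)) => j ->; rewrite ?FY ?FV //.
  move: i j; apply: ord2P; apply: ord2P; rewrite ?(form2_eq alt_a) //.
  by rewrite (form2_swap alt_a) YY oppr0.
by rewrite (form2_swap alt_a) YV oppr0.
Qed.

Variable beta : dform M 1.
Hypotheses (fb : is_form O beta)
  (hb : forall q v, O q -> horizontal gamma q v -> beta q v = 0).

Definition bt (c : 'I_3) q : R := beta q (eV c q).

Lemma smooth_bt c : smooth_fun O (bt c).
Proof. by apply: (smooth_eval oO fb); apply: smooth_eV. Qed.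

Lemma beta_eY i q : O q -> beta q (eY i q) = 0.
Proof. by move=> Oq; apply: hb => //; exact: (horizontal_Yh bundle af cg). Qed.

Lemma beta_decomp q v : O q -> beta q v = \sum_c (v *m vcov q) 0 c * bt c q.
Proof.
move=> Oq; have alt_b : alternating (beta q) by case: fb => h _; exact: h.
rewrite [in LHS](decomp bundle af cg Oq v) (form1_add alt_b) !(form1_mul alt_b).
rewrite big1 ?add0r => [|i _]; last by rewrite beta_eY // mulr0.
by apply: eq_bigr => c _; rewrite eVE.
Qed.

Lemma beta_gamma q v : O q -> beta q (v *m gamma q) = beta q v.
Proof.
by move=> Oq; rewrite !beta_decomp // -mulmxA (gamma_vcov bundle af cg Oq).
Qed.

(** The minus in the definition of [Pbeta] cancels that of [QVE]; reversing a single covector costs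
    no sign. *)
Lemma PbetaE q Xi : O q -> Pbeta pi Omega omega gamma beta q Xi =
  (dens q)^-1 * \det (@col_mx R 1 2 3 (\row_c bt c q) (Xi *m (Dz q)^T)).
Proof.
move=> Oq; rewrite /Pbeta.
have -> : beta q = fun W => 1 * \det (W *m (vcov q *m (\row_c bt c q)^T)).
  apply/funext => W; rewrite mul1r det_mx11 beta_decomp // mulmxA mxE.
  by apply: eq_bigr => c _; rewrite !mxE.
have QE := QVE bundle af vO vo cg Oq.
rewrite iprod_det; last by rewrite QE; exact: det_form_alternating.
rewrite odd_rev1 expr0 mulr1 mul1r QE mulNr opprK; congr (_ * \det _).
have e : (vcov q *m (\row_c bt c q)^T)^T *m (Dz q)^T = \row_c bt c q.
  by rewrite trmx_mul trmxK -mulmxA -trmx_mul (Dz_vcov af gamma Oq) trmx1 mulmx1.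
by rewrite (@mul_col_mx _ 1 2 5 3) e.
Qed.

(* The bracket of P_beta is beta . (grad f x grad h) / dens in the vertical frame. *)
Definition vdet (f h : M -> R) q : R :=
  bt 0 q * (vder (eV 1) f q * vder (eV 2%:R) h q - vder (eV 2%:R) f q * vder (eV 1) h q)
  - bt 1 q * (vder (eV 0) f q * vder (eV 2%:R) h q - vder (eV 2%:R) f q * vder (eV 0) h q)
  + bt 2%:R q * (vder (eV 0) f q * vder (eV 1) h q - vder (eV 1) f q * vder (eV 0) h q).

Definition br f h q : R := (dens q)^-1 * vdet f h q.

Lemma grad_Dz f V q c : smooth_fun V f -> V q -> (dfun f q *m (Dz q)^T) 0 c = vder (eV c) f q.
Proof.
move=> sf Vq; rewrite /vder -(dfunE _ sf Vq) -eVE !mxE.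
by apply: eq_bigr => l _; rewrite !mxE mulrC.
Qed.

Lemma bracketE f h V q : smooth_fun V f -> smooth_fun V h -> V q -> O q ->
  bracket (Pbeta pi Omega omega gamma beta) f h q = br f h q.
Proof.
move=> sf sh Vq Oq; rewrite /bracket PbetaE //; congr (_ * _).
rewrite (@mul_col_mx _ 1 1 5 3).
have := grad_Dz _ sf Vq; have := grad_Dz _ sh Vq.
move: (dfun f q *m _) (dfun h q *m _) => F H eH eF.
by rewrite det_col3 !eH !eF !mxE.
Qed.

Lemma extd_vv c d q : O q ->
  extd beta q (row2 (eV c q) (eV d q)) = vder (eV c) (bt d) q - vder (eV d) (bt c) q.
Proof. by move=> Oq; exact: (extd_two oO sPhi uJ _ _ fb Oq). Qed.

Lemma beta_eD i q : O q -> beta q (eD i q) =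
  - (hz q i 0 * bt 0 q + hz q i 1 * bt 1 q + hz q i 2%:R * bt 2%:R q).
Proof.
move=> Oq; rewrite beta_decomp // sum3E (eD_vcov af gamma Oq) !mxE; ring.
Qed.

(** The horizontal derivatives of beta, completed by the vertical derivatives of the lift
    coefficients; these enter because beta is nonzero on [eD i] while it vanishes on the lift. *)
Lemma extd_Yv i c q : O q -> extd beta q (row2 (eY i q) (eV c q)) =
  vder (eY i) (bt c) q + (bt 0 q * vder (eV c) (fun q => hz q i 0) q
   + bt 1 q * vder (eV c) (fun q => hz q i 1) q + bt 2%:R q * vder (eV c) (fun q => hz q i 2%:R) q).
Proof.
move=> Oq; have altT := extd_alternating oO fb Oq.
rewrite eY_lin !(form2_lin0 altT) !extd_vv //.
have -> : extd beta q (row2 (eD i q) (eV c q)) =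
    vder (eD i) (bt c) q - vder (eV c) (fun q => beta q (eD i q)) q.
  exact: (extd_two oO sPhi uJ _ _ fb Oq).
have sh a := smooth_hz bundle af cg i a.
have shb a := smooth_funM oO (sh a) (smooth_bt a).
rewrite (vder_eY pi cB z gamma i (smooth_bt c) Oq) /vder.
rewrite (ddir_near oO _ Oq (beta_eD i)).
rewrite (ddirN _ (smooth_funD oO (smooth_funD oO (shb _) (shb _)) (shb _)) Oq).
rewrite (ddirD _ (smooth_funD oO (shb _) (shb _)) (shb _) Oq) (ddirD _ (shb _) (shb _) Oq).
rewrite !(ddirM _ (sh _) (smooth_bt _) Oq).
move: (bt 0 q) (bt 1 q) (bt 2%:R q) => b0 b1 b2; abstract_atoms; ring.
Qed.

End TripleOneForm.

(** * The equations of a Poisson triple *)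

Lemma alternating_col_mx (R : realType) n k l (b : 'M[R]_(k + l, n) -> R) (U : 'M[R]_(k, n)) :
  alternating b -> alternating (fun W : 'M[R]_(l, n) => b (col_mx U W)).
Proof.
move=> Hb; have e W i v : rset (col_mx U W) (rshift k i) v = col_mx U (rset W i v).
  apply/row_matrixP => m; rewrite rowK; case: (split_ordP m) => m' ->.
    by rewrite eq_lrshift !rowKu.
  by rewrite (inj_eq (@rshift_inj _ _)) !rowKd rowK.
split=> [W i r u v subst|W i j ij eW]; last first.
  apply: (alternating_eq (i := rshift k i) (j := rshift k j) Hb); rewrite ?rowKd //.
  by rewrite (inj_eq (@rshift_inj _ _)).
by have := alternating_multilinear Hb (col_mx U W) (rshift k i) r u v; rewrite !e.
Qed.

Section TripleEquivalences.
Context {R : realType} {M : manifold R 5} {B : manifold R 2}.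
Variable pi : M -> B.
Hypothesis bundle : fiber_bundle pi.
Variables (O : set M) (cB : chart R B 2) (z : 'I_3 -> M -> R).
Hypothesis af : adapted_frame pi O cB z.
Let oO : open O := af_open af.
Variables (Omega : dform M 5) (omega : dform B 2).
Hypotheses (vO : volume_form Omega) (vo : volume_form omega).
Variable gamma : M -> 'M[R]_5.
Hypothesis cg : connection pi O gamma.
Notation Dz := (Dz pi cB z).
Notation wt := (wt pi cB omega). Notation dens := (dens pi cB z Omega omega).
Notation hz := (hz pi cB z gamma). Notation Yh := (Yh pi cB z gamma).
Notation OmegaV := (OmegaV pi Omega omega gamma).
Notation eV := (eV pi cB z). Notation eY := (eY pi cB z gamma).
Notation curv := (curv pi cB z gamma).
Notation divh := (divh pi cB z Omega omega gamma).
Variable beta : dform M 1.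
Hypotheses (fb : is_form O beta)
  (hb : forall q v, O q -> horizontal gamma q v -> beta q v = 0).
Notation bt := (bt pi cB z beta).

(** Scalar product of beta with its curl along the fibre: up to sign conventions of the frame, the
    coefficient of d_(0,1) beta /\ beta. *)
Definition beta_curl q : R :=
  bt 0 q * (vder (eV 1) (bt 2%:R) q - vder (eV 2%:R) (bt 1) q)
  + bt 1 q * (vder (eV 2%:R) (bt 0) q - vder (eV 0) (bt 2%:R) q)
  + bt 2%:R q * (vder (eV 0) (bt 1) q - vder (eV 1) (bt 0) q).

(* The components of d_(1,0) beta - theta /\ beta on (eY i, eV c). *)
Definition beta_hor (i : 'I_2) (c : 'I_3) q : R :=
  vder (eY i) (bt c) q + (bt 0 q * vder (eV c) (fun q => hz q i 0) q
   + bt 1 q * vder (eV c) (fun q => hz q i 1) q + bt 2%:R q * vder (eV c) (fun q => hz q i 2%:R) q)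
  - divh i q / dens q * bt c q.

(** Cross product of beta with the vertical gradient of k, with cyclic indices in ['I_3]. Divided by
    [dens], these are the components of the Hamiltonian field of k. *)
Definition bt_cross (k : M -> R) q (c : 'I_3) : R :=
  bt (c + 1) q * vder (eV (c + 2%:R)) k q - bt (c + 2%:R) q * vder (eV (c + 1)) k q.

(** A product instead of a conjunction, so that it serves as a multirule for rewriting. *)
Lemma bt_crossE k q :
  (bt_cross k q 0 = bt 1 q * vder (eV 2%:R) k q - bt 2%:R q * vder (eV 1) k q) *
  (bt_cross k q 1 = bt 2%:R q * vder (eV 0) k q - bt 0 q * vder (eV 2%:R) k q) *
  (bt_cross k q 2%:R = bt 0 q * vder (eV 1) k q - bt 1 q * vder (eV 0) k q).
Proof.
have o01 : 0 + 1 = 1 :> 'I_3 by apply: val_inj.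
have o02 : 0 + 2%:R = 2%:R :> 'I_3 by apply: val_inj.
have o11 : 1 + 1 = 2%:R :> 'I_3 by apply: val_inj.
have o12 : 1 + 2%:R = 0 :> 'I_3 by apply: val_inj.
have o21 : 2%:R + 1 = 0 :> 'I_3 by apply: val_inj.
have o22 : 2%:R + 2%:R = 1 :> 'I_3 by apply: val_inj.
by rewrite /bt_cross o01 o02 o11 o12 o21 o22.
Qed.

Section Point.
Variable q : M.
Hypothesis Oq : O q.
Let altb : alternating (beta q). Proof. by case: fb => h _; exact: h. Qed.
Let alt2 : alternating (extd beta q) := extd_alternating oO fb Oq.
Let alt4 : alternating (extd OmegaV q) :=
  extd_alternating oO (form_OmegaV bundle af vO vo cg) Oq.

Let comp_alt p k (a : 'M[R]_(k, 5) -> R) : alternating a ->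
  alternating (bicomp (1%:M - gamma q) (gamma q) p a).
Proof. exact: bicomp_alternating. Qed.

Let sY i : eY i q *m (1%:M - gamma q) = eY i q /\ eY i q *m gamma q = 0.
Proof. by split; [exact: (eY_cogamma bundle af cg)|exact: (eY_gamma bundle af cg)]. Qed.
Let sV a : eV a q *m (1%:M - gamma q) = 0 /\ eV a q *m gamma q = eV a q.
Proof. by split; [exact: (eV_cogamma bundle af cg)|exact: (eV_gamma bundle af cg)]. Qed.

(** On fibres of dimension 3 a vertical 3-form is decided by its value on [Dz]. *)
Lemma vertical_wedge0 (a : 'M[R]_(2, 5) -> R) : alternating a ->
  (forall W, wedge (fun U => a (U *m gamma q)) (beta q) W = 0) <->
  a (row2 (eV 0 q) (eV 1 q)) * bt 2%:R q - a (row2 (eV 0 q) (eV 2%:R q)) * bt 1 q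
  + a (row2 (eV 1 q) (eV 2%:R q)) * bt 0 q = 0.
Proof.
move=> alt_a.
have -> : beta q = fun v => beta q (v *m gamma q).
  by apply/funext => v; rewrite (beta_gamma bundle af cg fb hb).
have alt_w : alternating (wedge a (beta q)) by exact: wedge_alternating.
have e : wedge a (beta q) (Dz q) = a (row2 (eV 0 q) (eV 1 q)) * bt 2%:R q
    - a (row2 (eV 0 q) (eV 2%:R q)) * bt 1 q + a (row2 (eV 1 q) (eV 2%:R q)) * bt 0 q.
  by rewrite wedge21 // !eVE.
rewrite -e; split=> [h|h W]; last first.
  by rewrite wedge_mulmx (gammaE bundle af cg Oq) mulmxA alternating_mulmx // h mulr0.
by have := h (Dz q); rewrite wedge_mulmx (Dz_gamma bundle af cg Oq).
Qed.

Lemma beta_closed_vertical :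
  (forall W, wedge (d01 gamma 0 beta q) (beta q) W = 0) <-> beta_curl q = 0.
Proof.
have -> : d01 gamma 0 beta q = fun U => extd beta q (U *m gamma q).
  by apply/funext => U; exact: bicomp0.
apply: (iff_trans (vertical_wedge0 alt2)).
rewrite !(extd_vv bundle af fb) // /beta_curl.
rewrite /vder; abstract_atoms; move: (bt 0 q) (bt 1 q) (bt 2%:R q) => b0 b1 b2.
match goal with |- (?x = 0 <-> ?y = 0) => by have -> : x = y by ring end.
Qed.

(** All terms vanish as soon as one argument is horizontal, so only the three vertical components
    remain. The factor r is free: kappa squared for the curvature equation, 0 for the Casimir
    condition. *)
Lemma vertical_wedge_fun (k : M -> R) (r : R) (a : 'M[R]_(2, 5) -> R) : smooth_fun O k ->
  alternating a -> (forall i v, a (row2 (eY i q) v) = 0) ->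
  (forall W, wedge (d01 gamma 0 (fun_form k) q) (beta q) W - r * a W = 0) <->
  [/\ vder (eV 0) k q * bt 1 q - vder (eV 1) k q * bt 0 q = r * a (row2 (eV 0 q) (eV 1 q)),
      vder (eV 0) k q * bt 2%:R q - vder (eV 2%:R) k q * bt 0 q = r * a (row2 (eV 0 q) (eV 2%:R q)) &
      vder (eV 1) k q * bt 2%:R q - vder (eV 2%:R) k q * bt 1 q = r * a (row2 (eV 1 q) (eV 2%:R q))].
Proof.
move=> sk alt_a a0.
have d01E v : d01 gamma 0 (fun_form k) q v = ddir k q (v *m gamma q).
  rewrite /d01 /form_comp bicomp0 /extd big_ord1 expr0 mul1r row_id.
  by apply: near_eq_derive; apply: filterE.
have altd : alternating (d01 gamma 0 (fun_form k) q).
  apply: alternating1 => r' u v.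
  by rewrite !d01E mulmxDl -scalemxAl (ddir_add _ _ sk Oq) (ddir_scale _ _ sk Oq).
pose c W := wedge (d01 gamma 0 (fun_form k) q) (beta q) W - r * a W.
have altc : alternating c.
  have -> : c = fun W => wedge (d01 gamma 0 (fun_form k) q) (beta q) W + (- r) * a W.
    by apply/funext => W; rewrite /c mulNr.
  by apply: alternating_add; [exact: wedge_alternating|exact: alternating_scale].
have cE u v : c (row2 u v) = ddir k q (u *m gamma q) * beta q v - ddir k q (v *m gamma q) * beta q u - r * a (row2 u v).
  by rewrite /c wedge11 // !rowsK !d01E.
have cV i j : c (row2 (eV i q) (eV j q)) = vder (eV i) k q * bt j q - vder (eV j) k q * bt i q - r * a (row2 (eV i q) (eV j q)).
  by rewrite cE !(eV_gamma bundle af cg).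
split=> [h|[h1 h2 h3]].
  split; [have := h (row2 (eV 0 q) (eV 1 q))|have := h (row2 (eV 0 q) (eV 2%:R q))|have := h (row2 (eV 1 q) (eV 2%:R q))];
  by rewrite -/(c _) cV => /eqP; rewrite subr_eq0 => /eqP.
have cY i u : c (row2 (eY i q) u) = 0.
  rewrite cE (eY_gamma bundle af cg) // (ddir0) mul0r sub0r.
  by rewrite (beta_eY bundle af cg hb) // mulr0 oppr0 sub0r a0 mulr0 oppr0.
apply: (two_form_zero bundle af cg Oq altc) => //.
have c01 : c (row2 (eV 0 q) (eV 1 q)) = 0 by rewrite cV h1 subrr.
have c02 : c (row2 (eV 0 q) (eV 2%:R q)) = 0 by rewrite cV h2 subrr.
have c12 : c (row2 (eV 1 q) (eV 2%:R q)) = 0 by rewrite cV h3 subrr.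
have sw u v : c (row2 u v) = 0 -> c (row2 v u) = 0 by move=> e; rewrite form2_swap // e oppr0.
by apply: ord3P; apply: ord3P; [exact: form2_eq|exact: c01|exact: c02|exact: (sw _ _ c01)|
  exact: form2_eq|exact: c12|exact: (sw _ _ c02)|exact: (sw _ _ c12)|exact: form2_eq].
Qed.

Lemma thetaE W : theta pi Omega omega gamma q W =
  - (dens q)^-1 * form_comp gamma 1 (extd OmegaV) q (row4 (eV 0 q) (eV 1 q) (eV 2%:R q) W).
Proof.
have altc : alternating (form_comp gamma 1 (extd OmegaV) q) by exact: comp_alt.
have <- : @col_mx _ 3 1 5 (Dz q) W = row4 (eV 0 q) (eV 1 q) (eV 2%:R q) W; last first.
  by rewrite /theta /d10 (QVE bundle af vO vo cg Oq) iprod_det // odd_rev3 expr1 trmxK mulrN1 opprK mulNr.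
apply/row_matrixP; apply: ord4P; rewrite rowsK.
- rewrite (_ : 0 = lshift 1 (0 : 'I_3) :> 'I_4); last exact: val_inj.
  by rewrite (@rowKu _ 3 1) eVE.
- rewrite (_ : 1 = lshift 1 (1 : 'I_3) :> 'I_4); last exact: val_inj.
  by rewrite (@rowKu _ 3 1) eVE.
- rewrite (_ : 2%:R = lshift 1 (2%:R : 'I_3) :> 'I_4); last exact: val_inj.
  by rewrite (@rowKu _ 3 1) eVE.
- rewrite (_ : 3%:R = rshift 3 (0 : 'I_1) :> 'I_4); last exact: val_inj.
  by rewrite (@rowKd _ 3 1) row_id.
Qed.

Lemma theta_lin : alternating (theta pi Omega omega gamma q).
Proof.
have altc : alternating (form_comp gamma 1 (extd OmegaV) q) by exact: comp_alt.
apply: alternating1 => r u v; rewrite !thetaE (form4_lin3 altc).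
move: (form_comp _ _ _ _ _) (form_comp _ _ _ _ _) (dens q) => x y d; ring.
Qed.

Lemma theta_eV a : theta pi Omega omega gamma q (eV a q) = 0.
Proof.
have altc : alternating (form_comp gamma 1 (extd OmegaV) q) by exact: comp_alt.
rewrite thetaE; move: a; apply: ord3P.
- by rewrite (form4_eq03 altc) mulr0.
- by rewrite (form4_eq13 altc) mulr0.
- by rewrite (form4_eq23 altc) mulr0.
Qed.

(** Only the fourth argument is horizontal, so the component of bidegree (1, 3) is the full
    derivative; the vertical part of the lift repeats an argument and drops out. *)
Lemma theta_eY i : theta pi Omega omega gamma q (eY i q) = divh i q / dens q.
Proof.
rewrite thetaE /form_comp.
rewrite (bicomp_homog _ (S0 := [set 3%:R]%SET) (alternating_multilinear alt4)).
- rewrite cards1 eqxx eY_lin !(form4_lin3 alt4).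
  rewrite (form4_eq03 alt4) (form4_eq13 alt4) (form4_eq23 alt4) (extd_vvvd bundle af vO vo cg Oq) !mulr0 !add0r.
  by rewrite mulrNN mulrC.
- by move=> j; rewrite finset.in_set1 => /eqP ->; rewrite rowsK.
- by apply: ord4P; rewrite finset.in_set1 // => _; rewrite rowsK.
Qed.

Lemma varrhoE u v : varrho pi Omega omega gamma q (row2 u v) =
  (wt q)^-1 * form_comp gamma 2 (extd OmegaV) q (row4 (eY 0 q) (eY 1 q) u v).
Proof.
have altc : alternating (form_comp gamma 2 (extd OmegaV) q) by exact: comp_alt.
have <- : @col_mx _ 2 2 5 (Yh q) (row2 u v) = row4 (eY 0 q) (eY 1 q) u v; last first.
  rewrite /varrho /d2m1 (QHE bundle af vo cg Oq) iprod_det; last exact: altc.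
  by rewrite odd_rev2 expr1 trmxK mulrN1 opprK.
apply/row_matrixP; apply: ord4P; rewrite rowsK.
- rewrite (_ : 0 = lshift 2 (0 : 'I_2) :> 'I_4); last exact: val_inj.
  exact: (@rowKu _ 2 2).
- rewrite (_ : 1 = lshift 2 (1 : 'I_2) :> 'I_4); last exact: val_inj.
  exact: (@rowKu _ 2 2).
- rewrite (_ : 2%:R = rshift 2 (0 : 'I_2) :> 'I_4); last exact: val_inj.
  by rewrite (@rowKd _ 2 2) rowsK.
- rewrite (_ : 3%:R = rshift 2 (1 : 'I_2) :> 'I_4); last exact: val_inj.
  by rewrite (@rowKd _ 2 2) rowsK.
Qed.

Lemma varrho_alternating : alternating (varrho pi Omega omega gamma q).
Proof.
have altc : alternating (form_comp gamma 2 (extd OmegaV) q) by exact: comp_alt.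
have -> : varrho pi Omega omega gamma q = fun W =>
    (wt q)^-1 * form_comp gamma 2 (extd OmegaV) q (@col_mx _ 2 2 5 (Yh q) W).
  apply/funext => W.
  rewrite /varrho /d2m1 (QHE bundle af vo cg Oq) iprod_det; last exact: altc.
  by rewrite odd_rev2 expr1 trmxK mulrN1 opprK.
exact/alternating_scale/(@alternating_col_mx _ 5 2 2 _ (Yh q) altc).
Qed.

Lemma varrho_eY i v : varrho pi Omega omega gamma q (row2 (eY i q) v) = 0.
Proof.
have altc : alternating (form_comp gamma 2 (extd OmegaV) q) by exact: comp_alt.
rewrite varrhoE; move: i; apply: ord2P.
- by rewrite (form4_eq02 altc) mulr0.
- by rewrite (form4_eq12 altc) mulr0.
Qed.

Lemma varrho_vv a b : varrho pi Omega omega gamma q (row2 (eV a q) (eV b q)) =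
  (wt q)^-1 * extd OmegaV q (row4 (eY 0 q) (eY 1 q) (eV a q) (eV b q)).
Proof.
rewrite varrhoE /form_comp (bicomp_homog _ (S0 := [set 0; 1]%SET) (alternating_multilinear alt4)).
- by rewrite cards2.
- by move=> j; rewrite finset.in_set2 => /orP[] /eqP ->; rewrite rowsK.
- by apply: ord4P; rewrite finset.in_set2 // => _; rewrite rowsK.
Qed.

(** The 2-form is purely of bidegree (1, 1), so its values on one lift and one vertical field
    decide. The factor r must stay, since kappa may vanish. *)
Lemma beta_horP (r : R) :
  (forall W, r * (d10 gamma 0 beta q W - wedge (theta pi Omega omega gamma q) (beta q) W) = 0) <->
  (forall i c, r * beta_hor i c q = 0).
Proof.
pose a W := r * (d10 gamma 0 beta q W + -1 * wedge (theta pi Omega omega gamma q) (beta q) W).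
have altd : alternating (d10 gamma 0 beta q) by exact: comp_alt.
have alta : alternating a.
  apply/alternating_scale/alternating_add => //.
  by apply: alternating_scale; exact: (wedge_alternating theta_lin altb).
have aE W : r * (d10 gamma 0 beta q W - wedge (theta pi Omega omega gamma q) (beta q) W) = a W.
  by rewrite /a mulN1r.
have wE u v : wedge (theta pi Omega omega gamma q) (beta q) (row2 u v) =
    theta pi Omega omega gamma q u * beta q v - theta pi Omega omega gamma q v * beta q u.
  by rewrite wedge11 ?rowsK //; exact: theta_lin.
have w0 u v : beta q u = 0 -> beta q v = 0 ->
    wedge (theta pi Omega omega gamma q) (beta q) (row2 u v) = 0.
  move=> hu hv; rewrite wE hu hv.
  move: (theta _ _ _ _ _ u) (theta _ _ _ _ _ v) => x y.
  by rewrite !mulr0 subr0.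
have aYV i c : a (row2 (eY i q) (eV c q)) = r * beta_hor i c q.
  rewrite /a wE theta_eY theta_eV mul0r subr0 /d10 /form_comp.
  rewrite (bicomp_homog _ (S0 := [set 0]%SET) (alternating_multilinear alt2)).
  - rewrite cards1 eqxx (extd_Yv bundle af cg fb hb) // mulN1r //.
  - by move=> j; rewrite finset.in_set1 => /eqP ->; rewrite rowsK.
  - by apply: ord2P; rewrite finset.in_set1 // => _; rewrite rowsK.
have aYY : a (row2 (eY 0 q) (eY 1 q)) = 0.
  have e : d10 gamma 0 beta q (row2 (eY 0 q) (eY 1 q)) = 0.
    rewrite /d10 /form_comp.
    rewrite (bicomp_homog _ (S0 := [set: 'I_2]%SET) (alternating_multilinear alt2)).
    - by rewrite cardsT card_ord.
    - by apply: ord2P; rewrite rowsK.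
    - by move=> j; rewrite finset.in_setT.
  by rewrite /a w0 ?e ?mulr0 ?addr0 ?mulr0 //; exact: (beta_eY bundle af cg hb _ Oq).
have aVV c d : a (row2 (eV c q) (eV d q)) = 0.
  have e : d10 gamma 0 beta q (row2 (eV c q) (eV d q)) = 0.
    rewrite /d10 /form_comp.
    rewrite (bicomp_homog _ (S0 := finset.set0) (alternating_multilinear alt2)).
    - by rewrite cards0.
    - by move=> j; rewrite finset.in_set0.
    - by apply: ord2P; rewrite rowsK.
  by rewrite /a wE e !theta_eV !mul0r subr0 mulr0 addr0 mulr0.
split=> [h i c|h W]; first by rewrite -aYV -aE.
rewrite aE; apply: (two_form_zero bundle af cg Oq alta) => // i c.
by rewrite aYV h.
Qed.

(** On the vertical frame [varrho] is the curvature contracted with the density [dens / wt]; the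
    three components of the equation then form one vector identity for the cross product. *)
Lemma curvP (k : M -> R) : smooth_fun O k ->
  (forall W, wedge (d01 gamma 0 (fun_form k) q) (beta q) W -
    k q ^+ 2 * varrho pi Omega omega gamma q W = 0) <->
  (forall c, bt_cross k q c = k q ^+ 2 * (dens q / wt q * curv c q)).
Proof.
move=> sk; apply: (iff_trans (vertical_wedge_fun _ sk varrho_alternating varrho_eY)).
rewrite !varrho_vv (extd_YYvv01 bundle af vO vo cg Oq) (extd_YYvv02 bundle af vO vo cg Oq).
rewrite (extd_YYvv12 bundle af vO vo cg Oq).
move: (wt q)^-1 (dens q) (k q ^+ 2) => w d K.
split=> [[h1 h2 h3]|h].
  apply: ord3P; rewrite bt_crossE /vder.
  - move: h3; rewrite /vder; abstract_atoms; move: (bt 1 q) (bt 2%:R q) (curv 0 q) => b1 b2 c0 h3.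
    by rewrite (_ : K * _ = - (K * (w * - (d * c0)))); [rewrite -h3|]; ring.
  - move: h2; rewrite /vder; abstract_atoms; move: (bt 0 q) (bt 2%:R q) (curv 1 q) => b1 b2 c0 h2.
    by rewrite (_ : K * _ = K * (w * (d * c0))); [rewrite -h2|]; ring.
  - move: h1; rewrite /vder; abstract_atoms; move: (bt 0 q) (bt 1 q) (curv 2%:R q) => b1 b2 c0 h1.
    by rewrite (_ : K * _ = - (K * (w * - (d * c0)))); [rewrite -h1|]; ring.
have := h 0; have := h 1; have := h 2%:R; rewrite !bt_crossE /vder.
abstract_atoms; move: (bt 0 q) (bt 1 q) (bt 2%:R q) (curv 0 q) (curv 1 q) (curv 2%:R q).
move=> b0 b1 b2 c0 c1 c2 h2 h1 h0; split.
- by rewrite (_ : K * _ = - (K * (d * w * c2))); [rewrite -h2|]; ring.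
- by rewrite (_ : K * _ = K * (d * w * c1)); [rewrite -h1|]; ring.
- by rewrite (_ : K * _ = - (K * (d * w * c0))); [rewrite -h0|]; ring.
Qed.

Lemma casimirP (k : M -> R) : smooth_fun O k ->
  (forall W, wedge (d01 gamma 0 (fun_form k) q) (beta q) W = 0) ->
  forall c, bt_cross k q c = 0.
Proof.
move=> sk h.
have [] := (vertical_wedge_fun 0 sk varrho_alternating varrho_eY).1.
  by move=> W; rewrite h mul0r subr0.
have z0 (x y : R) : x = 0 * y -> x = 0 by move=> ->; rewrite mul0r.
move=> g1 g2 g3; have h1 := z0 _ _ g1; have h2 := z0 _ _ g2; have h3 := z0 _ _ g3.
apply: ord3P; rewrite bt_crossE.
- move: h3; move: (vder _ _ _) (vder _ _ _) (bt _ _) (bt _ _) => x y u v h3.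
  by apply: oppr_inj; rewrite oppr0 -h3; ring.
- move: h2; move: (vder _ _ _) (vder _ _ _) (bt _ _) (bt _ _) => x y u v h2.
  by rewrite -h2; ring.
- move: h1; move: (vder _ _ _) (vder _ _ _) (bt _ _) (bt _ _) => x y u v h1.
  by apply: oppr_inj; rewrite oppr0 -h1; ring.
Qed.

End Point.
End TripleEquivalences.

(** * Formal brackets and derivations *)

Section Derivations.
Context {R : comNzRingType} {T : Type}.
Variables (O : T -> Prop) (S : (T -> R) -> Prop).
Implicit Types (f g h : T -> R) (q : T).

(* S is the algebra of smooth functions on O; functions are total on T, hence
   all identities are pointwise on O. *)
Definition derivation (D : (T -> R) -> T -> R) :=
  [/\ forall f, S f -> S (D f),
      forall f g q, S f -> S g -> O q -> D (fun q => f q + g q) q = D f q + D g q,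
      forall f g q, S f -> S g -> O q -> D (fun q => f q * g q) q = D f q * g q + f q * D g q &
      forall f q, S f -> O q -> D (fun q => - f q) q = - D f q].

Hypotheses (SD : forall f g, S f -> S g -> S (fun q => f q + g q))
  (SM : forall f g, S f -> S g -> S (fun q => f q * g q))
  (SN : forall f, S f -> S (fun q => - f q)).

Lemma S_sub f g : S f -> S g -> S (fun q => f q - g q).
Proof. by move=> sf sg; apply: (SD sf (SN sg)). Qed.

Lemma derivation_sub D f g q : derivation D -> S f -> S g -> O q ->
  D (fun q => f q - g q) q = D f q - D g q.
Proof. by move=> [_ dD _ dN] sf sg Oq; rewrite (dD _ _ _ sf (SN sg) Oq) dN. Qed.

(** * Formal horizontal lifts and their commutators *)

Section Lift.
Definition local (D : (T -> R) -> T -> R) := forall f g q, (forall p, O p -> f p = g p) -> O q -> D f q = D g q.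
Definition commuting (D E : (T -> R) -> T -> R) :=
  forall f q, S f -> O q -> D (E f) q = E (D f) q.

Variables D0 D1 D2 : (T -> R) -> T -> R.
Hypotheses (d0 : derivation D0) (d1 : derivation D1) (d2 : derivation D2).

(** The formal horizontal lift Y = E + h0 D0 + h1 D1 + h2 D2 of a base field E. *)
Definition lift_of (E : (T -> R) -> T -> R) (h0 h1 h2 : T -> R) (Y : (T -> R) -> T -> R) :=
  forall f q, S f -> O q -> Y f q = E f q + h0 q * D0 f q + h1 q * D1 f q + h2 q * D2 f q.

Lemma derivation_lift D E h0 h1 h2 Y f q : derivation D -> local D -> derivation E ->
  S h0 -> S h1 -> S h2 -> lift_of E h0 h1 h2 Y -> S f -> O q ->
  D (Y f) q = D (E f) q + (D h0 q * D0 f q + h0 q * D (D0 f) q)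
    + (D h1 q * D1 f q + h1 q * D (D1 f) q) + (D h2 q * D2 f q + h2 q * D (D2 f) q).
Proof.
move=> [_ DD DM _] lD [SE _ _ _] s0 s1 s2 YE sf Oq.
have [S0 _ _ _] := d0; have [S1 _ _ _] := d1; have [S2 _ _ _] := d2.
rewrite (lD _ _ _ (fun p Op => YE f p sf Op) Oq).
have m0 := SM s0 (S0 _ sf); have m1 := SM s1 (S1 _ sf); have m2 := SM s2 (S2 _ sf).
rewrite (DD _ _ _ (SD (SD (SE _ sf) m0) m1) m2 Oq) (DD _ _ _ (SD (SE _ sf) m0) m1 Oq).
by rewrite (DD _ _ _ (SE _ sf) m0 Oq) !DM; auto.
Qed.

Lemma lift_commuting D E h0 h1 h2 Y f q : commuting D D0 -> commuting D D1 -> commuting D D2 ->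
  commuting D E -> derivation D -> local D -> derivation E ->
  S h0 -> S h1 -> S h2 -> lift_of E h0 h1 h2 Y -> S f -> O q ->
  D (Y f) q = Y (D f) q + (D h0 q * D0 f q + D h1 q * D1 f q + D h2 q * D2 f q).
Proof.
move=> c0 c1 c2 cE dD lD dE s0 s1 s2 YE sf Oq; have [SD' _ _ _] := dD.
rewrite (derivation_lift dD lD dE s0 s1 s2 YE sf Oq) YE; [|by auto..].
by rewrite cE ?c0 ?c1 ?c2 //; ring.
Qed.

(** All underlying derivations commute, so only the derivatives of the coefficients survive, and the
    commutator has no component along E0 and E1. *)
Lemma lift_commutator E0 E1 h00 h01 h02 h10 h11 h12 Y0 Y1 f q :
  commuting D1 D0 -> commuting D2 D0 -> commuting D2 D1 ->
  commuting D0 E0 -> commuting D1 E0 -> commuting D2 E0 ->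
  commuting D0 E1 -> commuting D1 E1 -> commuting D2 E1 -> commuting E1 E0 ->
  derivation E0 -> derivation E1 -> derivation Y0 -> derivation Y1 -> local Y0 -> local Y1 ->
  S h00 -> S h01 -> S h02 -> S h10 -> S h11 -> S h12 ->
  lift_of E0 h00 h01 h02 Y0 -> lift_of E1 h10 h11 h12 Y1 -> S f -> O q ->
  Y0 (Y1 f) q - Y1 (Y0 f) q = (Y0 h10 q - Y1 h00 q) * D0 f q
    + (Y0 h11 q - Y1 h01 q) * D1 f q + (Y0 h12 q - Y1 h02 q) * D2 f q.
Proof.
move=> c10 c20 c21 c00 c01 c02 e0 e1 e2 ee dE0 dE1 dY0 dY1 l0 l1 s00 s01 s02 s10 s11 s12 Y0E Y1E sf Oq.
have [S0 _ _ _] := d0; have [S1 _ _ _] := d1; have [S2 _ _ _] := d2.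
have [SE0 _ _ _] := dE0; have [SE1 _ _ _] := dE1.
rewrite (derivation_lift dY0 l0 dE1 s10 s11 s12 Y1E sf Oq) (derivation_lift dY1 l1 dE0 s00 s01 s02 Y0E sf Oq).
rewrite !Y0E ?Y1E; [|by auto..].
rewrite c00 ?c01 ?c02 ?e0 ?e1 ?e2 ?ee ?c10 ?c20 ?c21 //; ring.
Qed.

End Lift.

(** * The bracket n b . (grad f x grad h) *)

Section CrossBracket.
Variables D0 D1 D2 : (T -> R) -> T -> R.
Hypotheses (d0 : derivation D0) (d1 : derivation D1) (d2 : derivation D2).
Hypotheses (c10 : forall f q, S f -> O q -> D1 (D0 f) q = D0 (D1 f) q)
  (c20 : forall f q, S f -> O q -> D2 (D0 f) q = D0 (D2 f) q)
  (c21 : forall f q, S f -> O q -> D2 (D1 f) q = D1 (D2 f) q).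
Variables b0 b1 b2 n : T -> R.
Hypotheses (s0 : S b0) (s1 : S b1) (s2 : S b2) (sn : S n).

Definition cross f h q : R :=
  b0 q * (D1 f q * D2 h q - D2 f q * D1 h q)
  - b1 q * (D0 f q * D2 h q - D2 f q * D0 h q)
  + b2 q * (D0 f q * D1 h q - D1 f q * D0 h q).

Definition crbr f h q : R := n q * cross f h q.

Lemma S_cross f h : S f -> S h -> S (cross f h).
Proof.
case: d0 d1 d2 => [S0 _ _ _] [S1 _ _ _] [S2 _ _ _] sf sh.
exact: (SD (S_sub (SM s0 (S_sub (SM (S1 _ sf) (S2 _ sh)) (SM (S2 _ sf) (S1 _ sh))))
  (SM s1 (S_sub (SM (S0 _ sf) (S2 _ sh)) (SM (S2 _ sf) (S0 _ sh)))))
  (SM s2 (S_sub (SM (S0 _ sf) (S1 _ sh)) (SM (S1 _ sf) (S0 _ sh))))).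
Qed.

Lemma derivation_cross D f h q : derivation D -> S f -> S h -> O q -> D (cross f h) q =
  D b0 q * (D1 f q * D2 h q - D2 f q * D1 h q)
  - D b1 q * (D0 f q * D2 h q - D2 f q * D0 h q)
  + D b2 q * (D0 f q * D1 h q - D1 f q * D0 h q)
  + (b0 q * ((D (D1 f) q * D2 h q + D1 f q * D (D2 h) q) - (D (D2 f) q * D1 h q + D2 f q * D (D1 h) q))
  - b1 q * ((D (D0 f) q * D2 h q + D0 f q * D (D2 h) q) - (D (D2 f) q * D0 h q + D2 f q * D (D0 h) q))
  + b2 q * ((D (D0 f) q * D1 h q + D0 f q * D (D1 h) q) - (D (D1 f) q * D0 h q + D1 f q * D (D0 h) q))).
Proof.
move=> dD sf sh Oq; have [S0 _ _ _] := d0; have [S1 _ _ _] := d1; have [S2 _ _ _] := d2.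
have [_ DD DM _] := dD; have DB := fun f g => @derivation_sub D f g q dD.
have sB u v : S u -> S v -> S (fun q => u q * v q) by exact: SM.
rewrite /cross DD ?DB ?DM ?DB ?DM //; try by repeat (apply: SM || apply: S_sub || apply: SD || auto).
ring.
Qed.

Lemma derivation_crbr D f h q : derivation D -> S f -> S h -> O q ->
  D (crbr f h) q = D n q * cross f h q + n q * D (cross f h) q.
Proof. by move=> [_ _ DM _] sf sh Oq; apply: DM => //; apply: S_cross. Qed.

Lemma crbr_derivation f : S f -> derivation (crbr f).
Proof.
move=> sf; have [S0 A0 M0 N0] := d0; have [S1 A1 M1 N1] := d1; have [S2 A2 M2 N2] := d2.
split=> [g sg|g h q sg sh Oq|g h q sg sh Oq|g q sg Oq]; first by apply: SM => //; exact: S_cross.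
- by rewrite /crbr /cross A0 // A1 // A2 //; ring.
- by rewrite /crbr /cross M0 // M1 // M2 //; ring.
- by rewrite /crbr /cross N0 // N1 // N2 //; ring.
Qed.

Lemma crbr_anti f h q : crbr f h q = - crbr h f q.
Proof. by rewrite /crbr /cross; ring. Qed.

(** Second derivatives cancel by commutation and the derivatives of n cancel as well. What remains
    is the product of n squared, b . curl b and the determinant of the three gradients, up to
    sign. *)
Lemma crbr_jacobi f g h q : S f -> S g -> S h -> O q ->
  b0 q * (D1 b2 q - D2 b1 q) + b1 q * (D2 b0 q - D0 b2 q) + b2 q * (D0 b1 q - D1 b0 q) = 0 ->
  crbr f (crbr g h) q + crbr g (crbr h f) q + crbr h (crbr f g) q = 0.
Proof.
move=> sf sg sh Oq h0.
rewrite [crbr f _ q]/crbr [crbr g (crbr h f) q]/crbr [crbr h (crbr f g) q]/crbr.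
rewrite [cross f _ q]/cross [cross g (crbr h f) q]/cross [cross h (crbr f g) q]/cross.
rewrite !(derivation_crbr d0) // !(derivation_crbr d1) // !(derivation_crbr d2) //.
rewrite !(derivation_cross d0) // !(derivation_cross d1) // !(derivation_cross d2) //.
rewrite /cross (c10 sf Oq) (c10 sg Oq) (c10 sh Oq) (c20 sf Oq) (c20 sg Oq) (c20 sh Oq).
rewrite (c21 sf Oq) (c21 sg Oq) (c21 sh Oq).
move: h0; set F := (X in X = 0) => h0.
(* Here F is b . curl b, and the last factor is the determinant of the gradients of f, g and h. *)
transitivity (- n q ^+ 2 * F * (D0 f q * (D1 g q * D2 h q - D2 g q * D1 h q)
  - D1 f q * (D0 g q * D2 h q - D2 g q * D0 h q) + D2 f q * (D0 g q * D1 h q - D1 g q * D0 h q))); last first.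
  by rewrite h0 mulr0 mul0r.
by rewrite /F; ring.
Qed.

(* The defect of a projectable derivation Y, with [Da, Y] = sum_b (c a b) Db. *)
Lemma crbr_defect Y (c : 'I_3 -> 'I_3 -> T -> R) f h q : derivation Y ->
  (forall f q, S f -> O q -> D0 (Y f) q = Y (D0 f) q + (c 0 0 q * D0 f q + c 0 1 q * D1 f q + c 0 2%:R q * D2 f q)) ->
  (forall f q, S f -> O q -> D1 (Y f) q = Y (D1 f) q + (c 1 0 q * D0 f q + c 1 1 q * D1 f q + c 1 2%:R q * D2 f q)) ->
  (forall f q, S f -> O q -> D2 (Y f) q = Y (D2 f) q + (c 2%:R 0 q * D0 f q + c 2%:R 1 q * D1 f q + c 2%:R 2%:R q * D2 f q)) ->
  S f -> S h -> O q ->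
  let G b a := Y n q * b q + n q * (Y b q + (b0 q * c a 0 q + b1 q * c a 1 q + b2 q * c a 2%:R q)
                 - (c 0 0 q + c 1 1 q + c 2%:R 2%:R q) * b q) in
  Y (crbr f h) q - crbr (Y f) h q - crbr f (Y h) q =
    G b0 0 * (D1 f q * D2 h q - D2 f q * D1 h q)
    - G b1 1 * (D0 f q * D2 h q - D2 f q * D0 h q)
    + G b2 2%:R * (D0 f q * D1 h q - D1 f q * D0 h q).
Proof.
move=> dY y0 y1 y2 sf sh Oq G.
rewrite (derivation_crbr dY) // (derivation_cross dY) //.
rewrite /crbr /cross !y0 // !y1 // !y2 //.
by rewrite /G; ring.
Qed.

End CrossBracket.

(** * Coupling a bracket with two derivations *)

Section Coupling.
Variable br : (T -> R) -> (T -> R) -> T -> R.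
Hypotheses (brd : forall f, S f -> derivation (br f))
  (br_anti : forall f h q, br f h q = - br h f q)
  (br_jac : forall f g h q, S f -> S g -> S h -> O q ->
    br f (br g h) q + br g (br h f) q + br h (br f g) q = 0).
Variables Y0 Y1 : (T -> R) -> T -> R.
Hypotheses (dY0 : derivation Y0) (dY1 : derivation Y1).
Variable K : T -> R.
Hypothesis sK : S K.

Definition defect (Y : (T -> R) -> T -> R) f h q : R :=
  Y (br f h) q - br (Y f) h q - br f (Y h) q.

Hypotheses (def0 : forall f h q, S f -> S h -> O q -> K q * defect Y0 f h q = 0)
  (def1 : forall f h q, S f -> S h -> O q -> K q * defect Y1 f h q = 0)
  (brK : forall f q, S f -> O q -> br K f q = K q ^+ 2 * (Y0 (Y1 f) q - Y1 (Y0 f) q)).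

Definition coupled f h q : R := K q * (Y0 f q * Y1 h q - Y0 h q * Y1 f q) + br f h q.

Lemma defectE Y f h q : Y (br f h) q = defect Y f h q + br (Y f) h q + br f (Y h) q.
Proof. by rewrite /defect; ring. Qed.

Lemma derivation_coupled D f h q : derivation D -> S f -> S h -> O q -> D (coupled f h) q =
  D K q * (Y0 f q * Y1 h q - Y0 h q * Y1 f q)
  + K q * (D (Y0 f) q * Y1 h q + Y0 f q * D (Y1 h) q - (D (Y0 h) q * Y1 f q + Y0 h q * D (Y1 f) q))
  + D (br f h) q.
Proof.
move=> dD sf sh Oq; have [S0 _ _ _] := dY0; have [S1 _ _ _] := dY1.
have [_ DD DM _] := dD; have [Sb _ _ _] := brd sf.
have sA u v : S u -> S v -> S (fun q => Y0 u q * Y1 v q) by move=> su sv; apply: SM; auto.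
have sB := S_sub (sA _ _ sf sh) (sA _ _ sh sf).
rewrite [LHS](DD _ _ _ (SM sK sB) (Sb _ sh) Oq) (DM _ _ _ sK sB Oq).
rewrite (derivation_sub dD (sA _ _ sf sh) (sA _ _ sh sf) Oq).
by rewrite !DM; auto.
Qed.

(** The terms in Y0 K and Y1 K cancel cyclically, as in a 3 x 3 determinant built from only two
    derivations. The commutators, which carry K squared, cancel against the brackets with K by
    [brK]. The rest is K times defects plus the Jacobi sum of [br]. *)
Lemma coupled_jacobi f g h q : S f -> S g -> S h -> O q ->
  coupled f (coupled g h) q + coupled g (coupled h f) q + coupled h (coupled f g) q = 0.
Proof.
move=> sf sg sh Oq; have J := br_jac sf sg sh Oq.
rewrite [coupled f _ q]/coupled [coupled g (coupled h f) q]/coupled [coupled h (coupled f g) q]/coupled.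
rewrite !(derivation_coupled dY0) // !(derivation_coupled dY1) //.
rewrite (derivation_coupled (brd sf)) // (derivation_coupled (brd sg)) // (derivation_coupled (brd sh)) //.
rewrite !(defectE Y0) !(defectE Y1).
rewrite (br_anti (Y0 f)) (br_anti (Y0 g)) (br_anti (Y0 h)) (br_anti (Y1 f)) (br_anti (Y1 g)) (br_anti (Y1 h)).
rewrite (br_anti f K) (br_anti g K) (br_anti h K) !brK //.
have Z0 u v : S u -> S v -> K q * defect Y0 u v q = 0 by move=> su sv; apply: def0.
have Z1 u v : S u -> S v -> K q * defect Y1 u v q = 0 by move=> su sv; apply: def1.
transitivity (Y0 f q * (K q * defect Y1 g h q) - Y1 f q * (K q * defect Y0 g h q)
  + (Y0 g q * (K q * defect Y1 h f q) - Y1 g q * (K q * defect Y0 h f q))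
  + (Y0 h q * (K q * defect Y1 f g q) - Y1 h q * (K q * defect Y0 f g q))
  + (br f (br g h) q + br g (br h f) q + br h (br f g) q)); first by ring.
by rewrite !Z0 // !Z1 // J !mulr0 !subr0 !addr0.
Qed.

(** * Shifting the derivations by Hamiltonian ones *)

Section Gauge.
Variables m0 m1 u iden : T -> R.
Hypotheses (sm0 : S m0) (sm1 : S m1) (su : S u) (si : S iden).
Let Y0' f q := Y0 f q + br m0 f q.
Let Y1' f q := Y1 f q + br m1 f q.
Let w q := Y0 m1 q - Y1 m0 q + br m0 m1 q.
Hypotheses (bru : forall f q, S f -> O q -> br u f q = br w f q)
  (idenE : forall q, O q -> iden q * (1 - K q * u q) = 1)
  (iden_der : forall f q, S f -> O q ->
     br f iden q = iden q ^+ 2 * (br f K q * u q + K q * br f u q)).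

(** By the Jacobi identity a Hamiltonian derivation is a derivation of the bracket, so adding one
    does not change the defect. *)
Lemma gauge_defect Y m f h q : derivation Y -> S m -> S f -> S h -> O q ->
  defect (fun f q => Y f q + br m f q) f h q = defect Y f h q.
Proof.
move=> dY sm sf sh Oq; have [SY _ _ _] := dY; have [Sm _ _ _] := brd sm.
have [_ Df _ _] := brd sf; have [_ Dh _ _] := brd sh.
rewrite /defect (br_anti _ h) Df ?Dh; [|by auto..].
rewrite (br_anti (Y f)).
have : br m (br f h) q + br f (br h m) q + br h (br m f) q = 0 by exact: br_jac.
have -> : br f (br h m) q = - br f (br m h) q.
  have [_ _ _ N] := brd sf; rewrite -N; [|by auto..].
  by congr (br f _ q); apply/funext => p; rewrite br_anti.
move=> /eqP; rewrite addrAC subr_eq0 => /eqP <-; ring.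
Qed.

(** The mixed terms Y0 {m1, f} and Y1 {m0, f} produce the defects of Y0 and Y1, which vanish only
    after multiplication by K; hence K on both sides. The commutator of the Hamiltonian parts is
    again Hamiltonian by Jacobi. *)
Lemma gauge_commutator f q : S f -> O q ->
  K q * (Y0' (Y1' f) q - Y1' (Y0' f) q) = K q * (Y0 (Y1 f) q - Y1 (Y0 f) q + br w f q).
Proof.
move=> sf Oq; have [S0 D0 _ _] := dY0; have [S1 D1 _ _] := dY1.
have [Sm0 Dm0 _ _] := brd sm0; have [Sm1 Dm1 _ _] := brd sm1.
have [_ Df _ Nf] := brd sf.
rewrite /Y0' /Y1' D0 ?D1 ?Dm0 ?Dm1; [|by auto..].
have e0 := @defectE Y0 m1 f q; have e1 := @defectE Y1 m0 f q.
have z0 := def0 sm1 sf Oq; have z1 := def1 sm0 sf Oq.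
have J := br_jac sm0 sm1 sf Oq.
have -> : br w f q = br (Y0 m1) f q - br (Y1 m0) f q - br f (br m0 m1) q.
  have sw1 := S_sub (S0 _ sm1) (S1 _ sm0).
  rewrite br_anti [br f w q](Df _ _ _ sw1 (Sm0 _ sm1) Oq) (derivation_sub (brd sf) (S0 _ sm1) (S1 _ sm0) Oq).
  by rewrite (br_anti (Y0 m1)) (br_anti (Y1 m0)); ring.
have J2 : br m1 (br f m0) q = - br m1 (br m0 f) q.
  have [_ _ _ N] := brd sm1; rewrite -N; [|by auto..].
  by congr (br m1 _ q); apply/funext => p; rewrite br_anti.
rewrite e0 e1; rewrite J2 in J.
transitivity (K q * defect Y0 m1 f q - K q * defect Y1 m0 f q
  + K q * (br m0 (br m1 f) q - br m1 (br m0 f) q + br f (br m0 m1) q)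
  + K q * (Y0 (Y1 f) q - Y1 (Y0 f) q + (br (Y0 m1) f q - br (Y1 m0) f q - br f (br m0 m1) q))).
  by ring.
by rewrite z0 z1 J mulr0 subr0 !add0r.
Qed.

(** The differential of K / (1 - K u) is (dK + K^2 du) / (1 - K u)^2. So the bracket is [iden]
    squared times K squared times the old commutator plus {w, f}, and [gauge_commutator] recognises
    the new commutator, with one K to spare. *)
Lemma gauge_brK f q : S f -> O q ->
  br (fun q => K q * iden q) f q = (K q * iden q) ^+ 2 * (Y0' (Y1' f) q - Y1' (Y0' f) q).
Proof.
move=> sf Oq; have [_ _ M _] := brd sf.
rewrite br_anti M // iden_der // (br_anti f K) (br_anti f u) bru // brK //.
have e := gauge_commutator sf Oq; have i1 := idenE Oq.
transitivity (iden q ^+ 2 * K q * (K q * (Y0' (Y1' f) q - Y1' (Y0' f) q))); last by ring.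
rewrite e.
(* Grouped so that [iden q * (1 - K q * u q)] appears and can be replaced by 1. *)
transitivity (iden q * (iden q * (1 - K q * u q)) * (K q ^+ 2 * (Y0 (Y1 f) q - Y1 (Y0 f) q))
  + iden q ^+ 2 * K q ^+ 2 * (u q * K q * (Y0 (Y1 f) q - Y1 (Y0 f) q) + br w f q)); last by ring.
by rewrite i1; ring.
Qed.

End Gauge.
End Coupling.
End Derivations.

(** * Poisson triples as bracket identities *)

Lemma vder_derivation (R : realType) n (M : manifold R n) (O : set M) (X : M -> 'rV[R]_n) :
  open O -> smooth_vfs O X -> derivation O (smooth_fun O) (vder X).
Proof.
move=> oO sX; split=> [f sf|f g q sf sg Oq|f g q sf sg Oq|f q sf Oq].
- exact: smooth_vder.
- exact: (ddirD _ sf sg Oq).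
- exact: (ddirM _ sf sg Oq).
- exact: (ddirN _ sf Oq).
Qed.

Section TripleOperators.
Context {R : realType} {M : manifold R 5} {B : manifold R 2}.
Variable pi : M -> B.
Hypothesis bundle : fiber_bundle pi.
Variables (O : set M) (cB : chart R B 2) (z : 'I_3 -> M -> R).
Hypothesis af : adapted_frame pi O cB z.
Let Phi : 'I_5 -> M -> R := adapted pi cB z.
Let oO : open O := af_open af.
Let sPhi i : smooth_fun O (Phi i) := smooth_adapted bundle i af.
Let uJ q : O q -> jac Phi q \in unitmx := @af_unit _ _ _ _ _ _ _ af q.
Variables (Omega : dform M 5) (omega : dform B 2).
Hypotheses (vO : volume_form Omega) (vo : volume_form omega).
Notation dens := (dens pi cB z Omega omega).
Notation eD := (eD pi cB z). Notation eV := (eV pi cB z).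
Variable beta : dform M 1.
Hypothesis fb : is_form O beta.
Notation bt := (bt pi cB z beta). Notation br := (br pi cB z Omega omega beta).
Notation beta_curl := (beta_curl pi cB z beta).
Notation S := (smooth_fun O).

Lemma derivation_eV a : derivation O S (vder (eV a)).
Proof. by apply: (vder_derivation oO); apply: (smooth_eV bundle af). Qed.
Lemma derivation_eD i : derivation O S (vder (eD i)).
Proof. by apply: (vder_derivation oO); apply: (smooth_eD bundle af). Qed.

Lemma smooth_idens : S (fun q => (dens q)^-1).
Proof.
by apply: (smooth_funV oO _ (smooth_dens bundle af vO vo)) => q; apply: (dens_neq0 af vO vo).
Qed.

Lemma brE f h q : br f h q = crbr (vder (eV 0)) (vder (eV 1)) (vder (eV 2%:R))
  (bt 0) (bt 1) (bt 2%:R) (fun q => (dens q)^-1) f h q.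
Proof. by []. Qed.

Lemma br_derivation f : S f -> derivation O S (br f).
Proof.
apply: (crbr_derivation (smooth_funD oO) (smooth_funM oO) (@smooth_funN _ _ _ _ oO)).
all: solve [exact: derivation_eV|exact: (smooth_bt bundle af fb)|exact: smooth_idens].
Qed.

Lemma br_anti f h q : br f h q = - br h f q.
Proof. by rewrite !brE; exact: crbr_anti. Qed.

Lemma eV_comm a b : commuting O S (vder (eV a)) (vder (eV b)).
Proof. by move=> f q sf Oq; exact: (fld_commute oO sPhi uJ _ _ sf Oq). Qed.

Lemma eVD_comm a b : commuting O S (vder (eV a)) (vder (eD b)).
Proof. by move=> f q sf Oq; exact: (fld_commute oO sPhi uJ _ _ sf Oq). Qed.

Lemma eD_comm a b : commuting O S (vder (eD a)) (vder (eD b)).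
Proof. by move=> f q sf Oq; exact: (fld_commute oO sPhi uJ _ _ sf Oq). Qed.

Lemma br_jacobi f g h q : S f -> S g -> S h -> O q -> beta_curl q = 0 ->
  br f (br g h) q + br g (br h f) q + br h (br f g) q = 0.
Proof.
move=> sf sg sh Oq.
apply: (crbr_jacobi (smooth_funD oO) (smooth_funM oO) (@smooth_funN _ _ _ _ oO)
  (derivation_eV 0) (derivation_eV 1) (derivation_eV 2%:R) _ _ _ _ _ _ _ sf sg sh Oq).
all: try solve [exact: eV_comm|exact: (smooth_bt bundle af fb)|exact: smooth_idens].
Qed.

Lemma eV_z a b q : O q -> vder (eV a) (z b) q = (a == b)%:R.
Proof.
move=> Oq; rewrite /vder (ddir_z bundle af Oq) -eVE -row_mul (Dz_dz af Oq).
by rewrite !mxE.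
Qed.

Lemma local_vder X : local O (vder X).
Proof. by move=> f g q fg Oq; exact: (ddir_near oO _ Oq fg). Qed.

Section Connection.
Variable gamma : M -> 'M[R]_5.
Hypothesis cg : connection pi O gamma.
Notation hz := (hz pi cB z gamma).
Notation eY := (eY pi cB z gamma).
Notation curv := (curv pi cB z gamma).
Notation divh := (divh pi cB z Omega omega gamma).
Notation beta_hor := (beta_hor pi cB z Omega omega gamma beta).

Lemma derivation_eY i : derivation O S (vder (eY i)).
Proof. by apply: (vder_derivation oO); apply: (smooth_eY bundle af cg). Qed.

Lemma eY_lift i : lift_of O S (vder (eV 0)) (vder (eV 1)) (vder (eV 2%:R)) (vder (eD i))
  (fun q => hz q i 0) (fun q => hz q i 1) (fun q => hz q i 2%:R) (vder (eY i)).
Proof. by move=> f q sf Oq; exact: vder_eY sf Oq. Qed.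

Lemma eVY_comm a i f q : S f -> O q -> vder (eV a) (vder (eY i) f) q =
  vder (eY i) (vder (eV a) f) q + (vder (eV a) (fun q => hz q i 0) q * vder (eV 0) f q
   + vder (eV a) (fun q => hz q i 1) q * vder (eV 1) f q
   + vder (eV a) (fun q => hz q i 2%:R) q * vder (eV 2%:R) f q).
Proof.
move=> sf Oq; have sh b := smooth_hz bundle af cg i b.
exact: (lift_commuting (smooth_funD oO) (smooth_funM oO) (derivation_eV 0) (derivation_eV 1)
  (derivation_eV 2%:R) (eV_comm a 0) (eV_comm a 1) (eV_comm a 2%:R) (eVD_comm a i)
  (derivation_eV a) (local_vder (eV a)) (derivation_eD i) (sh 0) (sh 1) (sh 2%:R) (eY_lift i) sf Oq).
Qed.

Lemma eY_commutator f q : S f -> O q ->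
  vder (eY 0) (vder (eY 1) f) q - vder (eY 1) (vder (eY 0) f) q =
  curv 0 q * vder (eV 0) f q + curv 1 q * vder (eV 1) f q + curv 2%:R q * vder (eV 2%:R) f q.
Proof.
move=> sf Oq; have sh i b := smooth_hz bundle af cg i b.
apply: (lift_commutator (smooth_funD oO) (smooth_funM oO) (derivation_eV 0) (derivation_eV 1)
  (derivation_eV 2%:R) (eV_comm 1 0) (eV_comm 2%:R 0) (eV_comm 2%:R 1) (eVD_comm 0 0) (eVD_comm 1 0)
  (eVD_comm 2%:R 0) (eVD_comm 0 1) (eVD_comm 1 1) (eVD_comm 2%:R 1) (eD_comm 1 0)
  (derivation_eD 0) (derivation_eD 1) (derivation_eY 0) (derivation_eY 1)
  (local_vder (eY 0)) (local_vder (eY 1)) (sh 0 0) (sh 0 1) (sh 0 2%:R) (sh 1 0) (sh 1 1) (sh 1 2%:R)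
  (eY_lift 0) (eY_lift 1) sf Oq).
Qed.

Lemma divhE i q : O q -> divh i q = vder (eY i) dens q + dens q *
  (vder (eV 0) (fun q => hz q i 0) q + vder (eV 1) (fun q => hz q i 1) q
   + vder (eV 2%:R) (fun q => hz q i 2%:R) q).
Proof.
move=> Oq; have sh a := smooth_hz bundle af cg i a.
have sd := smooth_dens bundle af vO vo.
rewrite /divh (vder_eY _ _ _ _ _ sd Oq).
have dM a b := ddirM (eV a q) sd (sh b) Oq.
rewrite {2 3 4}/vder (dM 0 0) (dM 1 1) (dM 2%:R 2%:R) /vder.
move: (dens q) => d; abstract_atoms; ring.
Qed.

(** The formal defect with n = 1 / dens. The derivative of n and the trace of the coefficient matrix
    combine into [divh / dens], which is the theta term of [beta_hor]. *)
Lemma br_defect i f h q : S f -> S h -> O q -> defect br (vder (eY i)) f h q =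
  (dens q)^-1 * (beta_hor i 0 q * (vder (eV 1) f q * vder (eV 2%:R) h q - vder (eV 2%:R) f q * vder (eV 1) h q)
    - beta_hor i 1 q * (vder (eV 0) f q * vder (eV 2%:R) h q - vder (eV 2%:R) f q * vder (eV 0) h q)
    + beta_hor i 2%:R q * (vder (eV 0) f q * vder (eV 1) h q - vder (eV 1) f q * vder (eV 0) h q)).
Proof.
move=> sf sh Oq.
have d0 := dens_neq0 af vO vo Oq; have sd := smooth_dens bundle af vO vo.
have sb c := smooth_bt bundle af fb c.
have := @crbr_defect _ _ _ _ (smooth_funD oO) (smooth_funM oO) (@smooth_funN _ _ _ _ oO)
  _ _ _ (derivation_eV 0) (derivation_eV 1) (derivation_eV 2%:R) _ _ _ _ (sb 0) (sb 1) (sb 2%:R)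
  smooth_idens (vder (eY i)) (fun a b q => vder (eV a) (fun q => hz q i b) q) f h q (derivation_eY i)
  (fun f q sf Oq => eVY_comm 0 i sf Oq) (fun f q sf Oq => eVY_comm 1 i sf Oq)
  (fun f q sf Oq => eVY_comm 2%:R i sf Oq) sf sh Oq.
rewrite /defect => e; rewrite [LHS]e {e} /beta_hor (divhE i Oq).
have -> : vder (eY i) (fun q => (dens q)^-1) q = - vder (eY i) dens q / dens q ^+ 2.
  exact: (ddirV _ sd Oq d0).
rewrite {1}[vder (eY i) dens]/vder.
move: d0; rewrite /vder; move: (dens q) (bt 0 q) (bt 1 q) (bt 2%:R q) => d b0 b1 b2 d0.
abstract_atoms.
by field.
Qed.

End Connection.
End TripleOperators.

(** * Equivalence of the triple equations with bracket identities *)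

Section TripleBracket.
Context {R : realType} {M : manifold R 5} {B : manifold R 2}.
Variable pi : M -> B.
Hypothesis bundle : fiber_bundle pi.
Variables (O : set M) (cB : chart R B 2) (z : 'I_3 -> M -> R).
Hypothesis af : adapted_frame pi O cB z.
Let oO : open O := af_open af.
Variables (Omega : dform M 5) (omega : dform B 2).
Hypotheses (vO : volume_form Omega) (vo : volume_form omega).
Notation wt := (wt pi cB omega). Notation dens := (dens pi cB z Omega omega).
Notation eV := (eV pi cB z).
Variable beta : dform M 1.
Hypothesis fb : is_form O beta.
Notation bt := (bt pi cB z beta). Notation br := (br pi cB z Omega omega beta).
Notation beta_curl := (beta_curl pi cB z beta).
Notation bt_cross := (bt_cross pi cB z beta).
Notation S := (smooth_fun O).
Variable gamma : M -> 'M[R]_5.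
Hypothesis cg : connection pi O gamma.
Hypothesis hb : forall q v, O q -> horizontal gamma q v -> beta q v = 0.
Notation eY := (eY pi cB z gamma).
Notation curv := (curv pi cB z gamma).
Notation beta_hor := (beta_hor pi cB z Omega omega gamma beta).

Lemma smooth_iwt : S (fun q => (wt q)^-1).
Proof.
by apply: (smooth_funV oO _ (smooth_wt bundle af vo)) => q; apply: (wt_neq0 af vo).
Qed.

Lemma br_iwt f q : O q -> br f (fun q => (wt q)^-1) q = 0.
Proof.
move=> Oq; have w0 := wt_neq0 af vo Oq.
have e a : vder (eV a) (fun q => (wt q)^-1) q = 0.
  rewrite /vder (ddirV _ (smooth_wt bundle af vo) Oq w0).
  by rewrite (ddir_wt bundle af vo Oq (eV_db af _ Oq)) oppr0 mul0r.
rewrite brE /crbr /cross (e 0) (e 1) (e 2%:R).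
move: (vder _ f q) (vder _ f q) (vder _ f q) (bt 0 q) (bt 1 q) (bt 2%:R q) (dens q)^-1.
by move=> *; ring.
Qed.

(** The bracket with k is the derivative along the Hamiltonian field of k; its coefficients are
    compared below with those of the curvature. *)
Lemma br_cross k f q : br k f q = (dens q)^-1 * (bt_cross k q 0 * vder (eV 0) f q
  + bt_cross k q 1 * vder (eV 1) f q + bt_cross k q 2%:R * vder (eV 2%:R) f q).
Proof.
rewrite brE /crbr /cross !bt_crossE.
rewrite /vder; move: (bt 0 q) (bt 1 q) (bt 2%:R q) (dens q)^-1 => b0 b1 b2 n.
abstract_atoms; ring.
Qed.

Variable kappa : M -> R.
Hypothesis sk : S kappa.
Definition coef q : R := kappa q / wt q.

Lemma smooth_coef : S coef.
Proof. exact: (smooth_funM oO sk smooth_iwt). Qed.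

Lemma br_coef f q : S f -> O q -> br coef f q = br kappa f q / wt q.
Proof.
move=> sf Oq; have [_ _ dM _] := br_derivation bundle af vO vo fb sf.
rewrite br_anti (dM _ _ _ sk smooth_iwt Oq) br_iwt // mulr0 addr0.
by rewrite (br_anti pi cB z Omega omega beta f kappa) mulNr opprK.
Qed.

(** Applied forwards to the given triple and backwards to the transformed one, whose connection, and
    hence whose [eY], is different. *)
Lemma triple_equations q : O q ->
  [/\ forall W, wedge (d01 gamma 0 beta q) (beta q) W = 0,
      forall W, kappa q *
        (d10 gamma 0 beta q W - wedge (theta pi Omega omega gamma q) (beta q) W) = 0 &
      forall W, wedge (d01 gamma 0 (fun_form kappa) q) (beta q) W -
        kappa q ^+ 2 * varrho pi Omega omega gamma q W = 0] <->
  [/\ beta_curl q = 0,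
      forall i f h, S f -> S h -> coef q * defect br (vder (eY i)) f h q = 0 &
      forall f, S f -> br coef f q =
        coef q ^+ 2 * (vder (eY 0) (vder (eY 1) f) q - vder (eY 1) (vder (eY 0) f) q)].
Proof.
move=> Oq; have w0 := wt_neq0 af vo Oq; have d0 := dens_neq0 af vO vo Oq.
have sz a : S (z a) := @af_smooth _ _ _ _ _ _ _ af a.
split=> -[/(beta_closed_vertical bundle af cg fb hb Oq) h1 h2 h3].
  split=> // [i f h sf sh|f sf].
    have /(beta_horP bundle af vO vo cg fb hb Oq) e := h2.
    rewrite (br_defect bundle af vO vo fb cg i sf sh Oq) /coef.
    move: (e i 0) (e i 1) (e i 2%:R) => {e}.
    move: (vder (eV 0) f q) (vder (eV 1) f q) (vder (eV 2%:R) f q) (vder (eV 0) h q) (vder (eV 1) h q) (vder (eV 2%:R) h q) => a0 a1 a2 c0 c1 c2.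
    move: (beta_hor i 0 q) (beta_hor i 1 q) (beta_hor i 2%:R q) (kappa q) (wt q)^-1 (dens q)^-1.
    move=> g0 g1 g2 k w n e0 e1 e2.
    transitivity (w * n * ((k * g0) * (a1 * c2 - a2 * c1) - (k * g1) * (a0 * c2 - a2 * c0)
      + (k * g2) * (a0 * c1 - a1 * c0))); first by ring.
    by rewrite e0 e1 e2; ring.
  have /(curvP bundle af vO vo cg fb hb Oq sk) e := h3.
  rewrite (br_coef sf Oq) br_cross (e 0) (e 1) (e 2%:R) (eY_commutator bundle af cg sf Oq) /coef.
  move: (vder _ f q) (vder _ f q) (vder _ f q) (curv 0 q) (curv 1 q) (curv 2%:R q) => a0 a1 a2 c0 c1 c2.
  move: (wt q) (dens q) (kappa q) w0 d0 => w d k w0 d0.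
  by field; rewrite w0 d0.
(* The fibre coordinates are dual to the vertical frame: the pair of coordinates following c
   cyclically isolates the component c of the defect, and z c isolates that of the commutator. *)
have z1 a : vder (eV a) (z a) q = 1 by rewrite (eV_z bundle af a a Oq) eqxx.
have z0 a b : a != b -> vder (eV a) (z b) q = 0.
  by move=> /negPf ab; rewrite (eV_z bundle af a b Oq) ab.
split; first exact: h1.
- apply/(beta_horP bundle af vO vo cg fb hb Oq) => i c.
  have kE (x : R) : coef q * ((dens q)^-1 * x) = 0 -> kappa q * x = 0.
    move/eqP; rewrite /coef mulf_eq0 mulf_eq0 invr_eq0 (negPf w0) orbF.
    by rewrite mulf_eq0 invr_eq0 (negPf d0) /= -mulf_eq0 => /eqP.
  move: c; apply: ord3P.
  + have := h2 i (z 1) (z 2%:R) (sz _) (sz _).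
    rewrite (br_defect bundle af vO vo fb cg i (sz _) (sz _) Oq).
    rewrite (z1 1) (z1 2%:R) (z0 0 1) // (z0 0 2%:R) // (z0 1 2%:R) // (z0 2%:R 1) // => /kE <-.
    by congr (_ * _); ring.
  + have := h2 i (z 2%:R) (z 0) (sz _) (sz _).
    rewrite (br_defect bundle af vO vo fb cg i (sz _) (sz _) Oq).
    rewrite (z1 0) (z1 2%:R) (z0 1 0) // (z0 0 2%:R) // (z0 1 2%:R) // (z0 2%:R 0) // => /kE <-.
    by congr (_ * _); ring.
  + have := h2 i (z 0) (z 1) (sz _) (sz _).
    rewrite (br_defect bundle af vO vo fb cg i (sz _) (sz _) Oq).
    rewrite (z1 0) (z1 1) (z0 1 0) // (z0 2%:R 1) // (z0 0 1) // (z0 2%:R 0) // => /kE <-.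
    by congr (_ * _); ring.
- apply/(curvP bundle af vO vo cg fb hb Oq sk).
  have kE (x c : R) : (dens q)^-1 * x / wt q = coef q ^+ 2 * c -> x = kappa q ^+ 2 * (dens q / wt q * c).
    rewrite /coef; move: (wt q) (dens q) (kappa q) w0 d0 => w d k w0 d0 e.
    have -> : x = (d^-1 * x / w) * d * w by field; rewrite w0 d0.
    by rewrite e; field.
  have hzE c : (dens q)^-1 * (bt_cross kappa q 0 * vder (eV 0) (z c) q
      + bt_cross kappa q 1 * vder (eV 1) (z c) q + bt_cross kappa q 2%:R * vder (eV 2%:R) (z c) q) / wt q =
      coef q ^+ 2 * (curv 0 q * vder (eV 0) (z c) q + curv 1 q * vder (eV 1) (z c) q
        + curv 2%:R q * vder (eV 2%:R) (z c) q).
    by rewrite -(eY_commutator bundle af cg (sz c) Oq) -(h3 _ (sz c)) (br_coef (sz c) Oq) br_cross.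
  apply: ord3P; apply: kE.
  + have := hzE 0; rewrite (z1 0) (z0 1 0) // (z0 2%:R 0) //.
    move: (bt_cross kappa q 0) (bt_cross kappa q 1) (bt_cross kappa q 2%:R).
    move: (curv 0 q) (curv 1 q) (curv 2%:R q) => c0 c1 c2 x0 x1 x2.
    by rewrite !mulr1 !mulr0 !addr0.
  + have := hzE 1; rewrite (z1 1) (z0 0 1) // (z0 2%:R 1) //.
    move: (bt_cross kappa q 0) (bt_cross kappa q 1) (bt_cross kappa q 2%:R).
    move: (curv 0 q) (curv 1 q) (curv 2%:R q) => c0 c1 c2 x0 x1 x2.
    by rewrite !mulr1 !mulr0 !addr0 !add0r.
  + have := hzE 2%:R; rewrite (z1 2%:R) (z0 0 2%:R) // (z0 1 2%:R) //.
    move: (bt_cross kappa q 0) (bt_cross kappa q 1) (bt_cross kappa q 2%:R).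
    move: (curv 0 q) (curv 1 q) (curv 2%:R q) => c0 c1 c2 x0 x1 x2.
    by rewrite !mulr1 !mulr0 !add0r.
Qed.
End TripleBracket.

(** * Almost coupling bivectors *)

Lemma det_row2 (R : realType) (u v : 'rV[R]_2) :
  \det (row2 u v : 'M[R]_2) = u 0 0 * v 0 1 - v 0 0 * u 0 1.
Proof.
have e0 i : row2 u v 0 i = u 0 i by rewrite -[in RHS](row2K0 u v) [RHS]mxE.
have e1 i : row2 u v 1 i = v 0 i by rewrite -[in RHS](row2K1 u v) [RHS]mxE.
by rewrite det2E !e0 !e1 [X in _ - X]mulrC.
Qed.

Section AlmostCoupling.
Context {R : realType} {M : manifold R 5} {B : manifold R 2}.
Variable pi : M -> B.
Hypothesis bundle : fiber_bundle pi.
Variables (Omega : dform M 5) (omega : dform B 2) (psi : mvec B 2).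
Hypotheses (vO : volume_form Omega) (vo : volume_form omega).
Hypotheses (mpsi : is_mvec setT psi) (psi_omega : forall b W, @iprod _ _ 2 0 (psi b) (omega b) W = -1).

Section Local.
Variables (O : set M) (cB : chart R B 2) (z : 'I_3 -> M -> R).
Hypothesis af : adapted_frame pi O cB z.
Let oO : open O := af_open af.
Notation wt := (wt pi cB omega). Notation dens := (dens pi cB z Omega omega).
Notation Dz := (Dz pi cB z).
Variable beta : dform M 1.
Hypothesis fb : is_form O beta.
Notation bt := (bt pi cB z beta). Notation br := (br pi cB z Omega omega beta).
Notation S := (smooth_fun O).
Variable gamma : M -> 'M[R]_5.
Hypothesis cg : connection pi O gamma.
Hypothesis hb : forall q v, O q -> horizontal gamma q v -> beta q v = 0.
Notation Yh := (Yh pi cB z gamma).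
Notation eY := (eY pi cB z gamma).
Variable kappa : M -> R.
Hypothesis sk : S kappa.
Notation coef := (coef pi cB omega kappa).

(** The normalisation i_psi omega = -1 compensates the sign of the reversal, so the lift of psi is
    Y0 /\ Y1 divided by [wt] with a plus sign. *)
Lemma horE q Xi : O q -> hor pi gamma psi q Xi = (wt q)^-1 * \det (Xi *m (Yh q)^T).
Proof.
move=> Oq; have w0 := wt_neq0 af vo Oq.
have [[alto _] _] := vo; have alt_o := alto (pi q) I.
have alt_p : alternating (psi (pi q)) by case: mpsi => h _; exact: h.
rewrite /hor (hliftE bundle af cg Oq) trmx_mul mulmxA (alternating_mulmx _ _ alt_p) mulrC.
congr (_ * _); have := psi_omega (pi q) (const_mx 0).
set T := to_chart cB (pi q); set F := of_chart cB (cB (pi q)).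
have FT : F *m T = 1%:M := of_to_chart (af_atlas af) (af_dom af Oq).
have -> : psi (pi q) = fun A => psi (pi q) T^T * \det (A *m F^T).
  apply/funext => A; rewrite mulrC -(alternating_mulmx _ _ alt_p) -mulmxA -trmx_mul.
  by rewrite (mulmx1C FT) trmx1 mulmx1.
rewrite iprod_det // odd_rev2 expr1 trmxK.
have -> : (col_mx F (const_mx 0 : 'M[R]_(0, 2)) : 'M[R]_(2 + 0, 2)) = F.
  apply/matrixP => i j; rewrite -[RHS](@col_mxEu _ 2 0 2 F (const_mx 0)).
  by congr (col_mx _ _ _ _); apply: val_inj.
rewrite -/(wt q) mulrN1 mulNr => /oppr_inj e.
rewrite -trmx_mul FT trmx1 det1 mulr1.
by apply: (mulIf w0); rewrite e mulVf.
Qed.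

Lemma almost_couplingE q Xi : O q ->
  almost_coupling pi Omega omega psi (Triple gamma kappa beta) q Xi =
  coef q * \det (Xi *m (Yh q)^T)
  + (dens q)^-1 * \det (@col_mx R 1 2 3 (\row_c bt c q) (Xi *m (Dz q)^T)).
Proof.
by move=> Oq; rewrite /almost_coupling horE // mulrA (PbetaE bundle af vO vo cg fb hb).
Qed.

Lemma bracket_coupled f h q : S f -> S h -> O q ->
  bracket (almost_coupling pi Omega omega psi (Triple gamma kappa beta)) f h q =
  coupled br (vder (eY 0)) (vder (eY 1)) coef f h q.
Proof.
move=> sf sh Oq; rewrite /bracket.
have yE g : S g -> forall i, (dfun g q *m (Yh q)^T) 0 i = vder (eY i) g q.
  move=> sg i; rewrite /vder -(dfunE _ sg Oq) !mxE.
  by apply: eq_bigr => l _; rewrite !mxE mulrC.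
have := bracketE bundle af vO vo cg fb hb sf sh Oq Oq.
rewrite /bracket (PbetaE bundle af vO vo cg fb hb _ Oq) almost_couplingE // => ->.
congr (_ * _ + _); have := yE _ sf; have := yE _ sh.
rewrite (@mul_col_mx _ 1 1 5 2); move: (dfun f q *m _) (dfun h q *m _) => F H eH eF.
by rewrite (det_row2 F H) !eH !eF.
Qed.

Lemma smooth_coupled f h : S f -> S h -> S (coupled br (vder (eY 0)) (vder (eY 1)) coef f h).
Proof.
move=> sf sh; have [y0 _ _ _] := derivation_eY bundle af cg 0.
have [y1 _ _ _] := derivation_eY bundle af cg 1.
have [b _ _ _] := br_derivation bundle af vO vo fb sf.
have sP u v : S u -> S v -> S (fun q => vder (eY 0) u q * vder (eY 1) v q).
  by move=> su sv; exact: (smooth_funM oO (y0 _ su) (y1 _ sv)).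
exact: (smooth_funD oO (smooth_funM oO (smooth_coef bundle af vo sk)
  (smooth_funB oO (sP _ _ sf sh) (sP _ _ sh sf))) (b _ sh)).
Qed.

(** The two brackets agree on O only, as functions are total; the inner one is exchanged under the
    derivatives of the outer one because O is open. *)
Lemma bracket_coupled2 f g h q : S f -> S g -> S h -> O q ->
  let A := almost_coupling pi Omega omega psi (Triple gamma kappa beta) in
  let cp := coupled br (vder (eY 0)) (vder (eY 1)) coef in
  bracket A f (bracket A g h) q = cp f (cp g h) q.
Proof.
move=> sf sg sh Oq A cp.
have e p : O p -> cp g h p = bracket A g h p by move=> Op; rewrite bracket_coupled.
have sG : S (bracket A g h) by apply: (smooth_fun_ext oO e); exact: smooth_coupled.
rewrite [LHS]bracket_coupled //.
have dE v : ddir (bracket A g h) q v = ddir (cp g h) q v.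
  by apply: (ddir_near oO _ Oq) => p Op; rewrite e.
move: (bracket A g h) (cp g h) dE => G C dE.
by rewrite /cp /coupled /br /vdet /vder !dE.
Qed.

Lemma smooth_almost_coupling c Xi : atlas c -> smooth_on (coord_set c O)
  (fun x => mvec_in c (almost_coupling pi Omega omega psi (Triple gamma kappa beta)) x Xi).
Proof.
move=> ac; have oC := coord_set_open c oO.
have sY := smooth_Yh bundle af cg ac; have sD := smooth_Dz bundle af ac.
have sm m k (A : M -> 'M[R]_(m, 5)) (W : 'M[R]_(k, 5)) i j : smooth_on (coord_set c O) (mx_in c A) ->
    smooth_on (coord_set c O) (fun x => (W *m (mx_in c A x)^T) i j).
  move=> /(smooth_on_mxP _ oC) sA.
  apply: (smooth_on_ext (f := fun x => \sum_l W i l * mx_in c A x j l) oC) => [x _|].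
    by rewrite !mxE; apply: eq_bigr => l _; rewrite [in RHS]mxE.
  apply: (smooth_on_sum oC) => l _.
  exact: (smooth_onM oC (smooth_on_cst oC _) (sA j l)).
have s1 : smooth_on (coord_set c O) (fun x => \det (Xi *m (mx_in c Yh x)^T)).
  by apply: (smooth_on_det oC) => i j; exact: sm.
have s2 : smooth_on (coord_set c O) (fun x => \det (@col_mx R 1 2 3
    (\row_a bt a (chart_inv c x)) (Xi *m (mx_in c Dz x)^T))).
  apply: (smooth_on_det oC) => i j; case: (split_ordP (i : 'I_(1 + 2))) => i' ->.
    apply: (smooth_on_ext (f := bt j \o chart_inv c) oC) => [x _|].
      by rewrite (@col_mxEu _ 1 2 3) mxE.
    exact: (smooth_bt bundle af fb j ac).
  apply: (smooth_on_ext (f := fun x => (Xi *m (mx_in c Dz x)^T) i' j) oC) => [x _|].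
    by rewrite (@col_mxEd _ 1 2 3).
  exact: sm.
apply: (smooth_on_ext oC _ (smooth_onD oC (smooth_onM oC (smooth_coef bundle af vo sk ac) s1)
  (smooth_onM oC (smooth_idens bundle af vO vo ac) s2))) => x [ix Ox].
rewrite /mvec_in almost_couplingE // /mx_in !trmx_mul !mulmxA.
done.
Qed.

Lemma alternating_almost_coupling q : O q ->
  alternating (almost_coupling pi Omega omega psi (Triple gamma kappa beta) q).
Proof.
move=> Oq; have -> : almost_coupling pi Omega omega psi (Triple gamma kappa beta) q = fun Xi =>
    coef q * \det (Xi *m (Yh q)^T) +
    (dens q)^-1 * \det (@col_mx R 1 2 3 (\row_c bt c q) (Xi *m (Dz q)^T)).
  by apply/funext => Xi; rewrite almost_couplingE.
apply: alternating_add; first exact: det_form_alternating.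
apply/alternating_scale/(alternating_mulr (a := fun W => \det (@col_mx R 1 2 3 (\row_c bt c q) W))).
exact/(@alternating_col_mx _ 3 1 2 (fun X => \det X))/det_alternating.
Qed.

End Local.

(** Smoothness and the Jacobi identity are local, and every point of U has an adapted frame inside
    U, where the bracket is the formal coupled one. *)
Lemma Poisson_triple_Poisson (U : set M) gamma kappa beta : open U ->
  Poisson_triple pi Omega omega U (Triple gamma kappa beta) ->
  Poisson U (almost_coupling pi Omega omega psi (Triple gamma kappa beta)).
Proof.
move=> oU [cg sk [fb hb] tE].
have local O cB z : adapted_frame pi O cB z -> O `<=` U ->
    [/\ connection pi O gamma, smooth_fun O kappa, is_form O beta &
      forall q v, O q -> horizontal gamma q v -> beta q v = 0].
  move=> af OU; split.
  - case: cg => sg vg; split=> [c ac|q /OU]; last exact: vg.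
    exact: smooth_on_open_sub (coord_set_sub OU) (sg c ac).
  - exact: smooth_fun_sub OU sk.
  - case: fb => alt sm; split=> [q /OU|c W ac]; first exact: alt.
    exact: smooth_on_open_sub (coord_set_sub OU) (sm c W ac).
  - by move=> q v /OU; exact: hb.
split; first split.
- move=> q Uq; have [W0 [cB [z [af Wq WU]]]] := adapted_frame_exists bundle oU Uq.
  have [cgO skO fbO hbO] := local _ _ _ af WU.
  exact: (alternating_almost_coupling af fbO cgO hbO).
- move=> c Xi ac; apply: smooth_on_local => x [ix Ux].
  have [W0 [cB [z [af Wq WU]]]] := adapted_frame_exists bundle oU Ux.
  have [cgO skO fbO hbO] := local _ _ _ af WU.
  by exists (coord_set c W0) => //; exact: (smooth_almost_coupling af fbO cgO hbO).
move=> f g h sf sg sh q Uq.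
have [W0 [cB [z [af Wq WU]]]] := adapted_frame_exists bundle oU Uq.
have [cgO skO fbO hbO] := local _ _ _ af WU.
have [sfO sgO shO] : [/\ smooth_fun W0 f, smooth_fun W0 g & smooth_fun W0 h] by split; apply: smooth_fun_sub WU _.
have oO := af_open af.
rewrite !(bracket_coupled2 af fbO cgO hbO skO) //.
have op p (Op : W0 p) := (triple_equations bundle af vO vo fbO cgO hbO skO Op).1 (tE p (WU p Op)).
apply: (coupled_jacobi (smooth_funD oO) (smooth_funM oO) (@smooth_funN _ _ _ _ oO)
  (fun f sf => br_derivation bundle af vO vo fbO sf) _ _ (derivation_eY bundle af cgO 0)
  (derivation_eY bundle af cgO 1) (smooth_coef bundle af vo skO) _ _ _ sfO sgO shO Wq).
- by move=> *; exact: br_anti.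
- move=> u v w p su sv sw Op; have [h1 _ _] := op p Op; exact: (br_jacobi bundle af vO vo fbO).
- by move=> u v p su sv Op; have [_ h2 _] := op p Op; exact: h2.
- by move=> u v p su sv Op; have [_ h2 _] := op p Op; exact: h2.
- by move=> u p su Op; have [_ _ h3] := op p Op; exact: h3.
Qed.

End AlmostCoupling.

(** * The shift of the connection *)

Section HorizontalOneForm.
Context {R : realType} {M : manifold R 5} {B : manifold R 2}.
Variable pi : M -> B.
Hypothesis bundle : fiber_bundle pi.
Variables (O : set M) (cB : chart R B 2) (z : 'I_3 -> M -> R).
Hypothesis af : adapted_frame pi O cB z.
Let Phi : 'I_5 -> M -> R := adapted pi cB z.
Let oO : open O := af_open af.
Let sPhi i : smooth_fun O (Phi i) := smooth_adapted bundle i af.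
Let uJ q : O q -> jac Phi q \in unitmx := @af_unit _ _ _ _ _ _ _ af q.
Variables (Omega : dform M 5) (omega : dform B 2).
Hypotheses (vO : volume_form Omega) (vo : volume_form omega).
Notation db := (db pi cB z).
Notation dens := (dens pi cB z Omega omega).
Notation Dz := (Dz pi cB z).
Notation eD := (eD pi cB z). Notation eV := (eV pi cB z).
Variables beta mu : dform M 1.
Hypotheses (fb : is_form O beta) (fm : is_form O mu)
  (hm : forall q v, O q -> vertical pi q v -> mu q v = 0).
Notation bt := (bt pi cB z beta). Notation bt_cross := (bt_cross pi cB z beta).
Notation S := (smooth_fun O).
Variable gamma : M -> 'M[R]_5.
Hypothesis cg : connection pi O gamma.
Hypothesis hb : forall q v, O q -> horizontal gamma q v -> beta q v = 0.
Notation vcov := (vcov pi cB z gamma).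
Notation eY := (eY pi cB z gamma).

(** Since mu kills vertical vectors, this is also its value on the horizontal lift for any
    connection. *)
Definition mu_ (i : 'I_2) q : R := mu q (eD i q).

Lemma smooth_mu i : S (mu_ i).
Proof. by apply: (smooth_eval oO fm); apply: (smooth_eD bundle af). Qed.

Lemma mu_eV a q : O q -> mu q (eV a q) = 0.
Proof. by move=> Oq; apply: hm => //; apply/(verticalP bundle af Oq); exact: (eV_db af). Qed.

Lemma mu_eY i q : O q -> mu q (eY i q) = mu_ i q.
Proof.
move=> Oq; have alt_m : alternating (mu q) by case: fm => h _; exact: h.
rewrite eY_lin !(form1_lin alt_m) (mu_eV 0 Oq) (mu_eV 1 Oq) (mu_eV 2%:R Oq) -/(mu_ i q).
by move: (mu_ i q) => m; abstract_atoms; move=> *; ring.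
Qed.

Lemma mu_decomp q v : O q -> mu q v = (v *m db q) 0 0 * mu_ 0 q + (v *m db q) 0 1 * mu_ 1 q.
Proof.
move=> Oq; have alt_m : alternating (mu q) by case: fm => h _; exact: h.
rewrite [in LHS](decomp bundle af cg Oq v) (form1_add alt_m) !(form1_mul alt_m) sum2E.
rewrite [X in _ + X]big1 ?addr0 => [|a _]; last by rewrite eVE mu_eV // mulr0.
by rewrite -(mu_eY 0 Oq) -(mu_eY 1 Oq).
Qed.

Section Point.
Variable q : M.
Hypothesis Oq : O q.
Let alt_b : alternating (beta q). Proof. by case: fb => h _; exact: h. Qed.
Let alt2 : alternating (extd mu q) := extd_alternating oO fm Oq.

Lemma extd_mu_VV a b : extd mu q (row2 (eV a q) (eV b q)) = 0.
Proof.
have e c : vder (eV c) (fun q => mu q (eV a q)) q = 0.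
  by rewrite /vder (ddir_near oO _ Oq (fun p Op => mu_eV a Op)) ddir_cst.
have e' c : vder (eV c) (fun q => mu q (eV b q)) q = 0.
  by rewrite /vder (ddir_near oO _ Oq (fun p Op => mu_eV b Op)) ddir_cst.
have := extd_two oO sPhi uJ (rshift 2 a : 'I_(2 + 3)) (rshift 2 b : 'I_(2 + 3)) fm Oq.
by move=> ->; rewrite [X in X - _]e' [X in _ - X]e subrr.
Qed.

Lemma extd_mu_DV i a : extd mu q (row2 (eD i q) (eV a q)) = - vder (eV a) (mu_ i) q.
Proof.
have e c : vder (eD c) (fun q => mu q (eV a q)) q = 0.
  by rewrite /vder (ddir_near oO _ Oq (fun p Op => mu_eV a Op)) ddir_cst.
have := extd_two oO sPhi uJ (lshift 3 i : 'I_(2 + 3)) (rshift 2 a : 'I_(2 + 3)) fm Oq.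
by move=> ->; rewrite [X in X - _]e sub0r.
Qed.

Lemma extd_mu_DD : extd mu q (row2 (eD 0 q) (eD 1 q)) = vder (eD 0) (mu_ 1) q - vder (eD 1) (mu_ 0) q.
Proof. exact: (extd_two oO sPhi uJ (lshift 3 0 : 'I_(2 + 3)) (lshift 3 1 : 'I_(2 + 3)) fm Oq). Qed.

Lemma extd_mu_YV i a : extd mu q (row2 (eY i q) (eV a q)) = - vder (eV a) (mu_ i) q.
Proof.
rewrite eY_lin !(form2_lin0 alt2) !extd_mu_VV extd_mu_DV.
by rewrite !mulr0 !add0r.
Qed.

Lemma extd_mu_YY : extd mu q (row2 (eY 0 q) (eY 1 q)) = vder (eY 0) (mu_ 1) q - vder (eY 1) (mu_ 0) q.
Proof.
have VD a i : extd mu q (row2 (eV a q) (eD i q)) = vder (eV a) (mu_ i) q.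
  by rewrite (form2_swap alt2) extd_mu_DV opprK.
rewrite !eY_lin !(form2_lin0 alt2) !(form2_lin1 alt2) !extd_mu_VV !extd_mu_DV !VD extd_mu_DD.
rewrite (vder_eY _ _ _ _ _ (smooth_mu 1) Oq) (vder_eY _ _ _ _ _ (smooth_mu 0) Oq).
rewrite /vder; abstract_atoms; ring.
Qed.

Lemma d10_mu W : d10 gamma 1 mu q W =
  (vder (eY 0) (mu_ 1) q - vder (eY 1) (mu_ 0) q) * \det (W *m db q).
Proof.
rewrite /d10 /form_comp bicomp_full (cogammaE bundle af cg Oq) mulmxA.
rewrite (alternating_mulmx _ _ alt2) mulrC; congr (_ * _).
rewrite -extd_mu_YY; congr (extd mu q _).
by apply/row_matrixP; apply: ord2P; rewrite rowsK.
Qed.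

(** Minus the vertical differential of [mu_ i], extended by 0 to horizontal vectors. *)
Let nu i (v : 'rV[R]_5) : R := (v *m (vcov q *m (\row_a (- vder (eV a) (mu_ i) q))^T)) 0 0.

(** In forms, d_(0,1) mu is the sum of db_i /\ nu_i. Both sides are compared on pairs of frame
    vectors. *)
Lemma d01_mu u v : d01 gamma 1 mu q (row2 u v) =
  (u *m db q) 0 0 * nu 0 v - (v *m db q) 0 0 * nu 0 u
  + ((u *m db q) 0 1 * nu 1 v - (v *m db q) 0 1 * nu 1 u).
Proof.
pose p i : 'M[R]_(1, 5) -> R := fun v => (v *m db q) 0 i.
have alt_p i : alternating (p i).
  by apply: alternating1 => r x y; rewrite /p mulmxDl -scalemxAl !mxE.
have altd : alternating (d01 gamma 1 mu q) by exact: bicomp_alternating.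
pose b W := d01 gamma 1 mu q W + -1 * (wedge (p 0) (nu 0) W + wedge (p 1) (nu 1) W).
have alt_nu i : alternating (nu i).
  by apply: alternating1 => r x y; rewrite /nu mulmxDl -scalemxAl !mxE.
have altb : alternating b.
  apply: alternating_add => //; apply/alternating_scale/alternating_add.
    exact: (wedge_alternating (alt_p 0) (alt_nu 0)).
  exact: (wedge_alternating (alt_p 1) (alt_nu 1)).
have wE i x y : wedge (p i) (nu i) (row2 x y) = (x *m db q) 0 i * nu i y - (y *m db q) 0 i * nu i x.
  by rewrite (wedge11 _ _ (alt_p i)) !rowsK.
have bE x y : b (row2 x y) = d01 gamma 1 mu q (row2 x y) -
    ((x *m db q) 0 0 * nu 0 y - (y *m db q) 0 0 * nu 0 x
  + ((x *m db q) 0 1 * nu 1 y - (y *m db q) 0 1 * nu 1 x)) by rewrite /b mulN1r !wE.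
suff b0 W : b W = 0.
  by have := b0 (row2 u v); rewrite bE => /eqP; rewrite subr_eq0 => /eqP.
have nuY i j : nu i (eY j q) = 0 by rewrite /nu mulmxA (eY_vcov af gamma j Oq) mul0mx mxE.
have nuV i a : nu i (eV a q) = - vder (eV a) (mu_ i) q.
  by rewrite /nu mulmxA (eV_vcov af gamma Oq) -rowE !mxE.
have Vdb a i : (eV a q *m db q) 0 i = 0 by rewrite (eV_db af a Oq) mxE.
have Ydb j i : (eY j q *m db q) 0 i = (j == i)%:R.
  by rewrite /eY -row_mul (Yh_db af gamma Oq) !mxE.
have sY i : eY i q *m (1%:M - gamma q) = eY i q /\ eY i q *m gamma q = 0.
  by split; [exact: (eY_cogamma bundle af cg)|exact: (eY_gamma bundle af cg)].
have sV a : eV a q *m (1%:M - gamma q) = 0 /\ eV a q *m gamma q = eV a q.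
  by split; [exact: (eV_cogamma bundle af cg)|exact: (eV_gamma bundle af cg)].
apply: (two_form_zero bundle af cg Oq altb).
- rewrite bE (nuY 0 0) (nuY 0 1) (nuY 1 0) (nuY 1 1) !mulr0 !subrr addr0 subr0 /d01 /form_comp.
  rewrite (bicomp_homog _ (S0 := [set: 'I_2]%SET) (alternating_multilinear alt2)).
  + by rewrite cardsT card_ord.
  + by apply: ord2P; rewrite rowsK.
  + by move=> j; rewrite finset.in_setT.
- move=> i a; rewrite bE /d01 /form_comp.
  rewrite (bicomp_homog _ (S0 := [set 0]%SET) (alternating_multilinear alt2)).
  + rewrite cards1 eqxx extd_mu_YV (Vdb a 0) (Vdb a 1) (nuV 0 a) (nuV 1 a) (Ydb i 0) (Ydb i 1).
    move: i; apply: ord2P; rewrite /=; [move: (nu 0 (eY 0 q)) (nu 1 (eY 0 q)) => x y|move: (nu 0 (eY 1 q)) (nu 1 (eY 1 q)) => x y];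
    by move: (vder _ (mu_ 0) q) (vder _ (mu_ 1) q) => s t; ring.
  + by move=> j; rewrite finset.in_set1 => /eqP ->; rewrite rowsK.
  + by apply: ord2P; rewrite finset.in_set1 // => _; rewrite rowsK.
- move=> a c; rewrite bE (Vdb a 0) (Vdb a 1) (Vdb c 0) (Vdb c 1).
  move: (nu 0 (eV a q)) (nu 0 (eV c q)) (nu 1 (eV a q)) (nu 1 (eV c q)) => n0 n1 n2 n3.
  rewrite !mul0r !subrr addr0 subr0 /d01 /form_comp.
  rewrite (bicomp_homog _ (S0 := finset.set0) (alternating_multilinear alt2)).
  + by rewrite cards0.
  + by move=> j; rewrite finset.in_set0.
  + by apply: ord2P; rewrite rowsK.
Qed.

(* Row i is the Hamiltonian vector field of mu_ i in the frame eV. *)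
Definition Xmu p : 'M[R]_(2, 3) := \matrix_(i, a) ((dens p)^-1 * bt_cross (mu_ i) p a).

Lemma iprod_add k l (A A' : 'M[R]_(k, 5) -> R) (b : 'M[R]_(k + l, 5) -> R) W :
  iprod (fun U => A U + A' U) b W = iprod A b W + iprod A' b W.
Proof.
rewrite /iprod -mulrDr -big_split; congr (_ * _); apply: eq_bigr => J _.
by rewrite mulrDl.
Qed.

(** Brings the contracting 3-form into a sum of two decomposable forms, one for each base direction,
    as [iprod_det] requires; the columns of A i represent db_i, nu_i and beta. *)
Lemma wedge_d01_mu (A : 'I_2 -> 'M[R]_(5, 3)) :
  (forall (v : 'rV[R]_5) i, (v *m A i) 0 0 = (v *m db q) 0 i) ->
  (forall (v : 'rV[R]_5) i, (v *m A i) 0 1 = nu i v) ->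
  (forall (v : 'rV[R]_5) i, (v *m A i) 0 2%:R = beta q v) ->
  wedge (d01 gamma 1 mu q) (beta q) = fun W => 1 * \det (W *m A 0) + 1 * \det (W *m A 1).
Proof.
move=> A0 A1 A2; apply/funext => W.
have altd : alternating (d01 gamma 1 mu q) by exact: bicomp_alternating.
have rW i : W *m A i = row3 (row 0 W *m A i) (row 1 W *m A i) (row 2%:R W *m A i).
  by apply/row_matrixP; apply: ord3P; rewrite rowsK row_mul.
rewrite (wedge21 _ _ altd).
have e01 := d01_mu (row 0 W) (row 1 W); have e02 := d01_mu (row 0 W) (row 2%:R W).
have e12 := d01_mu (row 1 W) (row 2%:R W).
rewrite /row2 in e01 e02 e12; rewrite e01 e02 e12 {e01 e02 e12} (rW 0) (rW 1) /row3.
rewrite !det_col3 !A0 !A1 !A2.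
move: (nu 0 _) (nu 0 _) (nu 0 _) (nu 1 _) (nu 1 _) (nu 1 _) (beta q _) (beta q _) (beta q _).
move=> *; abstract_atoms; move=> *; ring.
Qed.

Lemma QV_row3 u v w : QV pi Omega omega gamma q (row3 u v w) =
  - (dens q)^-1 * \det (row3 (u *m (Dz q)^T) (v *m (Dz q)^T) (w *m (Dz q)^T)).
Proof.
rewrite (QVE bundle af vO vo cg Oq); congr (_ * \det _).
by apply/row_matrixP; apply: ord3P; rewrite row_mul !rowsK.
Qed.

(** Inserting beta, nu_i and db_i into [QV /\ X], only the terms pairing X with db_i survive,
    because [QV] kills the base differentials. The other two covectors fill [QV] and give the
    Hamiltonian field of [mu_ i]. *)
Lemma conn_shiftE : conn_shift pi Omega omega gamma beta mu q = - (db q *m Xmu q *m Dz q).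
Proof.
pose X i := row3 (row i (db q)^T) (\row_a (- vder (eV a) (mu_ i) q) *m (vcov q)^T)
  (\row_a bt a q *m (vcov q)^T).
have rX (v : 'rV[R]_5) i j : (v *m (X i)^T) 0 j = (v *m (row j (X i))^T) 0 0.
  by rewrite !mxE; apply: eq_bigr => l _; rewrite !mxE.
have aE := wedge_d01_mu (A := fun i => (X i)^T).
have {}aE : wedge (d01 gamma 1 mu q) (beta q) =
    fun W => 1 * \det (W *m (X 0)^T) + 1 * \det (W *m (X 1)^T).
  apply: aE => v i.
  - by rewrite rX rowsK !mxE; apply: eq_bigr => l _; rewrite !mxE.
  - by rewrite rX rowsK trmx_mul trmxK.
  - rewrite rX rowsK trmx_mul trmxK mulmxA (beta_decomp bundle af cg fb hb _ Oq) !mxE.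
    by apply: eq_bigr => l _; congr (_ * _); rewrite !mxE.
apply/matrixP => k j; rewrite /conn_shift mxE mxE aE iprod_add {aE rX}.
have alt_v (v : 'rV[R]_5) : alternating (vec1 v).
  apply: alternating1 => r x y; rewrite /vec1.
  by rewrite linearP /= mulmxDr -scalemxAr !mxE.
have alt_Q : alternating (QV pi Omega omega gamma q).
  by rewrite (QVE bundle af vO vo cg Oq); exact: det_form_alternating.
have alt_T v : alternating (wedge (QV pi Omega omega gamma q) (vec1 v)).
  exact: (wedge_alternating alt_Q (alt_v v)).
have dbD i : row i (db q)^T *m (Dz q)^T = 0.
  by rewrite -row_mul -trmx_mul (Dz_db af Oq) trmx0 row0.
have vD (m : 'rV[R]_3) : m *m (vcov q)^T *m (Dz q)^T = m.
  by rewrite -mulmxA -trmx_mul (Dz_vcov af gamma Oq) trmx1 mulmx1.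
have iE i : iprod (fun W => 1 * \det (W *m (X i)^T))
     (wedge (QV pi Omega omega gamma q) (vec1 (delta_mx 0 k))) (delta_mx 0 j) =
    - (db q k i * \sum_a Xmu q i a * Dz q a j).
  rewrite iprod_det; last exact: alt_T.
  rewrite odd_rev3 expr1 mulrN1 mulNr mul1r trmxK /X /row3.
  rewrite (wedge31 _ _ _ _ _ alt_Q) -!/(row3 _ _ _) !QV_row3 !vD !dbD.
  have -> : vec1 (delta_mx 0 k) (row i (db q)^T) = db q k i by rewrite /vec1 -rowE !mxE.
  have -> : delta_mx 0 j *m (Dz q)^T = \row_a Dz q a j.
    by rewrite -rowE; apply/rowP => a; rewrite !mxE.
  move: (vec1 _ _) (vec1 _ _) (vec1 _ _) => v1 v2 v3.
  rewrite /row3 !det_col3 sum3E !mxE !bt_crossE.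
  move: (dens q)^-1 (bt 0 q) (bt 1 q) (bt 2%:R q) => n b0 b1 b2.
  move: (vder (eV 0) _ _) (vder (eV 1) _ _) (vder (eV 2%:R) _ _) (ddir _ _ _) => m0 m1 m2 x.
  by move: (frame _ _ _ _) (frame _ _ _ _) (frame _ _ _ _) => y0 y1 y2; ring.
apply: (etrans (congr2 +%R (iE 0) (iE 1))).
have -> : (- (db q *m Xmu q *m Dz q)) k j = - (\sum_i db q k i * \sum_a Xmu q i a * Dz q a j).
  rewrite mxE -mulmxA mxE; congr (- _); apply: eq_bigr => i _.
  by congr (_ * _); rewrite mxE.
by rewrite sum2E opprD.
Qed.

End Point.
End HorizontalOneForm.

(** * The curvature function of the shift *)

Lemma mvec1_smooth_vfs (R : realType) n (B : manifold R n) (U : set B) (u : B -> 'rV[R]_n) :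
  open U -> is_mvec U (fun b => vec1 (u b)) <-> smooth_vfs U u.
Proof.
move=> oU.
have e c x j : mvec_in c (fun b => vec1 (u b)) x (delta_mx 0 j) = mx_in c u x 0 j.
  by rewrite /mvec_in /vec1 trmx_mul trmxK mulmxA trmx_delta -colE mxE.
split=> [[_ su]|su].
  apply/(smooth_vfsP oU) => c i j ac; rewrite (ord1 i).
  by apply: (smooth_on_ext (coord_set_open c oU) _ (su c (delta_mx 0 j) ac)) => x _.
split=> [b _|c Xi ac].
  by apply: alternating1 => r x y; rewrite /vec1 linearP /= mulmxDr -scalemxAr !mxE.
have oC := coord_set_open c oU.
have s j : smooth_on (coord_set c U) (fun x => Xi 0 j * mx_in c u x 0 j).
  by apply: (smooth_onM oC (smooth_on_cst oC _)); move/(smooth_vfsP oU): su; apply.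
apply: (smooth_on_ext oC _ (smooth_on_sum oC (index_enum 'I_n) (P := predT) (fun j _ => s j))) => x _.
rewrite /mvec_in /vec1 trmx_mul trmxK mulmxA -/(mx_in c u x) !mxE.
by apply: eq_bigr => j _; rewrite mulrC; congr (_ * _); rewrite mxE.
Qed.

Section GaugeCurvature.
Context {R : realType} {M : manifold R 5} {B : manifold R 2}.
Variable pi : M -> B.
Hypothesis bundle : fiber_bundle pi.
Variables (O : set M) (cB : chart R B 2) (z : 'I_3 -> M -> R).
Hypothesis af : adapted_frame pi O cB z.
Let oO : open O := af_open af.
Variables (Omega : dform M 5) (omega : dform B 2).
Hypotheses (vO : volume_form Omega) (vo : volume_form omega).
Notation db := (db pi cB z).
Notation wt := (wt pi cB omega). Notation dens := (dens pi cB z Omega omega).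
Notation Db := (Db pi cB z). Notation eV := (eV pi cB z).
Variables beta mu : dform M 1.
Hypotheses (fb : is_form O beta) (fm : is_form O mu)
  (hm : forall q v, O q -> vertical pi q v -> mu q v = 0).
Notation bt := (bt pi cB z beta). Notation br := (br pi cB z Omega omega beta).
Variable gamma : M -> 'M[R]_5.
Hypothesis cg : connection pi O gamma.
Hypothesis hb : forall q v, O q -> horizontal gamma q v -> beta q v = 0.
Notation Yh := (Yh pi cB z gamma).
Notation eY := (eY pi cB z gamma).
Notation mu_ := (mu_ pi cB z mu).

Section BaseField.
Variables (U : set B) (u : B -> 'rV[R]_2).
Hypotheses (oU : open U) (su : is_mvec U (fun b => vec1 (u b))).
Let V : set M := O `&` pi @^-1` U.
Let spi : smooth_map pi. Proof. by case: bundle. Qed.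
Let oV : open V. Proof. by apply: openI => //; exact: (open_preim spi). Qed.
Let VO : V `<=` O. Proof. by move=> q []. Qed.

Definition base_comp (i : 'I_2) q : R := (u (pi q) *m to_chart cB (pi q)) 0 i.

Let bcomp (i : 'I_2) (b : B) : R := (u b *m to_chart cB b) 0 i.
Let U' := U `&` chart_dom cB.
Let oU' : open U'. Proof. by apply: openI => //; exact: chart_dom_open. Qed.

Let smooth_bcomp i : smooth_fun U' (bcomp i).
Proof.
have sv : smooth_vfs U u by apply/mvec1_smooth_vfs.
have sv' : smooth_vfs U' u.
  move=> c ac; apply: smooth_on_open_sub (sv c ac); apply: coord_set_sub.
  by move=> b [].
have sc : smooth_fun U' (fun b => cB b 0 i).
  by apply: smooth_fun_sub (smooth_coord (af_atlas af) i) => b [].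
apply: (smooth_fun_ext oU' _ (smooth_vder oU' sc sv')) => b [Ub db].
exact: (ddir_coord (af_atlas af)).
Qed.

Lemma smooth_base_comp i : smooth_fun V (base_comp i).
Proof.
apply: smooth_fun_sub (smooth_pull spi oU' (smooth_bcomp i)) => q [Oq Uq].
by split=> //; exact: (af_dom af).
Qed.

(** The components of a field on B are constant along the fibres, so they leave a vertical bracket
    as factors; this is the tensoriality of {mu /\ mu}_beta. *)
Lemma ddir_base_comp i a q : V q -> vder (eV a) (base_comp i) q = 0.
Proof.
move=> [Oq Uq]; have U'q : U' (pi q) by split=> //; exact: (af_dom af).
have -> : vder (eV a) (base_comp i) q = ddir (bcomp i) (pi q) (eV a q *m tangent pi q).
  exact: (ddir_pull spi (eV a q) oU' (smooth_bcomp i) U'q).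
by rewrite (tangentE bundle af Oq) mulmxA (eV_db af _ Oq) mul0mx ddir0.
Qed.

Lemma hor_vfE q : O q -> hor_vf pi gamma u q = u (pi q) *m to_chart cB (pi q) *m Yh q.
Proof. by move=> Oq; rewrite /hor_vf (hliftE bundle af cg Oq) mulmxA. Qed.

Lemma mu_hor_vf q : O q -> mu q (hor_vf pi gamma u q) =
  base_comp 0 q * mu_ 0 q + base_comp 1 q * mu_ 1 q.
Proof.
move=> Oq; rewrite (mu_decomp bundle af fm hm cg _ Oq) hor_vfE // -mulmxA.
by rewrite (Yh_db af gamma Oq) mulmx1.
Qed.

Lemma smooth_mu_hor_vf : smooth_fun V (fun q => mu q (hor_vf pi gamma u q)).
Proof.
have sm i := smooth_fun_sub VO (smooth_mu bundle af fm i).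
apply: (smooth_fun_ext oV _ (smooth_funD oV (smooth_funM oV (smooth_base_comp 0) (sm 0))
  (smooth_funM oV (smooth_base_comp 1) (sm 1)))) => q [Oq _].
by rewrite mu_hor_vf.
Qed.

Lemma vder_mu_hor_vf a q : V q -> vder (eV a) (fun q => mu q (hor_vf pi gamma u q)) q =
  base_comp 0 q * vder (eV a) (mu_ 0) q + base_comp 1 q * vder (eV a) (mu_ 1) q.
Proof.
move=> Vq; have sm i := smooth_fun_sub VO (smooth_mu bundle af fm i).
rewrite {1}/vder (ddir_near oV _ Vq (fun p Vp => mu_hor_vf (VO Vp))).
rewrite (ddirD _ (smooth_funM oV (smooth_base_comp 0) (sm 0)) (smooth_funM oV (smooth_base_comp 1) (sm 1)) Vq).
rewrite (ddirM _ (smooth_base_comp 0) (sm 0) Vq) (ddirM _ (smooth_base_comp 1) (sm 1) Vq).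
have := ddir_base_comp 0 a Vq; have := ddir_base_comp 1 a Vq; rewrite /vder => -> ->.
by rewrite !mul0r !add0r.
Qed.

End BaseField.

(** The factor 2 arises because the defining difference adds {a, b} and -{b, a}. Uniqueness comes
    from testing on the coordinate fields of cB. *)
Lemma mubracketE q W : O q -> mubracket pi Omega omega gamma beta mu q W =
  2 * br (mu_ 0) (mu_ 1) q * \det (W *m db q).
Proof.
move=> Oq; have spi : smooth_map pi by case: bundle.
pose a W := 2 * br (mu_ 0) (mu_ 1) q * \det (W *m db q).
have aP (U : set B) (u1 u2 : B -> 'rV[R]_2) : open U -> U (pi q) ->
    is_mvec U (fun b => vec1 (u1 b)) -> is_mvec U (fun b => vec1 (u2 b)) ->
    a (col_mx (hor_vf pi gamma u1 q) (hor_vf pi gamma u2 q)) =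
    bracket (Pbeta pi Omega omega gamma beta) (fun q => mu q (hor_vf pi gamma u1 q))
      (fun q => mu q (hor_vf pi gamma u2 q)) q -
    bracket (Pbeta pi Omega omega gamma beta) (fun q => mu q (hor_vf pi gamma u2 q))
      (fun q => mu q (hor_vf pi gamma u1 q)) q.
  move=> oU Uq s1 s2; have Vq : (O `&` pi @^-1` U) q by split.
  have m1 := smooth_mu_hor_vf oU s1; have m2 := smooth_mu_hor_vf oU s2.
  rewrite (bracketE bundle af vO vo cg fb hb m1 m2 Vq Oq) (bracketE bundle af vO vo cg fb hb m2 m1 Vq Oq).
  rewrite !brE /crbr /cross.
  have d1 c := vder_mu_hor_vf oU s1 c Vq; have d2 c := vder_mu_hor_vf oU s2 c Vq.
  rewrite (d1 0) (d1 1) (d1 2%:R) (d2 0) (d2 1) (d2 2%:R) /a.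
  rewrite (@mul_col_mx _ 1 1 5 2) (det_row2 (hor_vf pi gamma u1 q *m _) (hor_vf pi gamma u2 q *m _)).
  have e u i : (hor_vf pi gamma u q *m db q) 0 i = base_comp u i q.
    by rewrite hor_vfE // -mulmxA (Yh_db af gamma Oq) mulmx1.
  rewrite !e brE /crbr /cross.
  move: (base_comp u1 0 q) (base_comp u1 1 q) (base_comp u2 0 q) (base_comp u2 1 q) => x0 x1 y0 y1.
  move: (vder _ (mu_ 0) q) (vder _ (mu_ 0) q) (vder _ (mu_ 0) q) => a0 a1 a2.
  move: (vder _ (mu_ 1) q) (vder _ (mu_ 1) q) (vder _ (mu_ 1) q) => c0 c1 c2.
  move: (dens q)^-1 (bt 0 q) (bt 1 q) (bt 2%:R q) => n b0 b1 b2.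
  ring.
have alt_a : alternating a by exact: det_form_alternating.
rewrite -[RHS]/(a W); congr (_ W); apply: get_eq => /= [|a' [[alt_a' bic] a'P]].
  split; first split=> //.
    apply/funext => X; rewrite bicomp_full /a -mulmxA mulmxBl mul1mx.
    by rewrite (gamma_db bundle af cg Oq) subr0.
  by move=> U u1 u2 oU Uq s1 s2; exact: aP oU Uq s1 s2.
apply/funext => X; rewrite -bic bicomp_full (cogammaE bundle af cg Oq) mulmxA.
rewrite (alternating_mulmx _ _ alt_a').
have -> : a X = \det (X *m db q) * a (Yh q).
  by rewrite /a (Yh_db af gamma Oq) det1 mulr1 mulrC.
congr (_ * _).
(* These fields are used over the chart domain only, which the quantification over open subsets of B
   allows. *)
pose u i b := row i (of_chart cB (cB b)).
have oC := @chart_dom_open _ _ _ cB.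
have su i : is_mvec (chart_dom cB) (fun b => vec1 (u i b)).
  by apply/(mvec1_smooth_vfs _ oC)/(smooth_vfs_row oC)/(smooth_of_chart (af_atlas af)).
have uE i : hor_vf pi gamma (u i) q = row i (Yh q).
  rewrite hor_vfE // -!row_mul; congr row.
  by rewrite (of_to_chart (af_atlas af) (af_dom af Oq)) mul1mx.
have := a'P _ (u 0) (u 1) oC (af_dom af Oq) (su 0) (su 1).
rewrite -(aP _ (u 0) (u 1) oC (af_dom af Oq) (su 0) (su 1)).
by rewrite !uE -(rows2E (Yh q)).
Qed.

Lemma quot_areaE (a : dform M 2) q s : O q -> (forall W, a q W = s * \det (W *m db q)) ->
  quot_area pi omega a q = s / wt q.
Proof.
move=> Oq aE; have w0 := wt_neq0 af vo Oq.
apply: get_eq => /= [W|r h].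
  by rewrite aE (pullbackE bundle af vo Oq) mulrA divfK.
have := h (Db q); rewrite aE (pullbackE bundle af vo Oq) (Db_db af Oq) det1 !mulr1 => ->.
by rewrite mulfK.
Qed.

Lemma varkappaE e q : O q ->
  quot_area pi omega (fun p W => d10 gamma 1 mu p W
    + e / 2 * mubracket pi Omega omega gamma beta mu p W) q =
  (vder (eY 0) (mu_ 1) q - vder (eY 1) (mu_ 0) q + e * br (mu_ 0) (mu_ 1) q) / wt q.
Proof.
move=> Oq; apply: quot_areaE => // W.
rewrite (d10_mu bundle af fm hm cg Oq) mubracketE //.
rewrite [RHS]mulrDl; congr (_ + _); rewrite -!mulrA; congr (_ * _).
by rewrite mulKf // pnatr_eq0.
Qed.

End GaugeCurvature.

(** * Gauge transformations of Poisson triples *)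

Section GaugeTransformation.
Context {R : realType} {M : manifold R 5} {B : manifold R 2}.
Variable pi : M -> B.
Hypothesis bundle : fiber_bundle pi.
Variables (O : set M) (cB : chart R B 2) (z : 'I_3 -> M -> R).
Hypothesis af : adapted_frame pi O cB z.
Let oO : open O := af_open af.
Variables (Omega : dform M 5) (omega : dform B 2).
Hypotheses (vO : volume_form Omega) (vo : volume_form omega).
Notation db := (db pi cB z). Notation wt := (wt pi cB omega). Notation dens := (dens pi cB z Omega omega).
Notation Dz := (Dz pi cB z).
Notation eV := (eV pi cB z).
Variables beta mu : dform M 1.
Hypotheses (fb : is_form O beta) (fm : is_form O mu)
  (hm : forall q v, O q -> vertical pi q v -> mu q v = 0).
Notation bt := (bt pi cB z beta). Notation br := (br pi cB z Omega omega beta).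
Notation bt_cross := (bt_cross pi cB z beta).
Notation S := (smooth_fun O).
Variable gamma : M -> 'M[R]_5.
Hypothesis cg : connection pi O gamma.
Hypothesis hb : forall q v, O q -> horizontal gamma q v -> beta q v = 0.
Notation mu_ := (mu_ pi cB z mu).
Notation Xmu := (Xmu pi cB z Omega omega beta mu).
Notation Yg := (eY pi cB z gamma).
Variable e : R.

Definition gauge_conn q := gamma q + e *: conn_shift pi Omega omega gamma beta mu q.

Let cse q (Oq : O q) : conn_shift pi Omega omega gamma beta mu q = - (db q *m Xmu q *m Dz q) :=
  conn_shiftE bundle af vO vo fb fm hm cg hb Oq.

Let smu i : S (mu_ i) := smooth_mu bundle af fm i.

Lemma smooth_bt_cross k a : S k -> S (fun q => bt_cross k q a).
Proof.
move=> sk; have sV c : S (vder (eV c) k) by case: (derivation_eV bundle af c) => h _ _ _; exact: h.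
have sb := smooth_bt bundle af fb.
exact: (smooth_funB oO (smooth_funM oO (sb _) (sV _)) (smooth_funM oO (sb _) (sV _))).
Qed.

Lemma smooth_Xmu i a : S (fun q => Xmu q i a).
Proof.
apply: (smooth_fun_ext oO _ (smooth_funM oO (smooth_idens bundle af vO vo) (smooth_bt_cross a (smu i)))).
by move=> q _; rewrite [RHS]mxE.
Qed.

Lemma gauge_connection : connection pi O gauge_conn.
Proof.
have [sg vg] := cg; split=> [c ac|q Oq v].
  have oC := coord_set_open c oO.
  have s1 : smooth_on (coord_set c O) (fun x => of_chart c x *m db (chart_inv c x) *m Xmu (chart_inv c x)).
    apply: (smooth_on_mulmx oC (smooth_db_in bundle af ac)); apply/(smooth_on_mxP _ oC) => i a.
    exact: (smooth_Xmu i a ac).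
  have s2 := smooth_on_mulmx oC s1 (smooth_Dz bundle af ac).
  have s3 := smooth_on_mulmx oC (smooth_on_cst oC (- e)%:M) s2.
  apply: (smooth_on_ext oC _ (smooth_onD oC (sg c ac) s3)) => x [ix Ox].
  rewrite /endo_in /gauge_conn cse // /mx_in mul_scalar_mx scaleNr scalerN mulmxBr mulmxBl.
  by rewrite -scalemxAr -scalemxAl !mulmxA.
have e1 : v *m gauge_conn q = v *m gamma q - e *: (v *m db q *m Xmu q *m Dz q).
  by rewrite /gauge_conn cse // mulmxDr scalerN mulmxN -scalemxAr !mulmxA.
have [h1 h2] := vg q Oq v; split.
  apply/(verticalP bundle af Oq); rewrite e1 mulmxBl.
  move/(verticalP bundle af Oq): h1 => ->.
  by rewrite -scalemxAl -(mulmxA _ (Dz q)) (Dz_db af Oq) mulmx0 scaler0 subr0.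
move=> vv; rewrite e1 h2 //; move/(verticalP bundle af Oq): vv => ->.
by rewrite !mul0mx scaler0 subr0.
Qed.

(** Beta annihilates every Hamiltonian field, since a cross product with beta is orthogonal to beta;
    so shifting the lifts by such fields leaves beta vertical. *)
Lemma gauge_horizontal q v : O q -> horizontal gauge_conn q v -> beta q v = 0.
Proof.
move=> Oq; rewrite /horizontal /gauge_conn cse // mulmxDr => /eqP; rewrite addr_eq0 => /eqP e1.
rewrite -(beta_gamma bundle af cg fb hb v Oq) e1 scalerN mulmxN opprK -scalemxAr.
have alt_b : alternating (beta q) by case: fb => h _; exact: h.
rewrite !mulmxA !scalemxAl; move: (e *: v *m db q) => C.
rewrite (form1_mul alt_b) sum3E !eVE -!/(bt _ q) !(mxE _ _ 0) !sum2E.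
rewrite !mxE !bt_crossE.
move: (vder (eV 0) (mu_ 0) q) (vder (eV 1) (mu_ 0) q) (vder (eV 2%:R) (mu_ 0) q) => a0 a1 a2.
move: (vder (eV 0) (mu_ 1) q) (vder (eV 1) (mu_ 1) q) (vder (eV 2%:R) (mu_ 1) q) => c0 c1 c2.
move: (dens q)^-1 (bt 0 q) (bt 1 q) (bt 2%:R q) => n b0 b1 b2.
ring.
Qed.

(** The minus sign in [hz] meets that of [conn_shiftE], so the lifts move by plus e times the
    Hamiltonian fields. *)
Lemma gauge_Yh q : O q -> Yh pi cB z gauge_conn q = Yh pi cB z gamma q + e *: Xmu q *m Dz q.
Proof.
move=> Oq; rewrite /Yh -addrA -mulmxDl; congr (_ + _ *m _).
rewrite /hz /gauge_conn cse // mulmxDr mulmxDl opprD scalerN mulmxN mulNmx opprK.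
rewrite -scalemxAr -scalemxAl; congr (_ + _ *: _).
by rewrite !mulmxA (Db_db af Oq) mul1mx -mulmxA (Dz_dz af Oq) mulmx1.
Qed.

Lemma vder_gauge i f q : S f -> O q -> vder (eY pi cB z gauge_conn i) f q =
  vder (Yg i) f q + br (fun q => e * mu_ i q) f q.
Proof.
move=> sf Oq.
rewrite /vder; have -> : eY pi cB z gauge_conn i q = e *: (row i (Xmu q) *m Dz q) + Yg i q.
  rewrite /eY gauge_Yh // linearD /= -scalemxAl linearZ /= -row_mul.
  exact: addrC.
rewrite (ddir_add _ _ sf Oq) (ddir_scale _ _ sf Oq) addrC; congr (_ + _).
rewrite br_cross mulmx_sum_row sum3E !(ddir_add _ _ sf Oq) !(ddir_scale _ _ sf Oq) !eVE !mxE.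
rewrite !bt_crossE.
have zE a : vder (eV a) (fun q => e * mu_ i q) q = e * vder (eV a) (mu_ i) q.
  exact: (ddirZ oO _ _ (smu i) Oq).
rewrite (zE 0) (zE 1) (zE 2%:R) -!/(vder _ f q).
move: (vder (eV 0) (mu_ i) q) (vder (eV 1) (mu_ i) q) (vder (eV 2%:R) (mu_ i) q) => a0 a1 a2.
move: (dens q)^-1 (bt 0 q) (bt 1 q) (bt 2%:R q) => n b0 b1 b2.
rewrite /vder; move: (ddir f q _) (ddir f q _) (ddir f q _) => x y t.
ring.
Qed.

Lemma local_br f : local O (br f).
Proof.
move=> g h q gh Oq; rewrite /br /vdet.
have E a : vder (eV a) g q = vder (eV a) h q by exact: (ddir_near oO _ Oq gh).
by rewrite (E 0) (E 1) (E 2%:R).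
Qed.

Lemma br_cst f (a : R) q : br f (fun=> a) q = 0.
Proof.
rewrite brE /crbr /cross.
have E b : vder (eV b) (fun=> a) q = 0 by exact: ddir_cst.
rewrite (E 0) (E 1) (E 2%:R).
move: (vder (eV 0) f q) (vder (eV 1) f q) (vder (eV 2%:R) f q) => a0 a1 a2.
by move: (dens q)^-1 (bt 0 q) (bt 1 q) (bt 2%:R q) => n b0 b1 b2; ring.
Qed.

Lemma br_inv f g q : S g -> O q -> g q != 0 ->
  br f (fun q => (g q)^-1) q = - br f g q / g q ^+ 2.
Proof.
move=> sg Oq g0; rewrite !brE /crbr /cross.
have E a : vder (eV a) (fun q => (g q)^-1) q = - vder (eV a) g q / g q ^+ 2.
  exact: (ddirV _ sg Oq g0).
rewrite (E 0) (E 1) (E 2%:R); move: (g q ^+ 2)^-1 => i.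
move: (vder (eV 0) f q) (vder (eV 1) f q) (vder (eV 2%:R) f q) => a0 a1 a2.
move: (vder (eV 0) g q) (vder (eV 1) g q) (vder (eV 2%:R) g q) => c0 c1 c2.
move: (dens q)^-1 (bt 0 q) (bt 1 q) (bt 2%:R q) => n b0 b1 b2; ring.
Qed.

Variables kappa c : M -> R.
Hypotheses (sk : S kappa) (sc : S c).
Hypothesis casimir : forall q W, O q -> wedge (d01 gamma 0 (fun_form c) q) (beta q) W = 0.
Hypothesis tE : forall q, O q ->
  [/\ forall W, wedge (d01 gamma 0 beta q) (beta q) W = 0,
      forall W, kappa q *
        (d10 gamma 0 beta q W - wedge (theta pi Omega omega gamma q) (beta q) W) = 0 &
      forall W, wedge (d01 gamma 0 (fun_form kappa) q) (beta q) W -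
        kappa q ^+ 2 * varrho pi Omega omega gamma q W = 0].

(** The function varkappa for the parameter e. *)
Definition gauge_kap q : R := quot_area pi omega (fun p W => d10 gamma 1 mu p W
    + e / 2 * mubracket pi Omega omega gamma beta mu p W) q.
Definition gauge_denom q : R := 1 - e * kappa q * (gauge_kap q - c q).

Let K := coef pi cB omega kappa.
Let m i q : R := e * mu_ i q.
Let w q : R := vder (Yg 0) (m 1) q - vder (Yg 1) (m 0) q + br (m 0) (m 1) q.
Let u q : R := w q - e * (wt q * c q).

Let sm i : S (m i). Proof. exact: (smooth_funM oO (smooth_fun_cst oO _) (smu i)). Qed.
Let swt : S wt := smooth_wt bundle af vo.
Let dbr f (sf : S f) : derivation O S (br f) := br_derivation bundle af vO vo fb sf.
Let dY i : derivation O S (vder (Yg i)) := derivation_eY bundle af cg i.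
Let sw : S w.
Proof.
have [y0 _ _ _] := dY 0; have [y1 _ _ _] := dY 1; have [b _ _ _] := dbr (sm 0).
exact: (smooth_funD oO (smooth_funB oO (y0 _ (sm 1)) (y1 _ (sm 0))) (b _ (sm 1))).
Qed.
Let sewc : S (fun q => e * (wt q * c q)).
Proof. exact: (smooth_funM oO (smooth_fun_cst oO _) (smooth_funM oO swt sc)). Qed.
Let su : S u. Proof. exact: (smooth_funB oO sw sewc). Qed.
Let sK : S K. Proof. exact: (smooth_coef bundle af vo sk). Qed.

(** Since m_i = e mu_i, the function w is e times [wt] times varkappa: one e goes to the linear
    terms and e squared to the bracket. The factor [wt] cancels the one in K, which is why the
    Casimir term of u carries [wt] as well. *)
Lemma gauge_denomE q : O q -> gauge_denom q = 1 - K q * u q.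
Proof.
move=> Oq; have w0 := wt_neq0 af vo Oq.
rewrite /gauge_denom /gauge_kap (varkappaE bundle af vO vo fb fm hm cg hb _ Oq).
have e1 i j : vder (Yg i) (m j) q = e * vder (Yg i) (mu_ j) q by exact: (ddirZ oO _ _ (smu j) Oq).
have e2 : br (m 0) (m 1) q = e ^+ 2 * br (mu_ 0) (mu_ 1) q.
  rewrite !brE /crbr /cross.
  have E a j : vder (eV a) (m j) q = e * vder (eV a) (mu_ j) q by exact: (ddirZ oO _ _ (smu j) Oq).
  rewrite (E 0 0) (E 1 0) (E 2%:R 0) (E 0 1) (E 1 1) (E 2%:R 1).
  move: (vder (eV 0) (mu_ 0) q) (vder (eV 1) (mu_ 0) q) (vder (eV 2%:R) (mu_ 0) q) => a0 a1 a2.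
  move: (vder (eV 0) (mu_ 1) q) (vder (eV 1) (mu_ 1) q) (vder (eV 2%:R) (mu_ 1) q) => c0 c1 c2.
  move: (dens q)^-1 (bt 0 q) (bt 1 q) (bt 2%:R q) => n b0 b1 b2; ring.
rewrite /u /w (e1 0 1) (e1 1 0) e2 /K /coef.
move: (vder _ _ q) (vder _ _ q) (br _ _ q) (kappa q) (c q) (wt q) w0 => x y t k c0 w1 w0.
by field.
Qed.

Lemma smooth_gauge_denom : S gauge_denom.
Proof.
apply: (smooth_fun_ext oO _ (smooth_funB oO (smooth_fun_cst oO 1) (smooth_funM oO sK su))).
by move=> q Oq; rewrite gauge_denomE.
Qed.

(** The difference of u and w is a constant times [wt] times c, where [wt] comes from the base and c
    is a Casimir function by hypothesis. *)
Let bru f q : S f -> O q -> br u f q = br w f q.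
Proof.
move=> sf Oq; have [_ _ dM _] := dbr sf.
rewrite br_anti (derivation_sub (@smooth_funN _ _ _ _ oO) (dbr sf) sw sewc Oq).
have -> : br f (fun q => e * (wt q * c q)) q = 0.
  rewrite (dM _ _ _ (smooth_fun_cst oO _) (smooth_funM oO swt sc) Oq) br_cst mul0r add0r.
  rewrite (dM _ _ _ swt sc Oq).
  have -> : br f wt q = 0.
    rewrite brE /crbr /cross.
    have E a : vder (eV a) wt q = 0 by exact: (ddir_wt bundle af vo Oq (eV_db af a Oq)).
    rewrite (E 0) (E 1) (E 2%:R).
    move: (vder (eV 0) f q) (vder (eV 1) f q) (vder (eV 2%:R) f q) => a0 a1 a2.
    move: (dens q)^-1 (bt 0 q) (bt 1 q) (bt 2%:R q) => n b0 b1 b2; ring.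
  have -> : br f c q = 0.
    have E := casimirP bundle af vO vo cg fb hb Oq sc (fun W => casimir W Oq).
    rewrite br_anti br_cross (E 0) (E 1) (E 2%:R).
    move: (vder (eV 0) f q) (vder (eV 1) f q) (vder (eV 2%:R) f q) (dens q)^-1 => a0 a1 a2 n.
    by rewrite !mul0r !addr0 mulr0 oppr0.
  by rewrite mul0r mulr0 addr0 mulr0.
by rewrite subr0 br_anti opprK.
Qed.

Hypothesis den0 : forall q, O q -> gauge_denom q != 0.

Let iden q : R := (gauge_denom q)^-1.
Let siden : S iden. Proof. by apply: (smooth_funV oO) smooth_gauge_denom => q /den0. Qed.

Let iden_der f q : S f -> O q -> br f iden q = iden q ^+ 2 * (br f K q * u q + K q * br f u q).
Proof.
move=> sf Oq; rewrite (br_inv _ smooth_gauge_denom Oq (den0 Oq)).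
rewrite (local_br f (fun p Op => gauge_denomE Op) Oq).
have [_ _ dM _] := dbr sf.
rewrite (derivation_sub (@smooth_funN _ _ _ _ oO) (dbr sf) (smooth_fun_cst oO 1) (smooth_funM oO sK su) Oq).
rewrite br_cst (dM _ _ _ sK su Oq) sub0r opprK /iden exprVn mulrC //.
Qed.

(** [br] does not involve the connection, so the old and the new triple share it; only the two
    derivations and the coefficient K change. *)
Lemma gauge_triple q : O q ->
  [/\ forall W, wedge (d01 gauge_conn 0 beta q) (beta q) W = 0,
      forall W, kappa q / gauge_denom q *
        (d10 gauge_conn 0 beta q W - wedge (theta pi Omega omega gauge_conn q) (beta q) W) = 0 &
      forall W, wedge (d01 gauge_conn 0 (fun_form (fun q => kappa q / gauge_denom q)) q) (beta q) W -
        (kappa q / gauge_denom q) ^+ 2 * varrho pi Omega omega gauge_conn q W = 0].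
Proof.
move=> Oq; have op p (Op : O p) := (triple_equations bundle af vO vo fb cg hb sk Op).1 (tE Op).
have skd : S (fun q => kappa q / gauge_denom q) by exact: (smooth_funM oO sk siden).
apply/(triple_equations bundle af vO vo fb gauge_connection gauge_horizontal skd Oq).
have cE : coef pi cB omega (fun q => kappa q / gauge_denom q) = fun q => K q * iden q.
  by apply/funext => p; rewrite /coef /K /coef mulrAC.
have jac f g h p : S f -> S g -> S h -> O p ->
    br f (br g h) p + br g (br h f) p + br h (br f g) p = 0.
  by move=> sf sg sh Op; have [h1 _ _] := op p Op; exact: (br_jacobi bundle af vO vo fb).
have def i f h p : S f -> S h -> O p -> K p * defect br (vder (Yg i)) f h p = 0.
  by move=> sf sh Op; have [_ h2 _] := op p Op; exact: h2.
have anti f h p : br f h p = - br h f p by exact: br_anti.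
have vg i f : S f -> forall p, O p -> vder (eY pi cB z gauge_conn i) f p = vder (Yg i) f p + br (m i) f p.
  by move=> sf p Op; exact: vder_gauge.
have sbr f h : S f -> S h -> S (br f h) by move=> sf sh; have [b _ _ _] := dbr sf; exact: b.
rewrite cE; split; first by have [h1 _ _] := op q Oq.
- move=> i f h sf sh.
  have -> : defect br (vder (eY pi cB z gauge_conn i)) f h q =
      defect br (fun f q => vder (Yg i) f q + br (m i) f q) f h q.
    rewrite /defect (vg i _ (sbr _ _ sf sh) q Oq) (local_br f (vg i h sh) Oq); congr (_ - _ - _).
    by rewrite (anti _ h) (local_br h (vg i f sf) Oq) -anti.
  rewrite (gauge_defect dbr anti jac (dY i) (sm i) sf sh Oq).
  by rewrite mulrAC (def i f h q sf sh Oq) mul0r.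
- move=> f sf; have brK p g (sg : S g) (Op : O p) : br K g p = K p ^+ 2 *
      (vder (Yg 0) (vder (Yg 1) g) p - vder (Yg 1) (vder (Yg 0) g) p).
    by have [_ _ h3] := op p Op; exact: h3.
  have dg i : derivation O S (vder (eY pi cB z gauge_conn i)) := derivation_eY bundle af gauge_connection i.
  have s2 i : S (fun p => vder (Yg i) f p + br (m i) f p).
    by have [y _ _ _] := dY i; exact: (smooth_funD oO (y _ sf) (sbr _ _ (sm i) sf)).
  have YY i j : vder (eY pi cB z gauge_conn i) (vder (eY pi cB z gauge_conn j) f) q =
      vder (Yg i) (fun p => vder (Yg j) f p + br (m j) f p) q
      + br (m i) (fun p => vder (Yg j) f p + br (m j) f p) q.
    by rewrite -(vg i _ (s2 j) q Oq); exact: (ddir_near oO _ Oq (vg j f sf)).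
  rewrite (YY 0 1) (YY 1 0).
  apply: (gauge_brK (smooth_funD oO) (@smooth_funN _ _ _ _ oO) dbr anti jac (dY 0) (dY 1) sK (def 0) (def 1)
    (fun g p sg Op => brK p g sg Op) (sm 0) (sm 1) siden bru _ iden_der sf Oq).
  by move=> p Op; rewrite /iden gauge_denomE // mulVf // -gauge_denomE // den0.
Qed.

End GaugeTransformation.

(** * The family of Poisson tensors *)

Lemma smooth_on_id (R : realType) n (U : set 'rV[R]_n) : open U -> smooth_on U id.
Proof.
move=> oU [|k]; first by move=> x _; exact: cvg_id.
split=> [x _|v]; first exact: ex_diff.
have -> : (fun x => 'D_v id x) = fun _ : 'rV[R]_n => v by apply/funext => x; exact: derive_id.
exact: smooth_on_cst.
Qed.

Lemma smooth_on_rsubmx (R : realType) m n (U : set 'rV[R]_(m + n)) :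
  open U -> smooth_on U rsubmx.
Proof.
move=> oU; apply/(smooth_on_mxP _ oU) => i j.
have /(smooth_on_mxP _ oU) /(_ i (rshift m j)) := smooth_on_id oU.
by apply: (smooth_on_ext oU) => x _; rewrite mxE.
Qed.

Section GaugeFamily.
Context {R : realType} {M : manifold R 5} {B : manifold R 2}.
Variable pi : M -> B.
Hypothesis bundle : fiber_bundle pi.
Variables (Omega : dform M 5) (omega : dform B 2) (psi : mvec B 2).
Hypotheses (vO : volume_form Omega) (vo : volume_form omega).
Hypotheses (mpsi : is_mvec setT psi) (psi_omega : forall b W, @iprod _ _ 2 0 (psi b) (omega b) W = -1).
Variables (gamma : M -> 'M[R]_5) (kappa : M -> R) (beta mu : dform M 1) (c : M -> R).
Hypotheses (pt : Poisson_triple pi Omega omega setT (Triple gamma kappa beta))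
  (fm : is_form setT mu) (hm : forall p v, vertical pi p v -> mu p v = 0)
  (sc : smooth_fun setT c)
  (casimir : forall p W, wedge (d01 gamma 0 (fun_form c) p) (beta p) W = 0).
Notation gconn := (gauge_conn pi Omega omega beta mu gamma).
Notation denom e := (gauge_denom pi Omega omega beta mu gamma e kappa c).

Let form_sub (W0 U : set M) k (a : dform M k) : W0 `<=` U -> is_form U a -> is_form W0 a.
Proof.
move=> WU [alt sm]; split=> [q /WU|c' W ac]; first exact: alt.
exact: smooth_on_open_sub (coord_set_sub WU) (sm c' W ac).
Qed.

Lemma triple_restrict W0 : [/\ connection pi W0 gamma, smooth_fun W0 kappa, is_form W0 beta,
  forall q v, W0 q -> horizontal gamma q v -> beta q v = 0 &
  [/\ is_form W0 mu, forall q v, W0 q -> vertical pi q v -> mu q v = 0 & smooth_fun W0 c]].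
Proof.
have [[sg vg] sk [fb hb] _] := pt; have WT : W0 `<=` setT by [].
split.
- split=> [c' ac|q _]; last exact: vg.
  exact: smooth_on_open_sub (coord_set_sub WT) (sg c' ac).
- exact: smooth_fun_sub WT sk.
- exact: form_sub WT fb.
- by move=> q v _; exact: hb.
- split; [exact: form_sub WT fm|by move=> q v _; exact: hm|exact: smooth_fun_sub WT sc].
Qed.

Lemma local_frame (U : set M) q : open U -> U q -> exists W0 cB z,
  [/\ adapted_frame pi W0 cB z, W0 q & W0 `<=` U].
Proof. exact: adapted_frame_exists. Qed.

Lemma gauge_is_triple e : open [set p | denom e p != 0] ->
  Poisson_triple pi Omega omega [set p | denom e p != 0]
    (Triple (gconn e) (fun p => kappa p / denom e p) beta).
Proof.
move=> oD; set D := [set p | _]; have [_ _ _ tE] := pt.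
have loc q : D q -> exists W0 cB z, [/\ adapted_frame pi W0 cB z, W0 q & W0 `<=` D].
  exact: local_frame.
have [_ _ fbD hbD _] := triple_restrict D.
split; [split|..].
- move=> c' ac; apply: smooth_on_local => x [ix Dx].
  have [W0 [cB [z [af Wq WD]]]] := loc _ Dx.
  have [cg sk fb hb [fm' hm' sc']] := triple_restrict W0.
  have [sg _] := gauge_connection bundle af vO vo fb fm' hm' cg hb e.
  by exists (coord_set c' W0) => //; exact: sg.
- move=> q Dq; have [W0 [cB [z [af Wq WD]]]] := loc _ Dq.
  have [cg sk fb hb [fm' hm' sc']] := triple_restrict W0.
  have [_ vg] := gauge_connection bundle af vO vo fb fm' hm' cg hb e.
  exact: vg.
- apply: smooth_fun_local => q Dq; have [W0 [cB [z [af Wq WD]]]] := loc _ Dq.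
  have [cg sk fb hb [fm' hm' sc']] := triple_restrict W0; have oW := af_open af.
  exists W0 => //; apply: (smooth_funM oW sk).
  apply: (smooth_funV oW _ (smooth_gauge_denom bundle af vO vo fb fm' hm' cg hb e sk sc')).
  by move=> p /WD.
- split=> // p v Dp; have [W0 [cB [z [af Wq WD]]]] := loc _ Dp.
  have [cg sk fb hb [fm' hm' sc']] := triple_restrict W0.
  exact: (gauge_horizontal bundle af vO vo fb fm' hm' cg hb Wq).
- move=> q Dq; have [W0 [cB [z [af Wq WD]]]] := loc _ Dq.
  have [cg sk fb hb [fm' hm' sc']] := triple_restrict W0.
  apply: (gauge_triple bundle af vO vo fb fm' hm' cg hb sk sc' _ _ _ Wq).
  + by move=> p W _; exact: casimir.
  + by move=> p _; exact: tE.
  + by move=> p /WD.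
Qed.

(** In a common adapted frame both sides have the same expression, which depends on the vertical
    fields and the density alone. *)
Lemma QV_gauge e : QV pi Omega omega (gconn e) = QV pi Omega omega gamma.
Proof.
apply/funext => q; have [W0 [cB [z [af Wq _]]]] := local_frame openT (I : setT q).
have [cg sk fb hb [fm' hm' sc']] := triple_restrict W0.
have cg' := gauge_connection bundle af vO vo fb fm' hm' cg hb e.
by rewrite (QVE bundle af vO vo cg Wq) (QVE bundle af vO vo cg' Wq).
Qed.

Lemma conn_shift_scale e : conn_shift pi Omega omega gamma (fun p W => e * beta p W) mu =
  fun p => e *: conn_shift pi Omega omega gamma beta mu p.
Proof.
apply/funext => p; apply/matrixP => i j; rewrite /conn_shift !mxE.
rewrite /iprod [RHS]mulrCA; congr (_ * _); rewrite mulr_sumr; apply: eq_bigr => J _.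
rewrite [RHS]mulrA; congr (_ * _); rewrite /wedge [RHS]mulrCA; congr (_ * _).
rewrite mulr_sumr; apply: eq_bigr => s _.
rewrite [RHS]mulrCA; congr (_ * _); exact: mulrCA.
Qed.

(** The 2-form is named by [get], so linearity in beta is read off its explicit expression in a
    frame. *)
Lemma mubracket_scale e p W :
  mubracket pi Omega omega gamma (fun p W => e * beta p W) mu p W =
  e * mubracket pi Omega omega gamma beta mu p W.
Proof.
have [W0 [cB [z [af Wq _]]]] := local_frame openT (I : setT p).
have [cg sk fb hb [fm' hm' sc']] := triple_restrict W0.
have fbe : is_form W0 (fun p W => e * beta p W : R).
  have oW := af_open af; case: fb => alt sm; split=> [q /alt|c' W' ac]; first exact: alternating_scale.
  have oC := coord_set_open c' oW.
  exact: (smooth_onM oC (smooth_on_cst oC e) (sm c' W' ac)).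
have hbe q v : W0 q -> horizontal gamma q v -> e * beta q v = 0.
  by move=> Wq' hv; rewrite hb // mulr0.
rewrite (mubracketE bundle af vO vo fbe fm' hm' cg hbe _ Wq).
rewrite (mubracketE bundle af vO vo fb fm' hm' cg hb _ Wq).
have -> f h : br pi cB z Omega omega (fun p W => e * beta p W) f h p =
    e * br pi cB z Omega omega beta f h p.
  rewrite !brE /crbr /cross /bt.
  move: (beta p (eV _ _ _ 0 p)) (beta p (eV _ _ _ 1 p)) (beta p (eV _ _ _ 2%:R p)) => b0 b1 b2.
  move: (dens _ _ _ _ _ p)^-1 => n.
  move: (vder _ f p) (vder _ f p) (vder _ f p) => x0 x1 x2.
  move: (vder _ h p) (vder _ h p) (vder _ h p) => y0 y1 y2.
  ring.
by move: (br _ _ _ _ _ _ _ _ _) (\det _) => x d; ring.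
Qed.

(** With e beta in place of beta, the shift and the bracket term each gain one factor e, and kappa
    gains another; the final scaling by the inverse of e restores kappa in the numerator and
    beta. *)
Lemma trans_gauge e : e != 0 ->
  rho e^-1 (Tmuc pi Omega omega mu c (rho e (Triple gamma kappa beta))) =
  Triple (gconn e) (fun p => kappa p / denom e p) beta.
Proof.
move=> e0; rewrite /rho /Tmuc /=; congr Triple.
- by rewrite conn_shift_scale.
- apply/funext => p; rewrite /gauge_denom /gauge_kap /varkappa.
  have -> : (fun p W => d10 gamma 1 mu p W + 2^-1 * mubracket pi Omega omega gamma (fun p W => e * beta p W) mu p W)
     = fun p W => d10 gamma 1 mu p W + e / 2 * mubracket pi Omega omega gamma beta mu p W.
    apply/funext => q; apply/funext => W; rewrite mubracket_scale; congr (_ + _).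
    by rewrite mulrA [2^-1 * e]mulrC.
  by rewrite !mulrA mulVf // mul1r.
- by apply/funext => p; apply/funext => W; rewrite mulrA mulVf // mul1r.
Qed.

(** The denominator is a polynomial in e with smooth coefficients; this gives openness of the domain
    and smoothness jointly in e and the point. *)
Lemma gauge_denom_affine W0 cB z : adapted_frame pi W0 cB z ->
  exists a b, [/\ smooth_fun W0 a, smooth_fun W0 b &
    forall e q, W0 q -> denom e q = 1 - e * kappa q * (a q + e * b q - c q)].
Proof.
move=> af; have [cg sk fb hb [fm' hm' sc']] := triple_restrict W0.
have oW := af_open af; have sw := smooth_iwt bundle af vo.
have [y0 _ _ _] := derivation_eY bundle af cg 0; have [y1 _ _ _] := derivation_eY bundle af cg 1.
have sm i := smooth_mu bundle af fm' i.
have [sb _ _ _] := br_derivation bundle af vO vo fb (sm 0).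
exists (fun q => (vder (eY pi cB z gamma 0) (mu_ pi cB z mu 1) q -
    vder (eY pi cB z gamma 1) (mu_ pi cB z mu 0) q) * (wt pi cB omega q)^-1).
exists (fun q => br pi cB z Omega omega beta (mu_ pi cB z mu 0) (mu_ pi cB z mu 1) q *
  (wt pi cB omega q)^-1).
split; [exact: (smooth_funM oW (smooth_funB oW (y0 _ (sm 1)) (y1 _ (sm 0))) sw)|
  exact: (smooth_funM oW (sb _ (sm 1)) sw)|].
move=> e q Wq; rewrite /gauge_denom /gauge_kap (varkappaE bundle af vO vo fb fm' hm' cg hb _ Wq).
by move: (vder _ _ q) (vder _ _ q) (br _ _ _ _ _ _ _ _ _) (wt _ _ _ q)^-1 => x y t i; ring.
Qed.

Lemma open_gauge_domain : open [set x : R * M | denom x.1 x.2 != 0].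
Proof.
rewrite openE => -[e p] /= d0.
have [W0 [cB [z [af Wp _]]]] := local_frame openT (I : setT p).
have [cg sk fb hb [fm' hm' sc']] := triple_restrict W0.
have [a [b [sa sb dE]]] := gauge_denom_affine af.
have cs g : smooth_fun W0 g -> g x.2 @[x --> ((e, p) : R * M)] --> g p.
  move=> sg; apply: (@cvg_comp _ _ _ snd g _ (nbhs p)); first exact: cvg_snd.
  exact: (smooth_fun_cont sg Wp).
have c1 : x.1 @[x --> ((e, p) : R * M)] --> e by exact: cvg_fst.
have cF : 1 - x.1 * kappa x.2 * (a x.2 + x.1 * b x.2 - c x.2) @[x --> ((e, p) : R * M)] -->
    1 - e * kappa p * (a p + e * b p - c p).
  apply: cvgB; first exact: cvg_cst.
  apply: cvgM; first exact: cvgM c1 (cs _ sk).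
  apply: cvgB; last exact: cs.
  by apply: cvgD; [exact: cs|exact: cvgM c1 (cs _ sb)].
have F0 : 1 - e * kappa p * (a p + e * b p - c p) != 0 by rewrite -dE.
have n1 : \forall x \near ((e, p) : R * M), 1 - x.1 * kappa x.2 * (a x.2 + x.1 * b x.2 - c x.2) != 0.
  exact: (cF _ (open_near (@open_neq R 0) F0)).
have n2 : \forall x \near ((e, p) : R * M), W0 x.2.
  exact: (cvg_snd (open_near (af_open af) Wp)).
by apply: filterS2 n1 n2 => x Fx Wx; rewrite /= dE.
Qed.

Lemma open_gauge_fiber e : open [set p | denom e p != 0].
Proof.
have cp : continuous (fun p : M => (e, p) : R * M).
  by move=> p; exact: (cvg_pair (f := fun=> e) (g := id) (G := nbhs e) (H := nbhs p) (cvg_cst e) cvg_id).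
by move/continuousP: cp => /(_ _ open_gauge_domain).
Qed.

Definition gauge_bivector e : mvec M 2 :=
  almost_coupling pi Omega omega psi (Triple (gconn e) (fun p => kappa p / denom e p) beta).

(** In an adapted frame near the point, each ingredient is polynomial in e with coefficients smooth
    on M, apart from the inverse of the denominator. *)
Lemma smooth_gauge_family : smooth_family (fun e => [set p | denom e p != 0]) gauge_bivector.
Proof.
split=> [|ch Xi ac]; first exact: open_gauge_domain.
apply: smooth_on_local => y0 [iy Dy].
have [W0 [cB [z [af Wq _]]]] := local_frame openT (I : setT (chart_inv ch (rsubmx y0))).
have [cg sk fb hb [fm' hm' sc']] := triple_restrict W0.
have oW := af_open af; have oC := coord_set_open ch oW.
have [a [b [sa sb dE]]] := gauge_denom_affine af.
pose V0 : set 'rV[R]_(1 + 5) := rsubmx @^-1` coord_set ch W0.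
have oT : open (@setT 'rV[R]_(1 + 5)) by exact: openT.
have oV0 : open V0.
  have cr : continuous (rsubmx : 'rV[R]_(1 + 5) -> 'rV[R]_5).
    by move=> y; exact: (smooth_on_rsubmx oT 0%N y I).
  by move/continuousP: cr => /(_ _ oC).
have sr V g : open V -> V `<=` V0 -> smooth_on (coord_set ch W0) g ->
    smooth_on V (fun y : 'rV[R]_(1 + 5) => g (rsubmx y) : R).
  by move=> oV VV; apply: (smooth_on_comp oV _ (smooth_on_rsubmx oV)) => y /VV.
have se V : open V -> smooth_on V (fun y : 'rV[R]_(1 + 5) => lsubmx y 0 0).
  move=> oV; have /(smooth_on_mxP _ oV) /(_ 0 (lshift 5 0)) := smooth_on_id oV.
  by apply: (smooth_on_ext oV) => y _; rewrite mxE.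
pose F (y : 'rV[R]_(1 + 5)) := denom (lsubmx y 0 0) (chart_inv ch (rsubmx y)).
have sF V : open V -> V `<=` V0 -> smooth_on V F.
  move=> oV VV; have s g (sg : smooth_fun W0 g) := sr V _ oV VV (sg ch ac).
  have s1 := smooth_onM oV (smooth_onM oV (se V oV) (s _ sk))
    (smooth_onB oV (smooth_onD oV (s _ sa) (smooth_onM oV (se V oV) (s _ sb))) (s _ sc')).
  apply: (smooth_on_ext oV _ (smooth_onB oV (smooth_on_cst oV (1 : R^o)) s1)).
  by move=> y /VV [iy' Wy]; rewrite /F dE.
(* Restricts to the pairs where the frame exists and the denominator does not vanish. *)
pose V := V0 `&` F @^-1` [set r | r != 0].
have VV : V `<=` V0 by move=> y [].
have oV : open V.
  rewrite openE => y [Vy Fy].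
  have n2 := sF V0 oV0 (@subset_refl _ V0) 0%N y Vy _ (open_near (@open_neq R 0) Fy).
  by apply: filterS2 (open_near oV0 Vy) n2.
exists V; first by split.
have s g (sg : smooth_fun W0 g) := sr V _ oV VV (sg ch ac).
have sm m (A : M -> 'M[R]_(m, 5)) i j : smooth_vfs W0 A ->
    smooth_on V (fun y => mx_in ch A (rsubmx y) i j).
  by move=> sA; apply: (sr V (fun x => mx_in ch A x i j) oV VV); move/(smooth_vfsP oW): sA; apply.
have sXi m (A : 'rV[R]_(1 + 5) -> 'M[R]_(m, 5)) : (forall i j, smooth_on V (fun y => A y i j)) ->
    forall i j, smooth_on V (fun y => (Xi *m (A y)^T) i j).
  move=> sA i j; apply: (smooth_on_ext oV _ (smooth_on_sum oV (index_enum 'I_5) (P := predT)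
    (fun l _ => smooth_onM oV (smooth_on_cst oV (Xi i l)) (sA j l)))) => y _.
  by rewrite !mxE; apply: eq_bigr => l _; congr (_ * _); rewrite mxE.
have sX := smooth_Xmu bundle af vO vo fb fm'.
(* The lifts for the shifted connection in the chart, affine in e. *)
pose Yy (y : 'rV[R]_(1 + 5)) : 'M[R]_(2, 5) :=
  \matrix_(i, j) (mx_in ch (Yh pi cB z gamma) (rsubmx y) i j + lsubmx y 0 0 *
    \sum_a Xmu pi cB z Omega omega beta mu (chart_inv ch (rsubmx y)) i a *
      mx_in ch (Dz pi cB z) (rsubmx y) a j).
have sY i j : smooth_on V (fun y => Yy y i j).
  apply: (smooth_on_ext oV _ (smooth_onD oV (sm _ _ i j (smooth_Yh bundle af cg))
    (smooth_onM oV (se V oV) (smooth_on_sum oV (index_enum 'I_3) (P := predT)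
    (fun l _ => smooth_onM oV (s _ (sX i l)) (sm _ _ l j (smooth_Dz bundle af))))))) => y _.
  by rewrite /Yy [RHS]mxE.
have s1 : smooth_on V (fun y => \det (Xi *m (Yy y)^T)) by apply: (smooth_on_det oV); exact: sXi sY.
have s2 : smooth_on V (fun y => \det (@col_mx R 1 2 3
    (\row_l bt pi cB z beta l (chart_inv ch (rsubmx y))) (Xi *m (mx_in ch (Dz pi cB z) (rsubmx y))^T))).
  apply: (smooth_on_det oV) => i j; case: (split_ordP (i : 'I_(1 + 2))) => i' ->.
    apply: (smooth_on_ext oV _ (s _ (smooth_bt bundle af fb j))) => y _.
    by rewrite (@col_mxEu _ 1 2 3) mxE.
  have sD k l := sm _ _ k l (smooth_Dz bundle af).
  by apply: (smooth_on_ext oV _ (sXi _ _ sD i' j)) => y _; rewrite (@col_mxEd _ 1 2 3).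
have sV : smooth_on V (fun y => (F y)^-1) by apply: (smooth_onV oV) (sF V oV VV) => y [].
have s3 := smooth_onM oV (smooth_onM oV (s _ sk) sV) (s _ (smooth_iwt bundle af vo)).
apply: (smooth_on_ext oV _ (smooth_onD oV (smooth_onM oV s3 s1)
  (smooth_onM oV (s _ (smooth_idens bundle af vO vo)) s2))) => y [[iy' Wy] _].
have cg' := gauge_connection bundle af vO vo fb fm' hm' cg hb.
have hb' e q v : W0 q -> horizontal (gconn e) q v -> beta q v = 0.
  by move=> Wq'; exact: (gauge_horizontal bundle af vO vo fb fm' hm' cg hb Wq').
rewrite /mvec_in /gauge_bivector.
rewrite (almost_couplingE bundle vO vo mpsi psi_omega af fb (cg' _) (hb' _) _ _ Wy).
rewrite [in RHS](gauge_Yh bundle af vO vo fb fm' hm' cg hb _ Wy).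
rewrite -!mulmxA -!trmx_mul; congr (_ * \det (Xi *m _^T) + _).
apply/matrixP => i j; rewrite [LHS]mxE mulmxDl [RHS]mxE; congr (_ + _).
by rewrite -mulmxA -scalemxAl [RHS]mxE; congr (_ * _); rewrite [RHS]mxE.
Qed.

End GaugeFamily.

Theorem proposition6p2 (R : realType) (M : manifold R 5) (B : manifold R 2)
    (pi : M -> B) (Omega : dform M 5) (omega : dform B 2) (psi : mvec B 2)
    (gamma : M -> 'M[R]_5) (kappa : M -> R) (beta mu : dform M 1) (c : M -> R) :
  fiber_bundle pi ->
  volume_form Omega ->
  volume_form omega ->
  is_mvec setT psi ->
  (forall b W, @iprod _ _ 2 0 (psi b) (omega b) W = -1) ->
  Poisson_triple pi Omega omega setT (Triple gamma kappa beta) ->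
  is_form setT mu ->
  (forall p v, vertical pi p v -> mu p v = 0) ->
  smooth_fun setT c ->
  (forall p W, wedge (d01 gamma 0 (fun_form c) p) (beta p) W = 0) ->
  let Pi := almost_coupling pi Omega omega psi (Triple gamma kappa beta) in
  let gamma_ (e : R) (p : M) :=
    gamma p + e *: conn_shift pi Omega omega gamma beta mu p in
  let varkappa_ (e : R) := quot_area pi omega (fun p W =>
    d10 gamma 1 mu p W + e / 2 * mubracket pi Omega omega gamma beta mu p W) in
  let denom (e : R) (p : M) := 1 - e * kappa p * (varkappa_ e p - c p) in
  let Dom (e : R) : set M := [set p | denom e p != 0] in
  let Pi_ (e : R) : mvec M 2 := fun p Xi =>
    kappa p / denom e p * hor pi (gamma_ e) psi p Xi
    - @iprod _ _ 1 2 (beta p) (QV pi Omega omega gamma p) Xi in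
  let trans (e : R) : triple M :=
    rho e^-1 (Tmuc pi Omega omega mu c (rho e (Triple gamma kappa beta))) in
  [/\ forall e, open (Dom e),
      forall e, e != 0 ->
        Poisson_triple pi Omega omega (Dom e) (trans e) /\
        (forall p Xi, Dom e p ->
           Pi_ e p Xi = almost_coupling pi Omega omega psi (trans e) p Xi),
      Dom 0 = setT /\ (forall p Xi, Pi_ 0 p Xi = Pi p Xi),
      forall e, Poisson (Dom e) (Pi_ e) &
      smooth_family Dom Pi_].
Proof.
move=> bundle vO vo mpsi psi_omega pt fm hm sc casimir Pi gamma_ varkappa_ denom Dom Pi_ trans.
have oD e : open (Dom e) := open_gauge_fiber bundle vO vo pt fm hm sc e.
have tD e : Poisson_triple pi Omega omega (Dom e) (Triple (gamma_ e) (fun p => kappa p / denom e p) beta).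
  exact: (gauge_is_triple bundle vO vo pt fm hm sc casimir (oD e)).
(* [Pi_] is written with the 3-vector of the original connection, the almost coupling tensor with
   that of the shifted one; they coincide. *)
have PiE : Pi_ = gauge_bivector pi Omega omega psi gamma kappa beta mu c.
  apply/funext => e; apply/funext => p; apply/funext => Xi.
  by rewrite /gauge_bivector /almost_coupling /Pbeta /= (QV_gauge bundle vO vo pt fm hm sc).
have tE e : e != 0 -> trans e = Triple (gamma_ e) (fun p => kappa p / denom e p) beta.
  exact: (trans_gauge bundle vO vo pt fm hm sc).
split; first exact: oD.
- move=> e e0; rewrite (tE e e0); split=> [|p Xi _]; first exact: tD.
  by rewrite PiE.
- have d0 p : denom 0 p = 1 by rewrite /denom mul0r mul0r subr0.
  split; first by apply/seteqP; split=> p _ //; rewrite /Dom /= d0 oner_eq0.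
  move=> p Xi; rewrite /Pi_ d0 divr1 /Pi /almost_coupling /Pbeta /=; congr (_ * _ + _).
  by rewrite /hor /hlift /gamma_ scale0r addr0.
- move=> e; rewrite PiE; exact: (Poisson_triple_Poisson bundle vO vo mpsi psi_omega (oD e) (tD e)).
- rewrite PiE; exact: (smooth_gauge_family bundle vO vo mpsi psi_omega pt fm hm sc).
Qed.
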